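(* There is a constant $C>0$ such that for all $f\in\mathrm{BMOSH}(\mathbb{D})$ $$\|f\|_{\mathcal{B}}\le C\,\|f\|_{\mathrm{BMOSH}(\mathbb{D})}.$$ Hence $\mathrm{BMOSH}(\mathbb{D})\subset\mathcal{B}(\mathbb{D})$ and $\mathrm{VMOSH}(\mathbb{D})\subset\mathcal{B}_0(\mathbb{D})$, where these inclusions are continuous.
   Context: Let $\mathbb{H}$ be the quaternions, $\mathbb{S}=\{x\in\mathbb{H}:\mathrm{Re}(x)=0,|x|=1\}$, $\mathbb{C}_i=\{x_0+ix_1:x_0,x_1\in\mathbb{R}\}$ for $i\in\mathbb{S}$, $\mathbb{D}$ the open unit ball of $\mathbb{H}$, $\mathbb{D}_i=\mathbb{D}\cap\mathbb{C}_i$. Every $x\in\mathbb{H}$ is written $x=x_0+i_xx_1$ with $x_0=\mathrm{Re}(x)$, $x_1=|\mathrm{Im}(x)|\ge 0$, $i_x\in\mathbb{S}$. A real differentiable $f:\mathbb{D}\to\mathbb{H}$ is (left) slice hyperholomorphic, $f\in\mathcal{SH}_L(\mathbb{D})$, if $f(x)=\alpha(x_0,x_1)+i_x\beta(x_0,x_1)$ for all $x\in\mathbb{D}$, where the $\mathbb{H}$-valued functions $\alpha,\beta$ satisfy $\alpha(x_0,-x_1)=\alpha(x_0,x_1)$, $\beta(x_0,-x_1)=-\beta(x_0,x_1)$, $\partial_{x_0}\alpha=\partial_{x_1}\beta$, $\partial_{x_0}\beta=-\partial_{x_1}\alpha$. The slice derivative of such $f$ is $\partial_Sf(s)=\lim_{\mathbb{C}_{i_s}\ni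 p\to s}(p-s)^{-1}(f(p)-f(s))=\frac{\partial}{\partial s_0}f(s)$. The Bloch space $\mathcal{B}(\mathbb{D})$ is the set of $f\in\mathcal{SH}_L(\mathbb{D})$ with $\|f\|_{\mathcal{B}}=|f(0)|+\sup_{s\in\mathbb{D}}(1-|s|^2)|\partial_Sf(s)|<\infty$. The little Bloch space $\mathcal{B}_0(\mathbb{D})$ is the set of $f\in\mathcal{B}(\mathbb{D})$ with $\lim_{|s|\nearrow1}(1-|s|^2)|\partial_Sf(s)|=0$, with the norm of $\mathcal{B}(\mathbb{D})$. $\mathcal{H}^2(\mathbb{D})$ is the set of $f\in\mathcal{SH}_L(\mathbb{D})$ with $\sup_{i\in\mathbb{S}}\lim_{r\nearrow1}\frac1{2\pi}\int_0^{2\pi}|f(re^{i\theta})|^2\,d\theta<\infty$; boundary values $f(e^{i\theta})$ are radial limits (existing for almost every $\theta$). For $f\in\mathcal{H}^2(\mathbb{D})$, $i\in\mathbb{S}$ and an interval $I=(\alpha,\beta)\subset\mathbb{R}$ with $|I|=\beta-\alpha\le2\pi$, let $f_{I,i}=\frac1{|I|}\int_If(e^{i\theta})\,d\theta$, and put $|f|_{\mathrm{BMOSH}(\mathbb{D}_i)}^2=\sup_{|I|\le2\pi}\frac1{|I|}\int_I|f(e^{i\theta})-f_{I,i}|^2\,d\theta$, $|f|_{\mathrm{BMOSH}(\mathbb{D})}=\sup_{i\in\mathbb{S}}|f|_{\mathrm{BMOSH}(\mathbb{D}_i)}$. $\mathrm{BMOSH}(\mathbb{D})$ is the set of $f\in\mathcal{H}^2(\mathbb{D})$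 with $|f|_{\mathrm{BMOSH}(\mathbb{D})}<\infty$, with norm $\|f\|_{\mathrm{BMOSH}(\mathbb{D})}=|f(0)|+|f|_{\mathrm{BMOSH}(\mathbb{D})}$. $\mathrm{VMOSH}(\mathbb{D})$, with the same norm, is the set of $f\in\mathrm{BMOSH}(\mathbb{D})$ such that $\lim_{|I|\to0}\frac1{|I|}\int_I|f(e^{i\theta})-f_{I,i}|^2\,d\theta=0$ (uniformly over intervals $I\subset\mathbb{R}$ of length $|I|$) for all $i\in\mathbb{S}$. *)

(* Defs.v *)
From HB Require Import structures.
From mathcomp Require Import all_boot all_order all_algebra.
From mathcomp Require Import all_classical all_reals all_analysis.
From mathcomp Require Import ring.

Set Implicit Arguments.
Unset Strict Implicit.
Unset Printing Implicit Defensive.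

Import Order.TTheory GRing.Theory Num.Theory.
Import numFieldNormedType.Exports.

Local Open Scope classical_set_scope.
Local Open Scope ring_scope.

Record quat (R : Type) := Quat { q0 : R; q1 : R; q2 : R; q3 : R }.
Arguments Quat {R}.
Arguments q0 {R}.
Arguments q1 {R}.
Arguments q2 {R}.
Arguments q3 {R}.

Section QuatAlgebra.
Context {R : realType}.
Implicit Types x y z : quat R.

Definition quat_prod x := (q0 x, q1 x, q2 x, q3 x).
Definition prod_quat (p : R * R * R * R) :=
  Quat p.1.1.1 p.1.1.2 p.1.2 p.2.
Lemma quat_prodK : cancel quat_prod prod_quat. Proof. by case. Qed.
HB.instance Definition _ := Choice.copy (quat R) (can_type quat_prodK).

Lemma quatP x y : q0 x = q0 y -> q1 x = q1 y -> q2 x = q2 y -> q3 x = q3 y ->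
  x = y.
Proof. by case: x y => [? ? ? ?] [? ? ? ?] /= -> -> -> ->. Qed.

Definition quat_add x y :=
  Quat (q0 x + q0 y) (q1 x + q1 y) (q2 x + q2 y) (q3 x + q3 y).
Definition quat_opp x := Quat (- q0 x) (- q1 x) (- q2 x) (- q3 x).
Definition quat_zero : quat R := Quat 0 0 0 0.
Definition quat_one : quat R := Quat 1 0 0 0.
Definition quat_mul x y := Quat
  (q0 x * q0 y - q1 x * q1 y - q2 x * q2 y - q3 x * q3 y)
  (q0 x * q1 y + q1 x * q0 y + q2 x * q3 y - q3 x * q2 y)
  (q0 x * q2 y - q1 x * q3 y + q2 x * q0 y + q3 x * q1 y)
  (q0 x * q3 y + q1 x * q2 y - q2 x * q1 y + q3 x * q0 y).
Definition quat_scale (a : R) x := Quat (a * q0 x) (a * q1 x) (a * q2 x) (a * q3 x).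

Local Ltac quat_ring := intros; apply: quatP => /=; ring.

Lemma quat_addA : associative quat_add. Proof. by move=> *; quat_ring. Qed.
Lemma quat_addC : commutative quat_add. Proof. by move=> *; quat_ring. Qed.
Lemma quat_add0 : left_id quat_zero quat_add. Proof. by move=> *; quat_ring. Qed.
Lemma quat_addN : left_inverse quat_zero quat_opp quat_add.
Proof. by move=> *; quat_ring. Qed.
HB.instance Definition _ :=
  GRing.isZmodule.Build (quat R) quat_addA quat_addC quat_add0 quat_addN.

Lemma quat_mulA : associative quat_mul. Proof. by move=> *; quat_ring. Qed.
Lemma quat_mul1l : left_id quat_one quat_mul. Proof. by move=> *; quat_ring. Qed.
Lemma quat_mul1r : right_id quat_one quat_mul. Proof. by move=> *; quat_ring. Qed.
Lemma quat_mulDl : left_distributive quat_mul +%R.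
Proof. by move=> *; quat_ring. Qed.
Lemma quat_mulDr : right_distributive quat_mul +%R.
Proof. by move=> *; quat_ring. Qed.
Lemma quat_one_neq0 : quat_one != 0.
Proof. by apply/eqP => -[] /eqP; rewrite oner_eq0. Qed.
HB.instance Definition _ := GRing.Zmodule_isNzRing.Build (quat R)
  quat_mulA quat_mul1l quat_mul1r quat_mulDl quat_mulDr quat_one_neq0.

Lemma quat_scaleA a b x : quat_scale a (quat_scale b x) = quat_scale (a * b) x.
Proof. by quat_ring. Qed.
Lemma quat_scale1 : left_id 1 quat_scale. Proof. by move=> *; quat_ring. Qed.
Lemma quat_scaleDr : right_distributive quat_scale +%R.
Proof. by move=> *; quat_ring. Qed.
Lemma quat_scaleDl x : {morph quat_scale^~ x : a b / a + b}.
Proof. by move=> *; quat_ring. Qed.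
HB.instance Definition _ := GRing.Zmodule_isLmodule.Build R (quat R)
  quat_scaleA quat_scale1 quat_scaleDr quat_scaleDl.

Lemma quat_scaleAl (a : R) x y : a *: (x * y) = (a *: x) * y.
Proof. by quat_ring. Qed.
HB.instance Definition _ :=
  GRing.Lmodule_isLalgebra.Build R (quat R) quat_scaleAl.
Lemma quat_scaleAr (a : R) x y : a *: (x * y) = x * (a *: y).
Proof. by quat_ring. Qed.
HB.instance Definition _ :=
  GRing.Lalgebra_isAlgebra.Build R (quat R) quat_scaleAr.

Definition quat_sqnorm x := q0 x ^+ 2 + q1 x ^+ 2 + q2 x ^+ 2 + q3 x ^+ 2.
Definition quat_conj x := Quat (q0 x) (- q1 x) (- q2 x) (- q3 x).
Definition quat_inv x := (quat_sqnorm x)^-1 *: quat_conj x.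

Lemma quat_sqnorm_ge0 x : 0 <= quat_sqnorm x.
Proof. by rewrite !addr_ge0 ?sqr_ge0. Qed.

Lemma quat_sqnorm_eq0 x : (quat_sqnorm x == 0) = (x == 0).
Proof.
apply/eqP/eqP => [|->]; last by rewrite /quat_sqnorm /= expr0n /= !addr0.
move=> /eqP; rewrite !paddr_eq0 ?addr_ge0 ?sqr_ge0// !sqrf_eq0.
by move=> /andP[/andP[/andP[/eqP ? /eqP ?] /eqP ?] /eqP ?]; apply: quatP.
Qed.

Lemma quat_mulVr : {in [pred x | x != 0], left_inverse 1 quat_inv *%R}.
Proof.
move=> x; rewrite inE -quat_sqnorm_eq0 => x0.
rewrite /quat_inv -scalerAl -[RHS](scale1r 1) -[in RHS](mulVf x0) -scalerA.
by congr (_ *: _); apply: quatP; rewrite /quat_sqnorm /=; ring.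
Qed.

Lemma quat_divrr : {in [pred x | x != 0], right_inverse 1 quat_inv *%R}.
Proof.
move=> x; rewrite inE -quat_sqnorm_eq0 => x0.
rewrite /quat_inv -scalerAr -[RHS](scale1r 1) -[in RHS](mulVf x0) -scalerA.
by congr (_ *: _); apply: quatP; rewrite /quat_sqnorm /=; ring.
Qed.

Lemma quat_unitrP x y : y * x = 1 /\ x * y = 1 -> x != 0.
Proof.
move=> [yx _]; apply/eqP => x0; move: yx; rewrite x0 mulr0.
by move/esym/eqP; rewrite oner_eq0.
Qed.

Lemma quat_inv_out : {in [predC [pred x | x != 0]], quat_inv =1 id}.
Proof.
move=> x; rewrite !inE negbK => /eqP ->.
by apply: quatP => /=; rewrite ?oppr0 mulr0.
Qed.
HB.instance Definition _ := GRing.NzRing_hasMulInverse.Build (quat R)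
  quat_mulVr quat_divrr quat_unitrP quat_inv_out.

Definition quat_norm x : R := Num.sqrt (quat_sqnorm x).

Lemma quat_normD x y : quat_norm (x + y) <= quat_norm x + quat_norm y.
Proof.
rewrite /quat_norm -(@ger0_norm _ (_ + _)) ?addr_ge0 ?sqrtr_ge0// -sqrtr_sqr.
apply: ler_wsqrtr; rewrite sqrrD !sqr_sqrtr ?quat_sqnorm_ge0//.
pose d := q0 x * q0 y + q1 x * q1 y + q2 x * q2 y + q3 x * q3 y.
have -> : quat_sqnorm (x + y) = quat_sqnorm x + d *+ 2 + quat_sqnorm y.
  by rewrite /quat_sqnorm /d /=; ring.
rewrite lerD2r lerD2l ler_pMn2r// -sqrtrM ?quat_sqnorm_ge0//.
apply: le_trans (ler_norm _) _; rewrite -sqrtr_sqr; apply: ler_wsqrtr.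
rewrite -subr_ge0.
have -> : quat_sqnorm x * quat_sqnorm y - d ^+ 2 =
  (q0 x * q1 y - q1 x * q0 y) ^+ 2 + (q0 x * q2 y - q2 x * q0 y) ^+ 2 +
  (q0 x * q3 y - q3 x * q0 y) ^+ 2 + (q1 x * q2 y - q2 x * q1 y) ^+ 2 +
  (q1 x * q3 y - q3 x * q1 y) ^+ 2 + (q2 x * q3 y - q3 x * q2 y) ^+ 2.
  by rewrite /quat_sqnorm /d; ring.
by rewrite !addr_ge0 ?sqr_ge0.
Qed.

Lemma quat_normZ (a : R) x : quat_norm (a *: x) = `|a| * quat_norm x.
Proof.
rewrite /quat_norm -sqrtr_sqr -sqrtrM ?sqr_ge0//; congr (Num.sqrt _).
by rewrite /quat_sqnorm /=; ring.
Qed.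

Lemma quat_norm0_eq0 x : quat_norm x = 0 -> x = 0.
Proof.
move/eqP; rewrite sqrtr_eq0 le_eqVlt ltNge quat_sqnorm_ge0 orbF.
by rewrite quat_sqnorm_eq0 => /eqP.
Qed.
HB.instance Definition _ := Lmodule_isNormed.Build R (quat R)
  quat_normD quat_normZ quat_norm0_eq0.

Lemma quat_normE x : `|x| = Num.sqrt (quat_sqnorm x). Proof. by []. Qed.

Lemma quat_normM x y : `|x * y| = `|x| * `|y|.
Proof.
rewrite !quat_normE -sqrtrM ?quat_sqnorm_ge0//; congr (Num.sqrt _).
by rewrite /quat_sqnorm /=; ring.
Qed.

Definition quat_Re x : R := q0 x.
Definition quat_Im x : quat R := Quat 0 (q1 x) (q2 x) (q3 x).

Definition imag_sphere : set (quat R) := [set i | quat_Re i = 0 /\ `|i| = 1].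

(* The unit i_x with x = Re x + i_x |Im x|; it is not unique for real x, where
   the first basis unit is chosen. *)
Definition imag_unit x : quat R :=
  if quat_Im x == 0 then Quat 0 1 0 0 else `|quat_Im x|^-1 *: quat_Im x.

Lemma imag_unit_sphere x : imag_sphere (imag_unit x).
Proof.
rewrite /imag_unit; case: eqVneq => [_|x0]; split => /=.
- by [].
- by rewrite quat_normE /quat_sqnorm /= expr0n expr1n /= add0r !addr0 sqrtr1.
- by rewrite /quat_Re /= mulr0.
- by rewrite normrZ normfV normr_id mulVf // normr_eq0.
Qed.

Lemma imag_unitE x : x = (quat_Re x)%:A + `|quat_Im x| *: imag_unit x.
Proof.
rewrite /imag_unit; case: eqVneq => [x0|x0].
  rewrite x0 normr0 scale0r addr0.
  by case: x0 => a b c; apply: quatP => /=; rewrite ?mulr1 ?mulr0.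
rewrite scalerA divff ?normr_eq0// scale1r.
by apply: quatP => /=; rewrite ?mulr1 ?mulr0 ?addr0 ?add0r.
Qed.

Definition slice_plane (i : quat R) : set (quat R) :=
  [set p | exists u v : R, p = u%:A + v *: i].

Definition cis (i : quat R) (t : R) : quat R := (cos t)%:A + sin t *: i.

Definition quat_integral (A : set R) (g : R -> quat R) : quat R :=
  let int h := \int[lebesgue_measure]_(t in A) (h (g t)) in
  Quat (int q0) (int q1) (int q2) (int q3).

End QuatAlgebra.

Section Spaces.
Context {R : realType}.
Implicit Types (f g : quat R -> quat R) (i x s : quat R).

(* A function on the open unit ball is represented by a total function; every
   notion below only involves its values on the ball. *)
Definition slice_hyperholomorphic f : Prop :=
  (forall x, `|x| < 1 -> differentiable f x) /\
  exists alpha beta : R -> R -> quat R,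
  [/\ forall x, `|x| < 1 ->
        f x = alpha (quat_Re x) `|quat_Im x| +
              imag_unit x * beta (quat_Re x) `|quat_Im x|,
      forall u v : R, u ^+ 2 + v ^+ 2 < 1 ->
        alpha u (- v) = alpha u v /\ beta u (- v) = - beta u v &
      forall u v : R, u ^+ 2 + v ^+ 2 < 1 ->
        [/\ derivable (alpha ^~ v) u 1 /\ derivable (alpha u) v 1,
            derivable (beta ^~ v) u 1 /\ derivable (beta u) v 1,
            derive1 (alpha ^~ v) u = derive1 (beta u) v &
            derive1 (beta ^~ v) u = - derive1 (alpha u) v]].

Definition slice_derivative f s : quat R :=
  lim ((p - s)^-1 * (f p - f s)
    @[p --> within (slice_plane (imag_unit s)) s^']).

Definition bloch_norm f : \bar R :=
  (`|f 0|%R%:E + ereal_sup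
    [set ((1 - `|s| ^+ 2) * `|slice_derivative f s|)%R%:E
      | s in [set s : quat R | (`|s| < 1)%R]])%E.

Definition bloch : set (quat R -> quat R) :=
  [set f | slice_hyperholomorphic f /\ (bloch_norm f < +oo)%E].

Definition little_bloch : set (quat R -> quat R) :=
  [set f | bloch f /\
    forall e : R, 0 < e -> exists2 r : R, r < 1 &
      forall s, r < `|s| -> `|s| < 1 ->
        (1 - `|s| ^+ 2) * `|slice_derivative f s| < e].

Definition circle_mean f i (r : R) : \bar R :=
  (((2 * pi)^-1)%R%:E *
    \int[lebesgue_measure]_(t in `[0%R, (2 * pi)%R]) (`|f (r *: cis i t)| ^+ 2)%R%:E)%E.

(* The existence of the limits, in [\bar R], is automatic for slice
   hyperholomorphic functions since the circular means increase with r. *)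
Definition hardy2 : set (quat R -> quat R) :=
  [set f | [/\ slice_hyperholomorphic f,
    forall i, imag_sphere i -> cvg (circle_mean f i r @[r --> 1^'-]) &
    (ereal_sup [set lim (circle_mean f i r @[r --> 1^'-]) | i in imag_sphere]
      < +oo)%E]].

(* Arbitrary at the angles, forming a null set for f in [hardy2], where the
   radial limit does not exist. *)
Definition boundary_value f i (t : R) : quat R :=
  lim (f (r *: cis i t) @[r --> (1 : R)^'-]).

Definition interval_mean f i (a b : R) : quat R :=
  (b - a)^-1 *: quat_integral `]a, b[ (boundary_value f i).

Definition oscillation f i (a b : R) : \bar R :=
  (((b - a)^-1)%R%:E * \int[lebesgue_measure]_(t in `]a, b[)
    (`|boundary_value f i t - interval_mean f i a b| ^+ 2)%R%:E)%E.

Definition bmosh_slice_seminorm f i : \bar R :=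
  sqrte (ereal_sup [set oscillation f i I.1 I.2
    | I in [set I : R * R | I.1 < I.2 /\ I.2 - I.1 <= 2 * pi]]).

Definition bmosh_seminorm f : \bar R :=
  ereal_sup [set bmosh_slice_seminorm f i | i in imag_sphere].

Definition bmosh_norm f : \bar R := (`|f 0|%R%:E + bmosh_seminorm f)%E.

Definition bmosh : set (quat R -> quat R) :=
  [set f | hardy2 f /\ (bmosh_seminorm f < +oo)%E].

Definition vmosh : set (quat R -> quat R) :=
  [set f | bmosh f /\
    forall i, imag_sphere i -> forall e : R, 0 < e ->
      exists2 d : R, 0 < d &
        forall a b : R, a < b -> b - a < d -> (oscillation f i a b < e%:E)%E].

(* Continuity of the inclusion map from (A, normA) to (B, normB) at every f. *)
Definition continuously_included (A B : set (quat R -> quat R))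
    (normA normB : (quat R -> quat R) -> \bar R) : Prop :=
  A `<=` B /\
  forall f, A f -> forall e : R, 0 < e ->
    exists2 d : R, 0 < d &
      forall g, A g -> (normA (g \- f)%R < d%:E)%E -> (normB (g \- f)%R < e%:E)%E.

End Spaces.

(* Main.v *)
(** Fix a slice, a unit [q] and put [U = Re (f conj q)]; with the companion
    obtained from [i q] it satisfies the Cauchy-Riemann equations, so Goursat's
    lemma applied to the contractions [r + l (e^{it} - r)] gives the Poisson
    formula.  Goursat applied to products of dilates makes the quadratic means
    midpoint convex in [log r]; being bounded in [H^2] they increase, hence [U]
    converges in [L^1] to a boundary function [g].  Integrating the Poisson
    formula by parts against the primitive [G] of [g], and Fatou's argument at
    the points where [G' = g], identify [g] with the radial limits.

    By Cauchy-Schwarz a mean oscillation at most [B^2] gives the Zygmund bound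
    [|G(x + t) + G(x - t) - 2 G(x)| <= 2 B t].  The tangential derivative of the
    Poisson integral pairs this second difference with the second derivative of
    the kernel, and is therefore [O(B / (1 - r^2))]; letting [q] vary bounds the
    slice derivative.  For vanishing mean oscillation the bound is
    [2 eps t + C t^4], which adds only [O(1 - r^2)].  The representation formula
    transfers the estimate on one slice to all slices, whence uniformity. *)
Require Import Defs.
From HB Require Import structures.
From mathcomp Require Import all_boot all_order all_algebra.
From mathcomp Require Import all_classical all_reals all_analysis.
From mathcomp Require Import measurable_realfun ring lra.

Import Order.TTheory GRing.Theory Num.Theory.
Import numFieldNormedType.Exports.

Local Open Scope classical_set_scope.
Local Open Scope ring_scope.

(** * Real calculus *)

Section Calculus.
Context {R : realType}.
Implicit Types (f g : R -> R) (F G : R * R -> R) (p : R * R).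

Definition has_deriv f (x d : R) : Prop := is_derive x 1 f d.

Lemma has_deriv_cst (c x : R) : has_deriv (fun=> c) x 0.
Proof. exact: is_derive_cst. Qed.

Lemma has_deriv_id (x : R) : has_deriv (fun y => y) x 1.
Proof. exact: is_derive_id. Qed.

Lemma has_derivD {f g : R -> R} {x a b : R} : has_deriv f x a -> has_deriv g x b ->
  has_deriv (fun y => f y + g y) x (a + b).
Proof. by move=> fa gb; apply: is_deriveD. Qed.

Lemma has_derivN {f : R -> R} {x a : R} : has_deriv f x a -> has_deriv (fun y => - f y) x (- a).
Proof. by move=> fa; apply: is_deriveN. Qed.

Lemma has_derivB {f g : R -> R} {x a b : R} : has_deriv f x a -> has_deriv g x b ->
  has_deriv (fun y => f y - g y) x (a - b).
Proof. by move=> fa gb; apply: has_derivD => //; apply: has_derivN. Qed.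

Lemma has_derivM {f g : R -> R} {x a b : R} : has_deriv f x a -> has_deriv g x b ->
  has_deriv (fun y => f y * g y) x (a * g x + f x * b).
Proof.
move=> fa gb; apply: is_derive_eq; first exact: (@is_deriveM _ _ f g x 1 a b).
by rewrite addrC /GRing.scale /= [g x * a]mulrC.
Qed.

Lemma has_derivZ {f : R -> R} {x a : R} (c : R) : has_deriv f x a ->
  has_deriv (fun y => c * f y) x (c * a).
Proof. by move=> fa; apply: (@is_deriveZ _ _ _ f c x 1 a). Qed.

Lemma has_deriv_comp {f g : R -> R} {x a b : R} : has_deriv f x a -> has_deriv g (f x) b ->
  has_deriv (fun y => g (f y)) x (b * a).
Proof. by move=> fa gb; apply: (@is_derive1_comp _ g f x b a). Qed.

Lemma has_derivV {f : R -> R} {x a : R} : f x != 0 -> has_deriv f x a ->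
  has_deriv (fun y => (f y)^-1) x (- a / f x ^+ 2).
Proof.
move=> fx0 fa; apply: is_derive_eq; first exact: (is_deriveV (f:=f) fx0 fa).
by rewrite /GRing.scale /= mulrC mulrN mulNr.
Qed.

Lemma has_deriv_eq {f : R -> R} {x a b : R} : has_deriv f x a -> a = b -> has_deriv f x b.
Proof. by move=> ? <-. Qed.

Lemma has_deriv_cvg {f : R -> R} {x a : R} : has_deriv f x a -> {for x, continuous f}.
Proof.
by move=> fa; apply: differentiable_continuous; apply/derivable1_diffP; case: fa.
Qed.

Lemma has_derivP {f : R -> R} {x a : R} : derivable f x 1 -> derive1 f x = a -> has_deriv f x a.
Proof. by move=> df fa; apply: DeriveDef => //; rewrite -derive1E. Qed.

(** The partial derivatives appear as explicit numbers, so that every chain rule leaves only [ring]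
    identities between them. *)
Definition has_diff F p (a b : R) : Prop :=
  is_diff p F (fun h => a * h.1 + b * h.2).

Lemma has_diff_eq {F p} {a b a' b' : R} : has_diff F p a b -> a = a' -> b = b' ->
  has_diff F p a' b'.
Proof. by move=> ? <- <-. Qed.

Lemma has_diff_cst (c : R) p : has_diff (fun=> c) p 0 0.
Proof.
apply: (is_diff_eq (is_diff_cst (c : R^o) p)).
by apply/funext => h /=; rewrite !mul0r addr0.
Qed.

Lemma has_diffD {F G p} {a b c d : R} : has_diff F p a b -> has_diff G p c d ->
  has_diff (fun q => F q + G q) p (a + c) (b + d).
Proof.
move=> Fp Gp; move=> /= ; apply: (is_diff_eq (is_diffD Fp Gp)).
by apply/funext => h /=; rewrite -[LHS]/(_ + _); ring.
Qed.

Lemma has_diffN {F p} {a b : R} : has_diff F p a b -> has_diff (fun q => - F q) p (- a) (- b).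
Proof.
move=> Fp; apply: (is_diff_eq (is_diffN Fp)).
by apply/funext => h /=; rewrite -[LHS]/(- _); ring.
Qed.

Lemma has_diffB {F G p} {a b c d : R} : has_diff F p a b -> has_diff G p c d ->
  has_diff (fun q => F q - G q) p (a - c) (b - d).
Proof. by move=> Fp Gp; apply: has_diffD => //; apply: has_diffN. Qed.

Lemma has_diffM {F G p} {a b c d : R} : has_diff F p a b -> has_diff G p c d ->
  has_diff (fun q => F q * G q) p (a * G p + F p * c) (b * G p + F p * d).
Proof.
move=> Fp Gp; apply: (is_diff_eq (is_diffM Fp Gp)).
by apply/funext => h /=; rewrite !fctE /GRing.scale /=; ring.
Qed.

Lemma has_diff_fst p : has_diff (fun q => q.1) p 1 0.
Proof.
have cf : continuous (fst : R * R -> R) by move=> q; exact: cvg_fst.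
apply: DiffDef; first exact: (linear_differentiable _ cf).
by rewrite (diff_lin _ cf); apply/funext => h /=; rewrite mul1r mul0r addr0.
Qed.

Lemma has_diff_snd p : has_diff (fun q => q.2) p 0 1.
Proof.
have cf : continuous (snd : R * R -> R) by move=> q; exact: cvg_snd.
apply: DiffDef; first exact: (linear_differentiable _ cf).
by rewrite (diff_lin _ cf); apply/funext => h /=; rewrite mul1r mul0r add0r.
Qed.

Lemma has_diff_deriv {f : R -> R} {x d : R} : has_deriv f x d -> is_diff x f (fun h => d * h).
Proof.
move=> fd; apply: DiffDef; first by apply/derivable1_diffP; case: fd.
rewrite deriv1E; last by case: fd.
by apply/funext => h; rewrite derive1E (@derive_val _ _ _ _ _ _ _ fd) mulrC.
Qed.

Lemma has_diff_comp1 {f F p} {a b d : R} : has_diff F p a b -> has_deriv f (F p) d ->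
  has_diff (fun q => f (F q)) p (d * a) (d * b).
Proof.
move=> Fp fd; apply: (is_diff_eq (is_diff_comp Fp (has_diff_deriv fd))).
by apply/funext => h /=; ring.
Qed.

Lemma has_diff_comp2 {F G H p} {a b c d e k : R} : has_diff F p a b -> has_diff G p c d ->
  has_diff H (F p, G p) e k ->
  has_diff (fun q => H (F q, G q)) p (e * a + k * c) (e * b + k * d).
Proof.
move=> Fp Gp Hp; apply: (is_diff_eq (is_diff_comp (is_diff_pair Fp Gp) Hp)).
by apply/funext => h /=; ring.
Qed.

Lemma has_diffV {F p} {a b : R} : F p != 0 -> has_diff F p a b ->
  has_diff (fun q => (F q)^-1) p (- a / F p ^+ 2) (- b / F p ^+ 2).
Proof.
move=> F0 Fp; apply: has_diff_eq.
  exact: (has_diff_comp1 Fp (has_derivV F0 (has_deriv_id _))).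
all: by ring.
Qed.

Lemma has_diff_continuous {F p} {a b : R} : has_diff F p a b -> {for p, continuous F}.
Proof. by case=> ? _; apply: differentiable_continuous. Qed.

Lemma has_diff_littleo {F p} {a b : R} : has_diff F p a b ->
  forall e : R, 0 < e -> exists2 d : R, 0 < d & forall q, `|q.1 - p.1| < d -> `|q.2 - p.2| < d ->
  `|F q - F p - a * (q.1 - p.1) - b * (q.2 - p.2)| <= e * (`|q.1 - p.1| + `|q.2 - p.2|).
Proof.
move=> [dF dE] e e0; have /diff_locallyP[_] := dF.
rewrite dE => /eqaddoP/(_ e e0)/nbhs_normP[d /= d0 dP].
exists d => // q q1 q2; have := dP (q - p); rewrite /ball_ /= sub0r normrN => /(_ _).
rewrite prod_normE /= gt_max q1 q2 => /(_ isT).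
rewrite !fctE /= subrK !opprD !addrA => /le_trans; apply.
by rewrite ler_wpM2l ?(ltW e0)// ge_max lerDl lerDr !normr_ge0.
Qed.

Lemma has_deriv_diff {f : R -> R} {x d : R} : is_diff x f (fun h => d * h) -> has_deriv f x d.
Proof.
move=> [df dE]; apply: DeriveDef; first exact/derivable1_diffP.
by rewrite deriveE// dE mulr1.
Qed.

Lemma has_deriv_comp2 {f g : R -> R} {F} {x a b c d : R} : has_deriv f x a -> has_deriv g x b ->
  has_diff F (f x, g x) c d -> has_deriv (fun t => F (f t, g t)) x (c * a + d * b).
Proof.
move=> /has_diff_deriv fa /has_diff_deriv gb Fp; apply: has_deriv_diff.
apply: (is_diff_eq (is_diff_comp (is_diff_pair fa gb) Fp)).
by apply/funext => h /=; ring.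
Qed.

Lemma has_diff_sect1 {F} {x y a b : R} : has_diff F (x, y) a b ->
  has_deriv (fun u => F (u, y)) x a.
Proof.
move=> Fp; apply: has_deriv_eq.
  exact: (has_deriv_comp2 (has_deriv_id x) (has_deriv_cst y x) Fp).
by rewrite mulr1 mulr0 addr0.
Qed.

Lemma has_diff_sect2 {F} {x y a b : R} : has_diff F (x, y) a b ->
  has_deriv (fun v => F (x, v)) y b.
Proof.
move=> Fp; apply: has_deriv_eq.
  exact: (has_deriv_comp2 (has_deriv_cst x y) (has_deriv_id y) Fp).
by rewrite mulr1 mulr0 add0r.
Qed.

Lemma has_deriv_littleo {f : R -> R} {x d : R} : has_deriv f x d -> forall e : R, 0 < e ->
  exists2 eta : R, 0 < eta & forall t, `|t| < eta -> `|f (x + t) - f x - d * t| <= e * `|t|.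
Proof.
move=> fd e e0.
have D : has_diff (fun q : R * R => f q.1) (x, 0) _ _ := has_diff_comp1 (has_diff_fst (x, 0)) fd.
have [eta eta0 P] := has_diff_littleo D _ e0; exists eta => // t teta.
have := P (x + t, 0); rewrite /= subrr normr0 addr0 [x + t - x]addrC addKr.
by move=> /(_ teta eta0); rewrite !mulr0 subr0 mulr1.
Qed.

(** The derivative is already known to exist, so increments to the right of [x] determine it: a
    single small [t] compares [d] with [M] up to [e]. *)
Lemma has_deriv_le {f : R -> R} {x d : R} (M eta : R) : has_deriv f x d -> 0 < eta ->
  (forall t, 0 < t < eta -> `|f (x + t) - f x| <= M * t) -> `|d| <= M.
Proof.
move=> fd eta0 fM; apply/ler_addgt0Pr => /= e e0.
have [c c0 cP] := has_deriv_littleo fd e e0.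
pose t := Num.min c eta / 2.
have m0 : 0 < Num.min c eta by rewrite lt_min c0.
have t0 : 0 < t by rewrite divr_gt0.
have tm : t < Num.min c eta by rewrite ltr_pdivrMr// ltr_pMr// ltr1n.
move: tm; rewrite lt_min => /andP[tc te].
rewrite -(ler_pM2r t0) mulrDl -[X in _ * X <= _](gtr0_norm t0) -normrM.
have -> : d * t = (f (x + t) - f x) - (f (x + t) - f x - d * t) by ring.
apply: (le_trans (ler_normB _ _)); apply: lerD; first by rewrite fM// t0.
by have := cP t; rewrite (gtr0_norm t0); apply.
Qed.

End Calculus.

(** * Integrals of continuous functions over segments *)

Section SegmentIntegral.
Context {R : realType}.
Implicit Types (f g F G : R -> R) (a b c : R).
Local Notation mu := (@lebesgue_measure R).

(** Continuity is two-sided even at the end points: stronger than continuity within the segment, and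
    inherited by subsegments without any boundary discussion. *)
Definition continuous_on a b f : Prop :=
  forall x, a <= x <= b -> {for x, continuous f}.

Definition segint a b f : R := \int[mu]_(x in `[a, b]) f x.

Lemma segintE a b f : segint a b f = \int[mu]_(x in `[a, b]) f x.
Proof. by []. Qed.

Lemma continuous_onS {a b c d f} : continuous_on a b f -> a <= c -> d <= b ->
  continuous_on c d f.
Proof.
by move=> cf ac db x /andP[cx xd]; apply: cf; rewrite (le_trans ac cx) (le_trans xd db).
Qed.

Lemma continuous_on_within {a b f} : continuous_on a b f -> {within `[a, b], continuous f}.
Proof.
move=> cf; apply: continuous_in_subspaceT => x; rewrite inE/= in_itv/=; exact: cf.
Qed.

Lemma continuous_on_integrable {a b f} : continuous_on a b f ->
  mu.-integrable `[a, b] (EFin \o f).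
Proof.
move=> /continuous_on_within cf.
by apply: continuous_compact_integrable; [exact: segment_compact|].
Qed.

Lemma continuous_onD {a b f g} : continuous_on a b f -> continuous_on a b g ->
  continuous_on a b (fun x => f x + g x).
Proof. by move=> cf cg x xab; apply: continuousD; [exact: cf|exact: cg]. Qed.

Lemma continuous_onN {a b f} : continuous_on a b f -> continuous_on a b (fun x => - f x).
Proof. by move=> cf x xab; apply: continuousN; exact: cf. Qed.

Lemma continuous_onB {a b f g} : continuous_on a b f -> continuous_on a b g ->
  continuous_on a b (fun x => f x - g x).
Proof. by move=> cf cg; apply: continuous_onD => //; apply: continuous_onN. Qed.

Lemma continuous_onM {a b f g} : continuous_on a b f -> continuous_on a b g ->
  continuous_on a b (fun x => f x * g x).
Proof. by move=> cf cg x xab; apply: continuousM; [exact: cf|exact: cg]. Qed.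

Lemma continuous_on_cst {a b} c : continuous_on a b (fun=> c).
Proof. by move=> x _; exact: cvg_cst. Qed.

Lemma continuous_on_id {a b} : continuous_on a b (fun x => x).
Proof. by move=> x _; exact: cvg_id. Qed.

Lemma continuous_on_norm {a b f} : continuous_on a b f ->
  continuous_on a b (fun x => `|f x|).
Proof. by move=> cf x xab; apply: (continuous_comp (cf _ xab)); exact: norm_continuous. Qed.

Lemma has_deriv_continuous_on {a b f} {df : R -> R} :
  (forall x, a <= x <= b -> has_deriv f x (df x)) -> continuous_on a b f.
Proof. by move=> fd x /fd/has_deriv_cvg. Qed.

Lemma eq_segint {a b f g} : (forall x, a <= x <= b -> f x = g x) -> segint a b f = segint a b g.
Proof. by move=> fg; apply: eq_Rintegral => x; rewrite inE/= in_itv/=; exact: fg. Qed.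

Lemma segintD {a b f g} : continuous_on a b f -> continuous_on a b g ->
  segint a b (fun x => f x + g x) = segint a b f + segint a b g.
Proof. by move=> cf cg; apply: RintegralD => //; exact: continuous_on_integrable. Qed.

Lemma segintB {a b f g} : continuous_on a b f -> continuous_on a b g ->
  segint a b (fun x => f x - g x) = segint a b f - segint a b g.
Proof. by move=> cf cg; apply: RintegralB => //; exact: continuous_on_integrable. Qed.

Lemma segintZ {a b} c {f} : continuous_on a b f ->
  segint a b (fun x => c * f x) = c * segint a b f.
Proof. by move=> cf; apply: RintegralZl => //; exact: continuous_on_integrable. Qed.

Lemma segint_cst {a b} c : a <= b -> segint a b (fun=> c) = c * (b - a).
Proof.
move=> ab; rewrite /segint Rintegral_cst//= lebesgue_measure_itv/= lte_fin.
by move: ab; rewrite le_eqVlt => /predU1P[->|->]; rewrite ?ltxx ?subrr ?EFinN.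
Qed.

Lemma le_segint {a b f g} : continuous_on a b f -> continuous_on a b g ->
  (forall x, a <= x <= b -> f x <= g x) -> segint a b f <= segint a b g.
Proof.
by move=> cf cg fg; apply: le_Rintegral => //; exact: continuous_on_integrable.
Qed.

Lemma norm_segint {a b f} : continuous_on a b f ->
  `|segint a b f| <= segint a b (fun x => `|f x|).
Proof. by move=> cf; apply: le_normr_Rintegral => //; exact: continuous_on_integrable. Qed.

Lemma norm_segint_le {a b f} M : a <= b -> continuous_on a b f ->
  (forall x, a <= x <= b -> `|f x| <= M) -> `|segint a b f| <= M * (b - a).
Proof.
move=> ab cf fM; apply: (le_trans (norm_segint cf)); rewrite -segint_cst//.
by apply: (le_segint (continuous_on_norm cf)) => //; exact: continuous_on_cst.
Qed.

Lemma segint_split {a b f} c : a <= c <= b -> continuous_on a b f ->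
  segint a b f = segint a c f + segint c b f.
Proof.
move=> /andP[ac cb] cf; apply/eqP; rewrite addrC -subr_eq; apply/eqP.
have fi := continuous_on_integrable cf.
rewrite /segint Rintegral_itvB ?bnd_simp//.
rewrite Rintegral_itv_obnd_cbnd//.
apply: integrableS fi => //; apply: subset_itvr; by rewrite bnd_simp.
Qed.

Lemma has_deriv_derivable_oo {a b F} {f : R -> R} : a < b ->
  (forall x, a <= x <= b -> has_deriv F x (f x)) -> derivable_oo_LRcontinuous F a b.
Proof.
move=> ab Ff; have cF := has_deriv_continuous_on Ff; split.
- move=> x; rewrite in_itv/= => /andP[ax xb].
  by case: (Ff x _) => //; rewrite !ltW.
- by apply: cvg_at_right_filter; apply: cF; rewrite lexx ltW.
- by apply: cvg_at_left_filter; apply: cF; rewrite lexx ltW.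
Qed.

Lemma has_deriv_derive1 {f} {x d : R} : has_deriv f x d -> derive1 f x = d.
Proof. by move=> fd; rewrite derive1E (@derive_val _ _ _ _ _ _ _ fd). Qed.

Lemma segint_FTC2 {a b F f} : a <= b -> continuous_on a b f ->
  (forall x, a <= x <= b -> has_deriv F x (f x)) -> segint a b f = F b - F a.
Proof.
rewrite le_eqVlt => /predU1P[<- _ _|ab cf Ff].
  by rewrite /segint set_itv1 Rintegral_set1 subrr.
rewrite /segint /Rintegral (continuous_FTC2 ab (continuous_on_within cf)
  (has_deriv_derivable_oo ab Ff))//.
move=> x; rewrite in_itv/= => /andP[ax xb].
by apply: has_deriv_derive1; apply: Ff; rewrite !ltW.
Qed.

Lemma segint_by_parts {a b F f G g} : a <= b -> continuous_on a b f -> continuous_on a b g ->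
  (forall x, a <= x <= b -> has_deriv F x (f x)) ->
  (forall x, a <= x <= b -> has_deriv G x (g x)) ->
  segint a b (fun x => F x * g x) = F b * G b - F a * G a - segint a b (fun x => f x * G x).
Proof.
move=> ab cf cg Ff Gg.
have cF := has_deriv_continuous_on Ff; have cG := has_deriv_continuous_on Gg.
apply/eqP; rewrite -subr_eq opprK addrC; apply/eqP.
rewrite -(segintD (continuous_onM cf cG) (continuous_onM cF cg)).
apply: (@segint_FTC2 a b (fun x => F x * G x)) => //.
  by apply: continuous_onD; exact: continuous_onM.
by move=> x xab; apply: has_derivM; [exact: Ff|exact: Gg].
Qed.

Lemma segint_primitive {a u f} (x : R) : a < x < u -> continuous_on a u f ->
  has_deriv (fun y => segint a y f) x (f x).
Proof.
move=> /andP[ax xu] cf.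
have [] := continuous_FTC1_closed xu (continuous_on_integrable cf) ax (cf x _).
  by rewrite !ltW.
by move=> d1 d2; apply: has_derivP.
Qed.

End SegmentIntegral.

(* Without this, unification and [ring] compare distinct integrals by unfolding
   them down to the definition of the Lebesgue integral. *)
#[global] Opaque segint.

(** * Goursat's lemma *)

Section Goursat.
Context {R : realType}.
Implicit Types (a b c d x y w h : R).
Variables (A B : R * R -> R) (a0 b0 c0 d0 : R).
Hypothesis closedAB : forall x y, a0 <= x <= b0 -> c0 <= y <= d0 ->
  exists al be ga, has_diff A (x, y) al be /\ has_diff B (x, y) be ga.

(** Circulation of A dx + B dy around the boundary of [a, b] x [c, d]. The coefficient [be] shared
    by both differentials in [closedAB] says that this form is closed. *)
Let circ a b c d : R := segint c d (fun y => B (b, y) - B (a, y)) -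
  segint a b (fun x => A (x, d) - A (x, c)).

Let cA y : c0 <= y <= d0 -> continuous_on a0 b0 (fun x => A (x, y)).
Proof.
move=> yP x xP; have [al [be [ga [dA _]]]] := closedAB _ _ xP yP.
exact: has_deriv_cvg (has_diff_sect1 dA).
Qed.

Let cB x : a0 <= x <= b0 -> continuous_on c0 d0 (fun y => B (x, y)).
Proof.
move=> xP y yP; have [al [be [ga [_ dB]]]] := closedAB _ _ xP yP.
exact: has_deriv_cvg (has_diff_sect2 dB).
Qed.

Let circ_split1 a m b c d : a0 <= a -> a <= m <= b -> b <= b0 -> c0 <= c -> c <= d -> d <= d0 ->
  circ a b c d = circ a m c d + circ m b c d.
Proof.
move=> a0a /andP[am mb] bb0 c0c cd dd0.
have cBx x : a0 <= x <= b0 -> continuous_on c d (fun y => B (x, y)).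
  by move=> xP; apply: (continuous_onS (cB _ xP)).
have cAy y : c0 <= y <= d0 -> continuous_on a b (fun x => A (x, y)).
  by move=> yP; apply: (continuous_onS (cA _ yP)).
have aP : a0 <= a <= b0 by lra.
have mP : a0 <= m <= b0 by lra.
have bP : a0 <= b <= b0 by lra.
have cP : c0 <= c <= d0 by lra.
have dP : c0 <= d <= d0 by lra.
rewrite /circ (segint_split m (a := a) (b := b)); first last.
- by apply: continuous_onB; exact: cAy.
- by lra.
rewrite !(segintB (cBx _ _) (cBx _ _))//; ring.
Qed.

Let circ_split2 a b c m d : a0 <= a -> a <= b -> b <= b0 -> c0 <= c -> c <= m <= d -> d <= d0 ->
  circ a b c d = circ a b c m + circ a b m d.
Proof.
move=> a0a ab bb0 c0c /andP[cm md] dd0.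
have cBx x : a0 <= x <= b0 -> continuous_on c d (fun y => B (x, y)).
  by move=> xP; apply: (continuous_onS (cB _ xP)).
have cAy y : c0 <= y <= d0 -> continuous_on a b (fun x => A (x, y)).
  by move=> yP; apply: (continuous_onS (cA _ yP)).
have aP : a0 <= a <= b0 by lra.
have mP : c0 <= m <= d0 by lra.
have bP : a0 <= b <= b0 by lra.
have cP : c0 <= c <= d0 by lra.
have dP : c0 <= d <= d0 by lra.
rewrite /circ (segint_split m (a := c) (b := d)); first last.
- by apply: continuous_onB; exact: cBx.
- by lra.
rewrite !(segintB (cAy _ _) (cAy _ _))//; ring.
Qed.

(** A first-order expansion at (p1, p2) has zero circulation because the cross coefficients of [A]
    and [B] agree. What remains is the error of differentiability, at most [e * (w + h)] for either
    function on the boundary. *)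
Let circ_local p1 p2 (e : R) : a0 <= p1 <= b0 -> c0 <= p2 <= d0 -> 0 < e ->
  exists2 r : R, 0 < r & forall x y w h, a0 <= x <= p1 -> p1 <= x + w <= b0 ->
    c0 <= y <= p2 -> p2 <= y + h <= d0 -> w < r -> h < r ->
    `|circ x (x + w) y (y + h)| <= 2 * e * (w + h) ^+ 2.
Proof.
move=> p1P p2P e0; have [al [be [ga [dA dB]]]] := closedAB _ _ p1P p2P.
have [r1 r10 Ar] := has_diff_littleo dA _ e0.
have [r2 r20 Br] := has_diff_littleo dB _ e0.
exists (Num.min r1 r2); first by rewrite lt_min r10.
move=> x y w h /andP[x1 x2] /andP[xw1 xw2] /andP[y1 y2] /andP[yh1 yh2].
rewrite !lt_min => /andP[wr1 wr2] /andP[hr1 hr2].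
have w0 : 0 <= w by lra.
have h0 : 0 <= h by lra.
have bnd F (k1 k2 r : R) : w < r -> h < r -> (forall q, `|q.1 - p1| < r -> `|q.2 - p2| < r ->
  `|F q - F (p1, p2) - k1 * (q.1 - p1) - k2 * (q.2 - p2)| <= e * (`|q.1 - p1| + `|q.2 - p2|)) ->
  forall u v, x <= u <= x + w -> y <= v <= y + h ->
  `|F (u, v) - F (p1, p2) - k1 * (u - p1) - k2 * (v - p2)| <= e * (w + h).
  move=> wr hr FP u v /andP[u1 u2] /andP[v1 v2].
  have uw : `|u - p1| <= w by rewrite ler_norml; apply/andP; split; lra.
  have vh : `|v - p2| <= h by rewrite ler_norml; apply/andP; split; lra.
  have := FP (u, v) (le_lt_trans uw wr) (le_lt_trans vh hr).
  by move=> /le_trans; apply; rewrite ler_wpM2l ?(ltW e0)// lerD.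
have bA := bnd A al be r1 wr1 hr1 Ar.
have bB := bnd B be ga r2 wr2 hr2 Br.
have cB1 u : x <= u <= x + w -> continuous_on y (y + h) (fun v => B (u, v)).
  by move=> /andP[u1 u2]; apply: (continuous_onS (cB u _)); lra.
have cA1 v : y <= v <= y + h -> continuous_on x (x + w) (fun u => A (u, v)).
  by move=> /andP[v1 v2]; apply: (continuous_onS (cA v _)); lra.
have xx : x <= x <= x + w by lra.
have xw : x <= x + w <= x + w by lra.
have yy : y <= y <= y + h by lra.
have yh : y <= y + h <= y + h by lra.
have cBB := continuous_onB (cB1 _ xw) (cB1 _ xx).
have cAA := continuous_onB (cA1 _ yh) (cA1 _ yy).
(* Both integrals change by the same amount [be * w * h]; after the subtraction the linear parts
   cancel pointwise. *)
have -> : circ x (x + w) y (y + h) =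
  segint y (y + h) (fun v => B (x + w, v) - B (x, v) - be * w) -
  segint x (x + w) (fun u => A (u, y + h) - A (u, y) - be * h).
  rewrite (segintB cBB (continuous_on_cst _)) (segintB cAA (continuous_on_cst _)).
  by rewrite !segint_cst ?lerDl// /circ; ring.
apply: (le_trans (ler_normB _ _)).
have -> : 2 * e * (w + h) ^+ 2 = (e * (w + h) + e * (w + h)) * (y + h - y) +
  (e * (w + h) + e * (w + h)) * (x + w - x) by ring.
apply: lerD; apply: norm_segint_le; rewrite ?lerDl//.
- by apply: (continuous_onB cBB); exact: continuous_on_cst.
- move=> v vP.
  have -> : B (x + w, v) - B (x, v) - be * w =
    (B (x + w, v) - B (p1, p2) - be * (x + w - p1) - ga * (v - p2)) -
    (B (x, v) - B (p1, p2) - be * (x - p1) - ga * (v - p2)) by ring.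
  by apply: (le_trans (ler_normB _ _)); apply: lerD; exact: bB.
- by apply: (continuous_onB cAA); exact: continuous_on_cst.
- move=> u uP.
  have -> : A (u, y + h) - A (u, y) - be * h =
    (A (u, y + h) - A (p1, p2) - al * (u - p1) - be * (y + h - p2)) -
    (A (u, y) - A (p1, p2) - al * (u - p1) - be * (y - p2)) by ring.
  by apply: (le_trans (ler_normB _ _)); apply: lerD; exact: bA.
Qed.

(** The circulations of the four quarters add up to the whole, so they cannot all be below E / 4 in
    absolute value. *)
Let quarter x y w h (E : R) : a0 <= x -> x + w <= b0 -> c0 <= y -> y + h <= d0 -> 0 <= w -> 0 <= h ->
  E <= `|circ x (x + w) y (y + h)| ->
  exists q : R * R, [/\ x <= q.1, q.1 + w / 2 <= x + w, y <= q.2, q.2 + h / 2 <= y + h &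
    E <= 4 * `|circ q.1 (q.1 + w / 2) q.2 (q.2 + h / 2)|].
Proof.
move=> xa xb yc yd w0 h0 HE; apply: contrapT => /forallNP Hn.
have {}Hn u v : u = x \/ u = x + w / 2 -> v = y \/ v = y + h / 2 ->
    4 * `|circ u (u + w / 2) v (v + h / 2)| < E.
  move=> uP vP; rewrite ltNge; apply/negP => HH; apply: (Hn (u, v)); split => //=.
  - by case: uP => ->; lra.
  - by case: uP => ->; lra.
  - by case: vP => ->; lra.
  - by case: vP => ->; lra.
have xm : x <= x + w / 2 <= x + w by lra.
have ym : y <= y + h / 2 <= y + h by lra.
have xwE : x + w / 2 + w / 2 = x + w by lra.
have yhE : y + h / 2 + h / 2 = y + h by lra.
have := Hn x y (or_introl erefl) (or_introl erefl).
have := Hn x _ (or_introl erefl) (or_intror erefl).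
have := Hn _ y (or_intror erefl) (or_introl erefl).
have := Hn _ _ (or_intror erefl) (or_intror erefl).
rewrite xwE yhE; move: HE.
rewrite (circ_split1 _ (x + w / 2))//; [|lra..].
rewrite (circ_split2 x (x + w / 2) _ (y + h / 2))//; [|lra..].
rewrite (circ_split2 (x + w / 2) (x + w) _ (y + h / 2))//; [|lra..].
set e1 := circ _ _ _ _; set e2 := circ _ _ _ _; set e3 := circ _ _ _ _; set e4 := circ _ _ _ _.
have := ler_normD (e1 + e2) (e3 + e4); have := ler_normD e1 e2; have := ler_normD e3 e4.
lra.
Qed.

Lemma goursat : a0 <= b0 -> c0 <= d0 -> segint c0 d0 (fun y => B (b0, y) - B (a0, y)) =
  segint a0 b0 (fun x => A (x, d0) - A (x, c0)).
Proof.
move=> ab cd; apply/eqP; rewrite -subr_eq0 -normr_le0 leNgt; apply/negP => E0.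
rewrite -/(circ a0 b0 c0 d0) in E0.
set W := b0 - a0; set H := d0 - c0; set E : R := `|circ _ _ _ _| in E0.
have W0 : 0 <= W by rewrite subr_ge0.
have H0 : 0 <= H by rewrite subr_ge0.
pose P (n : nat) (q : R * R) := [/\ a0 <= q.1, q.1 + W / 2 ^+ n <= b0, c0 <= q.2,
  q.2 + H / 2 ^+ n <= d0 & E / 4 ^+ n <= `|circ q.1 (q.1 + W / 2 ^+ n) q.2 (q.2 + H / 2 ^+ n)|].
pose rel (n : nat) (q q' : R * R) := [/\ q.1 <= q'.1, q'.1 + W / 2 ^+ n.+1 <= q.1 + W / 2 ^+ n,
  q.2 <= q'.2 & q'.2 + H / 2 ^+ n.+1 <= q.2 + H / 2 ^+ n].
have half (z : R) n : z / 2 ^+ n.+1 = z / 2 ^+ n / 2 by rewrite exprSr invfM mulrA.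
(* The invariant is a premise inside the existential, so that [choice] applies to all stages and
   corners at once. *)
have step (s : nat * (R * R)) : exists q', P s.1 s.2 -> P s.1.+1 q' /\ rel s.1 s.2 q'.
  case: s => n q /=; have [[q1 q2 q3 q4 q5]|nP] := pselect (P n q); last by exists q.
  have [||q' [r1 r2 r3 r4 r5]] := quarter _ _ _ _ _ q1 q2 q3 q4 _ _ q5.
  - by rewrite divr_ge0// exprn_ge0.
  - by rewrite divr_ge0// exprn_ge0.
  exists q' => _; rewrite /P /rel !half; split; split => //; try lra.
  by rewrite exprSr invfM mulrA ler_pdivrMr// [leRHS]mulrC.
have [nx nxP] := choice step.
pose fix q (n : nat) : R * R := if n is m.+1 then nx (m, q m) else (a0, c0).
have Pq n : P n (q n).
  elim: n => [|n IH]; last by have [] := nxP (n, q n) IH.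
  by rewrite /P /= expr0 !divr1 /W /H !subrKC; split => //; rewrite lexx.
have relq n : rel n (q n) (q n.+1) by have [] := nxP (n, q n) (Pq n).
pose w (Z : R) (n : nat) := Z / 2 ^+ n.
have nest (u : nat -> R) (Z : R) : 0 <= Z ->
    (forall n, u n <= u n.+1 /\ u n.+1 + w Z n.+1 <= u n + w Z n) ->
    exists l, forall n, u n <= l <= u n + w Z n.
  move=> Z0 uP.
  have wZ0 n : 0 <= w Z n by rewrite divr_ge0// exprn_ge0.
  have mono n k : u n <= u (n + k)%N /\ u (n + k)%N + w Z (n + k)%N <= u n + w Z n.
    elim: k => [|k [IH1 IH2]]; first by rewrite addn0.
    by rewrite addnS; have [v1 v2] := uP (n + k)%N; split; lra.
  have ub n m : u m <= u n + w Z n.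
    have [nm|/ltnW mn] := leqP n m.
      by have [_] := mono n (m - n)%N; rewrite subnKC//; have := wZ0 m; lra.
    by have [+ _] := mono m (n - m)%N; rewrite subnKC//; have := wZ0 n; lra.
  (* Every lower corner lies below every upper corner, so the supremum of the lower corners belongs
     to all the nested intervals. *)
  exists (sup (range u)) => n; apply/andP; split.
    by apply: ub_le_sup; [exists (u 0%N + w Z 0%N) => _ [m _ <-]; exact: ub|exists n].
  by apply: ge_sup; [exists (u 0%N), 0%N|move=> _ [m _ <-]; exact: ub].
have [|p1 p1P] := nest (fun n => (q n).1) W W0.
  by move=> n; have [] := relq n.
have [|p2 p2P] := nest (fun n => (q n).2) H H0.
  by move=> n; have [] := relq n.
(* The [+ 1] covers a rectangle with W + H = 0. With this [e] the local bound 2 e ((W + H) / 2^n)^2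
   falls below E / 4^n, against the invariant [P]. *)
have e0 : 0 < E / (4 * ((W + H) ^+ 2 + 1)).
  by rewrite divr_gt0// mulr_gt0// ltr_wpDl ?sqr_ge0.
have [] := @circ_local p1 p2 _ _ _ e0.
- by have := p1P 0%N; rewrite /w expr0 divr1 /W /=; lra.
- by have := p2P 0%N; rewrite /w expr0 divr1 /H /=; lra.
move=> r r0 rP.
have [n nr] : exists n : nat, (W + H) / 2 ^+ n < r.
  have := @cvg_geometric R (W + H) 2^-1 _.
  rewrite ger0_norm ?invr_ge0// invf_lt1 ?ltr1n// => /(_ isT)/cvgr0_norm_lt/(_ _ r0)[n _ nP].
  exists n; apply: le_lt_trans (nP n (leqnn n)).
  by rewrite /geometric /= exprVn ler_norm.
have [Pn1 Pn2 Pn3 Pn4 Pn5] := Pq n.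
have /andP[p11 p12] := p1P n; have /andP[p21 p22] := p2P n.
have w0 (Z : R) : 0 <= Z -> 0 <= Z / 2 ^+ n by move=> Z0; rewrite divr_ge0// exprn_ge0.
have wW := w0 W W0; have wH := w0 H H0; move: nr; rewrite mulrDl => nr.
have h1 : a0 <= (q n).1 <= p1 by rewrite Pn1 p11.
have h2 : p1 <= (q n).1 + W / 2 ^+ n <= b0 by rewrite p12 Pn2.
have h3 : c0 <= (q n).2 <= p2 by rewrite Pn3 p21.
have h4 : p2 <= (q n).2 + H / 2 ^+ n <= d0 by rewrite p22 Pn4.
have := rP _ _ _ _ h1 h2 h3 h4 ltac:(lra) ltac:(lra).
move=> /(le_trans Pn5).
rewrite -mulrDl expr_div_n -exprM mulnC exprM (_ : 2 ^+ 2 = 4)//; last by ring.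
rewrite [X in _ <= X]mulrA ler_pdivrMr ?exprn_gt0// divfK ?expf_neq0//.
apply/negP; rewrite -ltNge.
have k0 : 0 < (W + H) ^+ 2 + 1 by rewrite ltr_wpDl ?sqr_ge0.
set k := (W + H) ^+ 2 in k0 *.
have -> : 2 * (E / (4 * (k + 1))) * k = E * (k / (2 * (k + 1))).
  by field; rewrite gt_eqF.
rewrite gtr_pMr// ltr_pdivrMr ?mulr_gt0//.
have : 0 <= k by exact: sqr_ge0.
by lra.
Qed.

End Goursat.

(** * The Poisson formula *)

Section CauchyRiemann.
Context {R : realType}.
Implicit Types (F G : R * R -> R) (p q : R * R) (r t : R).

(** [F1 + i F2] has the complex derivative [a + i b] at [p]. *)
Definition cauchy_riemann F1 F2 p : Prop :=
  exists a b : R, has_diff F1 p a (- b) /\ has_diff F2 p b a.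

Lemma cauchy_riemannM {F1 F2 G1 G2 p} : cauchy_riemann F1 F2 p -> cauchy_riemann G1 G2 p ->
  cauchy_riemann (fun q => F1 q * G1 q - F2 q * G2 q) (fun q => F1 q * G2 q + F2 q * G1 q) p.
Proof.
move=> [a [b [Fa Fb]]] [c [d [Gc Gd]]].
exists (a * G1 p + F1 p * c - b * G2 p - F2 p * d), (a * G2 p + F1 p * d + b * G1 p + F2 p * c).
split.
- by apply: (has_diff_eq (has_diffB (has_diffM Fa Gc) (has_diffM Fb Gd))); ring.
- by apply: (has_diff_eq (has_diffD (has_diffM Fa Gd) (has_diffM Fb Gc))); ring.
Qed.

(** Real and imaginary part of 1 / (F1 + i F2). *)
Lemma cauchy_riemannV {F1 F2 p} : F1 p ^+ 2 + F2 p ^+ 2 != 0 -> cauchy_riemann F1 F2 p ->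
  cauchy_riemann (fun q => F1 q / (F1 q * F1 q + F2 q * F2 q))
    (fun q => - F2 q / (F1 q * F1 q + F2 q * F2 q)) p.
Proof.
rewrite !expr2 => D0 [a [b [Fa Fb]]].
have DV := has_diffV D0 (has_diffD (has_diffM Fa Fa) (has_diffM Fb Fb)).
set x := F1 p in D0 DV *; set y := F2 p in D0 DV *.
exists ((- a * (x * x - y * y) - 2 * b * x * y) / (x * x + y * y) ^+ 2),
  ((- b * (x * x - y * y) + 2 * a * x * y) / (x * x + y * y) ^+ 2); split.
- by apply: (has_diff_eq (has_diffM Fa DV)); rewrite -/x -/y; field.
- by apply: (has_diff_eq (has_diffM (has_diffN Fb) DV)); rewrite -/x -/y; field.
Qed.

(** Precomposition with z -> m + c z for complex m and c. *)
Lemma cauchy_riemann_affine (m1 m2 c1 c2 : R) {F1 F2 p} :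
  cauchy_riemann F1 F2 (m1 + (c1 * p.1 - c2 * p.2), m2 + (c2 * p.1 + c1 * p.2)) ->
  cauchy_riemann (fun q => F1 (m1 + (c1 * q.1 - c2 * q.2), m2 + (c2 * q.1 + c1 * q.2)))
    (fun q => F2 (m1 + (c1 * q.1 - c2 * q.2), m2 + (c2 * q.1 + c1 * q.2))) p.
Proof.
move=> [a [b [Fa Fb]]].
have X c := has_diffM (has_diff_cst c p) (has_diff_fst p).
have Y c := has_diffM (has_diff_cst c p) (has_diff_snd p).
have D1 := has_diffD (has_diff_cst m1 p) (has_diffB (X c1) (Y c2)).
have D2 := has_diffD (has_diff_cst m2 p) (has_diffD (X c2) (Y c1)).
exists (a * c1 - b * c2), (b * c1 + a * c2); split.
- by apply: (has_diff_eq (has_diff_comp2 D1 D2 Fa)); ring.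
- by apply: (has_diff_eq (has_diff_comp2 D1 D2 Fb)); ring.
Qed.

(** Multiplication by -i, through which statements on real parts also reach imaginary parts. *)
Lemma cauchy_riemann_rot {F1 F2 p} : cauchy_riemann F1 F2 p ->
  cauchy_riemann F2 (fun q => - F1 q) p.
Proof.
move=> [a [b [Fa Fb]]]; exists b, (- a); split.
- by apply: (has_diff_eq Fb); ring.
- by apply: (has_diff_eq (has_diffN Fa)); ring.
Qed.

Lemma cauchy_riemann_cst (c d : R) p : cauchy_riemann (fun=> c) (fun=> d) p.
Proof.
by exists 0, 0; split; apply: (has_diff_eq (has_diff_cst _ p)); ring.
Qed.

Lemma cauchy_riemann_id p : cauchy_riemann (fun q => q.1) (fun q => q.2) p.
Proof.
exists 1, 0; rewrite oppr0; split; [exact: has_diff_fst|exact: has_diff_snd].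
Qed.

Lemma cauchy_riemann_continuous {F1 F2 p} : cauchy_riemann F1 F2 p ->
  {for p, continuous F1} /\ {for p, continuous F2}.
Proof. by move=> [a [b [Fa Fb]]]; split; [exact: has_diff_continuous Fa|exact: has_diff_continuous Fb]. Qed.

(** This is |1 - r e^{it}|^2. *)
Definition poisson_den r t : R := 1 - 2 * r * cos t + r ^+ 2.

Lemma has_deriv_cos t : has_deriv cos t (- sin t).
Proof. exact: is_derive_cos. Qed.

Lemma has_deriv_sin t : has_deriv sin t (cos t).
Proof. exact: is_derive_sin. Qed.

Lemma has_deriv_poisson_den r t : has_deriv (poisson_den r) t (2 * r * sin t).
Proof.
apply: (has_deriv_eq (has_derivD (has_derivB (has_deriv_cst 1 t)
  (has_derivZ (2 * r) (has_deriv_cos t))) (has_deriv_cst (r ^+ 2) t))).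
by ring.
Qed.

Lemma poisson_den_ge r t : 0 <= r -> (1 - r) ^+ 2 <= poisson_den r t.
Proof.
move=> r0; rewrite -subr_ge0.
have -> : poisson_den r t - (1 - r) ^+ 2 = 2 * r * (1 - cos t) by rewrite /poisson_den; ring.
by rewrite mulr_ge0 ?mulr_ge0// subr_ge0 cos_le1.
Qed.

Lemma poisson_den_gt0 r t : 0 <= r < 1 -> 0 < poisson_den r t.
Proof.
move=> /andP[r0 r1]; apply: lt_le_trans (poisson_den_ge r t r0).
by rewrite exprn_gt0// subr_gt0.
Qed.

(* Real and imaginary part of 1 / (1 - r e^{-it}). *)
Definition cauchy_re r t : R := (1 - r * cos t) / poisson_den r t.
Definition cauchy_im r t : R := - (r * sin t) / poisson_den r t.

Lemma has_deriv_cauchy_re r t : 0 <= r < 1 -> exists d, has_deriv (cauchy_re r) t d.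
Proof.
move=> r01; eexists; apply: has_derivM; last first.
  apply: has_derivV; last exact: has_deriv_poisson_den.
  by rewrite gt_eqF// poisson_den_gt0.
exact: has_derivB (has_deriv_cst _ _) (has_derivZ _ (has_deriv_cos t)).
Qed.

Lemma has_deriv_cauchy_im r t : 0 <= r < 1 -> exists d, has_deriv (cauchy_im r) t d.
Proof.
move=> r01; eexists; apply: has_derivM; last first.
  apply: has_derivV; last exact: has_deriv_poisson_den.
  by rewrite gt_eqF// poisson_den_gt0.
exact: has_derivN (has_derivZ _ (has_deriv_sin t)).
Qed.

Lemma continuous_on_cauchy_re r a b : 0 <= r < 1 -> continuous_on a b (cauchy_re r).
Proof. by move=> r01 t _; have [d /has_deriv_cvg] := has_deriv_cauchy_re r t r01. Qed.

Lemma continuous_on_cauchy_im r a b : 0 <= r < 1 -> continuous_on a b (cauchy_im r).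
Proof. by move=> r01 t _; have [d /has_deriv_cvg] := has_deriv_cauchy_im r t r01. Qed.

Lemma continuous_delta {F p} : {for p, continuous F} -> forall e : R, 0 < e ->
  exists2 d : R, 0 < d & forall q, `|q.1 - p.1| < d -> `|q.2 - p.2| < d -> `|F q - F p| < e.
Proof.
move=> /cvgrPdist_lt + e e0 => /(_ e e0)/nbhs_normP[d /= d0 dP].
exists d => // q q1 q2; rewrite distrC; apply: dP.
by rewrite /ball_/= prod_normE/= gt_max distrC q1 distrC q2.
Qed.

Section Contraction.
Variables (F1 F2 : R * R -> R) (r : R).
Hypothesis r01 : 0 <= r < 1.
Hypothesis crF : forall p, p.1 ^+ 2 + p.2 ^+ 2 <= 1 -> cauchy_riemann F1 F2 p.

Let psi (l t : R) : R * R := (r + l * (cos t - r), l * sin t).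

Let psi_disc l t : 0 <= l <= 1 -> (psi l t).1 ^+ 2 + (psi l t).2 ^+ 2 <= 1.
Proof.
move=> /andP[l0 l1]; have /andP[r0 r1] := r01; rewrite /psi /=.
have -> : (r + l * (cos t - r)) ^+ 2 + (l * sin t) ^+ 2 =
  ((1 - l) * r) ^+ 2 + 2 * ((1 - l) * r * l) * cos t + l ^+ 2 * (cos t ^+ 2 + sin t ^+ 2).
  by ring.
rewrite cos2Dsin2 mulr1.
have k0 : 0 <= (1 - l) * r * l by rewrite !mulr_ge0// subr_ge0.
have : 2 * ((1 - l) * r * l) * cos t <= 2 * ((1 - l) * r * l).
  by rewrite -[leRHS]mulr1 ler_wpM2l ?cos_le1// mulr_ge0.
have : ((1 - l) * r + l) ^+ 2 <= 1.
  rewrite expr_le1// ?addr_ge0 ?mulr_ge0 ?subr_ge0//.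
  have : (1 - l) * r <= (1 - l) by rewrite -[leRHS]mulr1 ler_wpM2l ?subr_ge0// ltW.
  by lra.
by rewrite sqrrD -mulr_natl; lra.
Qed.

(** Real part of F(psi) e^{it} / (e^{it} - r), the integrand of Cauchy's formula over the contracted
    circle. *)
Let B (l t : R) : R := F1 (psi l t) * cauchy_re r t - F2 (psi l t) * cauchy_im r t.

Let closed_form (l t : R) : 0 < l <= 1 -> exists al be ga,
  has_diff (fun q => F2 (psi q.1 q.2) * q.1^-1) (l, t) al be /\
  has_diff (fun q => B q.1 q.2) (l, t) be ga.
Proof.
move=> /andP[l0 l1]; have /andP[r0 r1] := r01.
have [a [b [Fa Fb]]] := crF _ (psi_disc l t ltac:(lra)).
have [k1 K1] := has_deriv_cauchy_re r t r01.
have [k2 K2] := has_deriv_cauchy_im r t r01.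
have L := has_diff_fst (l, t); have T := has_diff_snd (l, t).
have D1 := has_diffD (has_diff_cst r (l, t))
  (has_diffM L (has_diffB (has_diff_comp1 T (has_deriv_cos t)) (has_diff_cst r (l, t)))).
have D2 := has_diffM L (has_diff_comp1 T (has_deriv_sin t)).
have G1 := has_diff_comp2 D1 D2 Fa.
have G2 := has_diff_comp2 D1 D2 Fb.
have LV : has_diff (fun q : R * R => q.1^-1) (l, t) _ _ := has_diffV (lt0r_neq0 l0) L.
have DA := has_diffM G2 LV.
have DB := has_diffB (has_diffM G1 (has_diff_comp1 T K1)) (has_diffM G2 (has_diff_comp1 T K2)).
eexists; exists (a * cos t - b * sin t); eexists; split.
- apply: (has_diff_eq DA erefl); rewrite /=; field; exact: lt0r_neq0.
- apply: (has_diff_eq DB _ erefl); rewrite /= /cauchy_re /cauchy_im.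
  have Q0 : poisson_den r t != 0 by rewrite gt_eqF// poisson_den_gt0.
  have CS := cos2Dsin2 t.
  apply: (mulIf Q0).
  transitivity (a * ((cos t - r) * (1 - r * cos t) + r * sin t ^+ 2) -
    b * (sin t * (1 - r * cos t) - (cos t - r) * (r * sin t))); first by field.
  have -> : sin t ^+ 2 = 1 - cos t ^+ 2 by rewrite -CS; ring.
  by rewrite /poisson_den; ring.
Qed.

Lemma cauchy_formula :
  segint (- pi) pi (fun t => F1 (cos t, sin t) * cauchy_re r t -
    F2 (cos t, sin t) * cauchy_im r t) =
  F1 (r, 0) * segint (- pi) pi (cauchy_re r) - F2 (r, 0) * segint (- pi) pi (cauchy_im r).
Proof.
have /andP[r0 r1] := r01.
have pi0 : 0 <= pi :> R by exact: pi_ge0.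
have cr := @continuous_on_cauchy_re r (- pi) pi r01.
have ci := @continuous_on_cauchy_im r (- pi) pi r01.
(* The sides t = -pi and t = pi of the rectangle cancel, since [psi] takes the same value there; the
   integral therefore does not depend on [l], and l -> 0 contracts the circle to [r]. *)
have const (l : R) : 0 < l <= 1 -> segint (- pi) pi (fun t => B 1 t) = segint (- pi) pi (fun t => B l t).
  move=> /andP[l0 l1]; have cB (k : R) : 0 < k <= 1 -> continuous_on (- pi) pi (fun t => B k t).
    move=> kP t _; have [al [be [ga [_ dB]]]] := closed_form k t kP.
    exact: has_deriv_cvg (has_diff_sect2 dB).
  apply/eqP; rewrite -subr_eq0 -(segintB (cB 1 _) (cB l _))//=; [|lra..].
  have /= -> := goursat (fun q => F2 (psi q.1 q.2) * q.1^-1) (fun q => B q.1 q.2)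
    l 1 (- pi) pi _ l1 _.
  - rewrite (@eq_segint _ _ _ _ (fun=> 0)) ?segint_cst ?mul0r// => x _.
    by rewrite /psi/= cosN sinN sinpi oppr0 subrr.
  - by move=> x y xP yP; apply: closed_form; lra.
  - by lra.
transitivity (segint (- pi) pi (fun t => B 1 t)).
  apply: eq_segint => t _; rewrite /B /psi !mul1r.
  by rewrite [r + (cos t - r)](_ : _ = cos t)//; ring.
apply/eqP; rewrite -subr_eq0 -normr_le0; apply/ler_addgt0Pr => e e0; rewrite add0r.
(* Bounds both kernels: numerators are at most 1 + r, the denominator is at least (1 - r)^2. *)
set K : R := (1 + r) / (1 - r) ^+ 2.
have K0 : 0 < K by rewrite divr_gt0 ?exprn_gt0//; lra.
have bK u t : `|u| <= 1 + r -> `|u / poisson_den r t| <= K.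
  move=> uP; have Q0 := poisson_den_gt0 r t r01.
  rewrite normrM normfV (gtr0_norm Q0) /K ler_pM ?invr_ge0 ?(ltW Q0)//.
  by rewrite lef_pV2 ?posrE ?exprn_gt0 ?poisson_den_ge//; lra.
have bre t : `|cauchy_re r t| <= K.
  apply: bK; apply: (le_trans (ler_normB _ _)); rewrite normr1 lerD2l normrM (ger0_norm r0).
  by rewrite -[leRHS]mulr1 ler_wpM2l// ler_norml cos_geN1 cos_le1.
have bim t : `|cauchy_im r t| <= K.
  apply: bK; rewrite normrN normrM (ger0_norm r0); apply: (@le_trans _ _ r); last by lra.
  by rewrite -[leRHS]mulr1 ler_wpM2l// ler_norml sin_geN1 sin_le1.
set e' : R := e / (2 * K * (pi - - pi) + 1).
have pp : 0 <= pi - - pi :> R by rewrite opprK addr_ge0.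
have KK : 0 <= 2 * K * (pi - - pi) by rewrite mulr_ge0// mulr_ge0// ltW.
have D0 : 0 < 2 * K * (pi - - pi) + 1 by rewrite ltr_wpDl.
have e'0 : 0 < e' by rewrite divr_gt0.
have rd : (r, 0 : R).1 ^+ 2 + (r, 0 : R).2 ^+ 2 <= 1 by rewrite /= expr0n /= addr0 expr_le1// ltW.
have [c1 c2] := cauchy_riemann_continuous (crF _ rd).
have [d1 d10 P1] := continuous_delta c1 e' e'0.
have [d2 d20 P2] := continuous_delta c2 e' e'0.
(* The coordinates of [psi l t] differ from (r, 0) by less than 3 l, because |cos t - r| <= 1 + r <
   3. *)
set l : R := Num.min 1 (Num.min d1 d2 / 3).
have l0 : 0 < l by rewrite lt_min ltr01 divr_gt0// lt_min d10.
have l1 : l <= 1 by rewrite ge_min lexx.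
have ld : l * 3 <= Num.min d1 d2 by rewrite -ler_pdivlMr// ge_min lexx orbT.
rewrite (const l) ?l0//.
have cB : continuous_on (- pi) pi (fun t => B l t).
  move=> t _; have [|al [be [ga [_ dB]]]] := closed_form l t; first by lra.
  exact: has_deriv_cvg (has_diff_sect2 dB).
have cz (k : R) h : continuous_on (- pi) pi h -> continuous_on (- pi) pi (fun t => k * h t).
  by move=> ch; apply: continuous_onM => //; exact: continuous_on_cst.
rewrite -(segintZ _ cr) -(segintZ _ ci) -(segintB (cz _ _ cr) (cz _ _ ci)).
have cR := continuous_onB (cz (F1 (r, 0)) _ cr) (cz (F2 (r, 0)) _ ci).
rewrite -(segintB cB cR).
apply: (@le_trans _ _ ((e' * K + e' * K) * (pi - - pi))); last first.
  rewrite /e'; set D := 2 * K * (pi - - pi) + 1 in D0 *.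
  have -> : (e / D * K + e / D * K) * (pi - - pi) = e * (2 * K * (pi - - pi) / D).
    by field; exact: lt0r_neq0.
  by rewrite ger_pMr// ler_pdivrMr// mul1r lerDl.
apply: norm_segint_le; first by lra.
  exact: continuous_onB cB cR.
move=> t _.
have -> : B l t - (F1 (r, 0) * cauchy_re r t - F2 (r, 0) * cauchy_im r t) =
  (F1 (psi l t) - F1 (r, 0)) * cauchy_re r t - (F2 (psi l t) - F2 (r, 0)) * cauchy_im r t.
  by rewrite /B; ring.
have near1 : `|(psi l t).1 - r| < Num.min d1 d2.
  rewrite /psi /= addrC addKr normrM (gtr0_norm l0); apply: lt_le_trans ld.
  rewrite ltr_pM2l//; apply: (le_lt_trans (ler_normB _ _)).
  have : `|cos t| <= 1 by rewrite ler_norml cos_geN1 cos_le1.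
  by rewrite (ger0_norm r0); lra.
have near2 : `|(psi l t).2 - 0| < Num.min d1 d2.
  rewrite /psi /= subr0 normrM (gtr0_norm l0); apply: lt_le_trans ld.
  rewrite ltr_pM2l//.
  have : `|sin t| <= 1 by rewrite ler_norml sin_geN1 sin_le1.
  by lra.
move: near1 near2; rewrite !lt_min => /andP[n11 n12] /andP[n21 n22].
apply: (le_trans (ler_normB _ _)); rewrite (normrM _ (cauchy_re r t)) (normrM _ (cauchy_im r t)).
apply: lerD; apply: ler_pM => //; first exact/ltW/P1.
exact/ltW/P2.
Qed.

End Contraction.

(** Real part of 1 / (1 - r z), spelled as [cauchy_riemannV] and [cauchy_riemann_affine] produce it;
    [inv2] is the imaginary part. On the unit circle this function is the conjugate of the kernel 1
    / (1 - r e^{-it}). *)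
Let inv1 r q : R := (1 + (- r * q.1 - 0 * q.2)) /
  ((1 + (- r * q.1 - 0 * q.2)) * (1 + (- r * q.1 - 0 * q.2)) +
   (0 + (0 * q.1 + - r * q.2)) * (0 + (0 * q.1 + - r * q.2))).
Let inv2 r q : R := - (0 + (0 * q.1 + - r * q.2)) /
  ((1 + (- r * q.1 - 0 * q.2)) * (1 + (- r * q.1 - 0 * q.2)) +
   (0 + (0 * q.1 + - r * q.2)) * (0 + (0 * q.1 + - r * q.2))).

Let cauchy_riemann_inv r p : 0 <= r < 1 -> p.1 ^+ 2 + p.2 ^+ 2 <= 1 ->
  cauchy_riemann (inv1 r) (inv2 r) p.
Proof.
move=> /andP[r0 r1] pP.
apply: (@cauchy_riemannV (fun q => 1 + (- r * q.1 - 0 * q.2)) (fun q => 0 + (0 * q.1 + - r * q.2))).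
  apply: lt0r_neq0; apply: ltr_pwDl; last exact: sqr_ge0.
  rewrite exprn_gt0//.
  have p1 : p.1 <= 1.
    have : p.1 ^+ 2 <= 1 by apply: le_trans pP; rewrite lerDl sqr_ge0.
    by nra.
  by nra.
apply: (@cauchy_riemann_affine 1 0 (- r) 0 (fun q => q.1) (fun q => q.2)).
exact: cauchy_riemann_id.
Qed.

Let sq_circle r t : r ^+ 2 = r ^+ 2 * (cos t ^+ 2 + sin t ^+ 2).
Proof. by rewrite cos2Dsin2 mulr1. Qed.

Let inv1_circle r t : inv1 r (cos t, sin t) = cauchy_re r t.
Proof.
rewrite /inv1 /cauchy_re /poisson_den /=; congr (_ / _); first by ring.
by rewrite [in RHS](sq_circle r t); ring.
Qed.

Let inv2_circle r t : inv2 r (cos t, sin t) = - cauchy_im r t.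
Proof.
rewrite /inv2 /cauchy_im /poisson_den /= -[RHS]mulNr; congr (_ / _); first by ring.
by rewrite [in RHS](sq_circle r t); ring.
Qed.

Let cauchy_re0 t : cauchy_re 0 t = 1.
Proof. by rewrite /cauchy_re /poisson_den mulr0 !mul0r expr0n/= !subr0 addr0 divr1. Qed.

Let cauchy_im0 t : cauchy_im 0 t = 0.
Proof. by rewrite /cauchy_im mul0r oppr0 mul0r. Qed.

Let zero01 : 0 <= (0 : R) < 1. Proof. by rewrite lexx ltr01. Qed.

Let mean_value F1 F2 : (forall p, p.1 ^+ 2 + p.2 ^+ 2 <= 1 -> cauchy_riemann F1 F2 p) ->
  segint (- pi) pi (fun t => F1 (cos t, sin t)) = 2 * pi * F1 (0, 0).
Proof.
move=> crF; have := cauchy_formula F1 F2 0 zero01 crF.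
rewrite (@eq_segint _ _ _ _ (fun t => F1 (cos t, sin t))); last first.
  by move=> t _; rewrite cauchy_re0 cauchy_im0 mulr1 mulr0 subr0.
move=> ->.
rewrite (@eq_segint _ _ _ (cauchy_re 0) (fun=> 1)); last by move=> t _; rewrite cauchy_re0.
rewrite (@eq_segint _ _ _ (cauchy_im 0) (fun=> 0)); last by move=> t _; rewrite cauchy_im0.
have pi0 : 0 <= pi :> R by exact: pi_ge0.
by rewrite !segint_cst; [ring|lra..].
Qed.

(** The mean of 1 / (1 - r z) over the unit circle is its value 1 at the origin. *)
Lemma segint_cauchy_re r : 0 <= r < 1 -> segint (- pi) pi (cauchy_re r) = 2 * pi.
Proof.
move=> r01; have := mean_value _ _ (fun p => cauchy_riemann_inv r p r01).
rewrite (@eq_segint _ _ _ _ (cauchy_re r)); last by move=> t _; exact: inv1_circle.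
move=> ->; rewrite /inv1 /= !mulr0 !subr0 !addr0 mulr0 addr0.
by rewrite !mulr1 divr1 mulr1.
Qed.

Lemma segint_cauchy_im r : 0 <= r < 1 -> segint (- pi) pi (cauchy_im r) = 0.
Proof.
move=> r01.
have := mean_value _ _ (fun p pP => cauchy_riemann_rot (cauchy_riemann_inv r p r01 pP)).
rewrite (@eq_segint _ _ _ _ (fun t => (- 1) * cauchy_im r t)); last first.
  by move=> t _; rewrite inv2_circle mulN1r.
rewrite segintZ; last exact: continuous_on_cauchy_im.
rewrite /inv2 /= !mulr0 !addr0 oppr0 mul0r mulr0 mulN1r => /eqP.
by rewrite oppr_eq0 => /eqP.
Qed.

Definition poisson r t : R := (1 - r ^+ 2) / poisson_den r t.

(** Cauchy's formula for F(z) / (1 - r z): on the circle the two kernels are conjugate, so their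
    product 1 / |1 - r e^{it}|^2 is real and only [F1] survives in the real part. At z = r the
    additional factor is 1 / (1 - r^2). *)
Let poisson_disc F1 F2 r : 0 <= r < 1 ->
  (forall p, p.1 ^+ 2 + p.2 ^+ 2 <= 1 -> cauchy_riemann F1 F2 p) ->
  segint (- pi) pi (fun t => F1 (cos t, sin t) * poisson r t) = 2 * pi * F1 (r, 0).
Proof.
move=> r01 crF; have /andP[r0 r1] := r01.
have crG p : p.1 ^+ 2 + p.2 ^+ 2 <= 1 -> cauchy_riemann
    (fun q => F1 q * inv1 r q - F2 q * inv2 r q) (fun q => F1 q * inv2 r q + F2 q * inv1 r q) p.
  by move=> pP; apply: cauchy_riemannM; [exact: crF|exact: cauchy_riemann_inv].
have := cauchy_formula _ _ r r01 crG.
rewrite segint_cauchy_re// segint_cauchy_im// mulr0 subr0.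
have r2 : 1 - r ^+ 2 != 0.
  by rewrite (_ : _ - _ = (1 - r) * (1 + r)); [rewrite mulf_neq0// gt_eqF//; lra|ring].
have -> : inv1 r (r, 0) = (1 - r ^+ 2)^-1.
  rewrite /inv1 /= (_ : 1 + (- r * r - 0 * 0) = 1 - r ^+ 2); last by ring.
  by rewrite (_ : 0 + (0 * r + - r * 0) = 0); [field|ring].
have -> : inv2 r (r, 0) = 0 by rewrite /inv2 /= mul0r mulr0 !addr0 oppr0 mul0r.
move=> H; transitivity ((1 - r ^+ 2) * (2 * pi * (F1 (r, 0) * (1 - r ^+ 2)^-1))); last first.
  by rewrite mulrCA [F1 _ * _]mulrC (mulrA (1 - _)) divff// mul1r.
have -> : 2 * pi * (F1 (r, 0) / (1 - r ^+ 2)) =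
    (F1 (r, 0) / (1 - r ^+ 2) - F2 (r, 0) * 0) * (2 * pi) by ring.
rewrite -H -segintZ.
  apply: eq_segint => t _; rewrite inv1_circle inv2_circle /poisson /cauchy_re /cauchy_im.
  have Q0 : poisson_den r t != 0 by rewrite gt_eqF// poisson_den_gt0.
  transitivity (F1 (cos t, sin t) * (1 - r ^+ 2) *
      ((1 - r * cos t) ^+ 2 + (r * sin t) ^+ 2) / poisson_den r t ^+ 2); last by field.
  have -> : (1 - r * cos t) ^+ 2 + (r * sin t) ^+ 2 = poisson_den r t.
    by rewrite /poisson_den [in RHS](sq_circle r t); ring.
  by field.
have cc t : cos t ^+ 2 + sin t ^+ 2 <= 1 :> R by rewrite cos2Dsin2.
apply: continuous_onB; apply: continuous_onM.
- move=> t _; have [a [b [Fa _]]] := crG (cos t, sin t) (cc t).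
  exact: has_deriv_cvg (has_deriv_comp2 (has_deriv_cos t) (has_deriv_sin t) Fa).
- exact: continuous_on_cauchy_re.
- move=> t _; have [a [b [_ Fb]]] := crG (cos t, sin t) (cc t).
  exact: has_deriv_cvg (has_deriv_comp2 (has_deriv_cos t) (has_deriv_sin t) Fb).
- exact: continuous_on_cauchy_im.
Qed.

Definition polar (r t : R) : R * R := (r * cos t, r * sin t).

Lemma polar_sq r t : (polar r t).1 ^+ 2 + (polar r t).2 ^+ 2 = r ^+ 2.
Proof. by rewrite /= !exprMn -mulrDr cos2Dsin2 mulr1. Qed.

(** Multiplication by rho e^{i th} maps the closed unit disc into the open one, where the
    Cauchy-Riemann equations hold. *)
Lemma poisson_formula F1 F2 (rho r th : R) :
  (forall p, p.1 ^+ 2 + p.2 ^+ 2 < 1 -> cauchy_riemann F1 F2 p) ->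
  0 <= rho < 1 -> 0 <= r < 1 ->
  segint (- pi) pi (fun t => F1 (polar rho (th + t)) * poisson r t) = 2 * pi * F1 (polar (rho * r) th).
Proof.
move=> crF /andP[rho0 rho1] r01.
pose h (q : R * R) := (0 + (rho * cos th * q.1 - rho * sin th * q.2),
  0 + (rho * sin th * q.1 + rho * cos th * q.2)).
have crh p : p.1 ^+ 2 + p.2 ^+ 2 <= 1 -> cauchy_riemann (fun q => F1 (h q)) (fun q => F2 (h q)) p.
  move=> pP; apply: cauchy_riemann_affine; apply: crF => /=.
  have -> : (0 + (rho * cos th * p.1 - rho * sin th * p.2)) ^+ 2 +
    (0 + (rho * sin th * p.1 + rho * cos th * p.2)) ^+ 2 =
    rho ^+ 2 * (cos th ^+ 2 + sin th ^+ 2) * (p.1 ^+ 2 + p.2 ^+ 2) by ring.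
  rewrite cos2Dsin2 mulr1; apply: (@le_lt_trans _ _ (rho ^+ 2)).
    by rewrite -[leRHS]mulr1 ler_wpM2l// sqr_ge0.
  by rewrite expr_lt1.
have := poisson_disc _ _ r r01 crh.
have -> : h (r, 0) = polar (rho * r) th by rewrite /h /polar /=; congr pair; ring.
move=> <-; apply: eq_segint => t _; congr (F1 _ * _).
by rewrite /h /polar /= cosD sinD; congr pair; ring.
Qed.

End CauchyRiemann.

(** * Quadratic means *)

Section HardySquare.
Context {R : realType}.
Variables (U V : R * R -> R).
Hypothesis crUV : forall p, p.1 ^+ 2 + p.2 ^+ 2 < 1 -> cauchy_riemann U V p.
Implicit Types (r s t l c : R).

Let L : R := 6 * pi.

Let L0 : 0 <= L. Proof. by rewrite mulr_ge0// pi_ge0. Qed.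

Let LL : - L <= L. Proof. by have := L0; lra. Qed.

Let crP r t : 0 <= r < 1 -> cauchy_riemann U V (polar r t).
Proof. by move=> /andP[r0 r1]; apply: crUV; rewrite polar_sq expr_lt1. Qed.

Lemma has_deriv_polar F r t a b : has_diff F (polar r t) a b ->
  has_deriv (fun t => F (polar r t)) t (a * (- (r * sin t)) + b * (r * cos t)).
Proof.
move=> Fp; apply: (has_deriv_eq (has_deriv_comp2 (has_derivZ r (has_deriv_cos t))
  (has_derivZ r (has_deriv_sin t)) Fp)).
by rewrite mulrN.
Qed.

Lemma continuous_polar1 r : 0 <= r < 1 -> forall a b, continuous_on a b (fun t => U (polar r t)).
Proof.
move=> rP a b t _; have [al [be [Fa _]]] := crP r t rP.
exact: has_deriv_cvg (has_deriv_polar _ _ _ _ _ Fa).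
Qed.

Lemma continuous_polar2 r : 0 <= r < 1 -> forall a b, continuous_on a b (fun t => V (polar r t)).
Proof.
move=> rP a b t _; have [al [be [_ Fb]]] := crP r t rP.
exact: has_deriv_cvg (has_deriv_polar _ _ _ _ _ Fb).
Qed.

(* Angles range over [- 6 pi, 6 pi] rather than over a period so that the boundary
   function can be translated without being extended periodically. *)
Definition cross_mean r s : R :=
  segint (- L) L (fun t => U (polar r t) * U (polar s t) + V (polar r t) * V (polar s t)).

Definition square_mean r : R := cross_mean r r.

(** In the variable w = log l + i t, both F(c l e^{it}) and the conjugate of F(c l^{-1} e^{it}) are
    holomorphic. Their product has real part [B] and imaginary part l times [A], so its integral
    over full periods does not depend on l; at l = 1 it is the square mean at c. *)
Let polar_cross c l : 0 < c -> 1 <= l -> c * l < 1 -> cross_mean (c * l) (c / l) = square_mean c.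
Proof.
move=> c0 l1 cl1.
pose A (q : R * R) : R := (V (polar (c * q.1) q.2) * U (polar (c * q.1^-1) q.2) -
  U (polar (c * q.1) q.2) * V (polar (c * q.1^-1) q.2)) * q.1^-1.
pose B (q : R * R) : R := U (polar (c * q.1) q.2) * U (polar (c * q.1^-1) q.2) +
  V (polar (c * q.1) q.2) * V (polar (c * q.1^-1) q.2).
have r1P x : 1 <= x <= l -> 0 <= c * x < 1.
  move=> /andP[x1 xl]; rewrite mulr_ge0 ?(ltW c0)//=; last lra.
  by apply: le_lt_trans cl1; rewrite ler_wpM2l// ltW.
have r2P x : 1 <= x <= l -> 0 <= c * x^-1 < 1.
  move=> /andP[x1 xl]; have xi : x^-1 <= 1 by rewrite invf_le1//; lra.
  rewrite mulr_ge0 ?(ltW c0) ?invr_ge0//=; last lra.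
  apply: le_lt_trans cl1; rewrite ler_wpM2l ?(ltW c0)//; lra.
have closedAB x y : 1 <= x <= l -> exists al be ga, has_diff A (x, y) al be /\ has_diff B (x, y) be ga.
  move=> xP; have x0 : x != 0 by rewrite gt_eqF//; lra.
  have [a1 [b1 [U1 V1]]] := crP (c * x) y (r1P _ xP).
  have [a2 [b2 [U2 V2]]] := crP (c * x^-1) y (r2P _ xP).
  have X := has_diff_fst (x, y); have T := has_diff_snd (x, y).
  have XV : has_diff (fun q : R * R => q.1^-1) (x, y) _ _ := has_diffV x0 X.
  have C := has_diff_comp1 T (has_deriv_cos y); have S := has_diff_comp1 T (has_deriv_sin y).
  have R1 := has_diffM (has_diff_cst c (x, y)) X.
  have R2 := has_diffM (has_diff_cst c (x, y)) XV.
  have U1' := has_diff_comp2 (has_diffM R1 C) (has_diffM R1 S) U1.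
  have V1' := has_diff_comp2 (has_diffM R1 C) (has_diffM R1 S) V1.
  have U2' := has_diff_comp2 (has_diffM R2 C) (has_diffM R2 S) U2.
  have V2' := has_diff_comp2 (has_diffM R2 C) (has_diffM R2 S) V2.
  have DA := has_diffM (has_diffB (has_diffM V1' U2') (has_diffM U1' V2')) XV.
  have DB := has_diffD (has_diffM U1' U2') (has_diffM V1' V2').
  do 3 eexists; split; first exact: DA.
  by apply: (has_diff_eq DB _ erefl) => /=; field.
have cB x : 1 <= x <= l -> continuous_on (- L) L (fun y => B (x, y)).
  move=> xP y _; have [al [be [ga [_ dB]]]] := closedAB x y xP.
  exact: has_deriv_cvg (has_diff_sect2 dB).
have l11 : 1 <= l <= l by rewrite l1 lexx.
have l12 : 1 <= (1 : R) <= l by rewrite l1 lexx.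
have H := goursat A B 1 l (- L) L (fun x y xP _ => closedAB x y xP) l1 LL.
apply/eqP; rewrite -subr_eq0; apply/eqP.
transitivity (segint (- L) L (fun y => B (l, y) - B (1, y))).
  rewrite (segintB (cB _ l11) (cB _ l12)); congr (_ - _).
  by apply: eq_segint => y _; rewrite /B /= invr1 mulr1.
rewrite H (@eq_segint _ _ _ _ (fun=> 0)) ?segint_cst ?mul0r// => x _.
rewrite /A /polar /= /L !cosN !sinN.
have -> : sin (6 * pi : R) = 0.
  by rewrite (_ : 6 * pi = 0 + pi *+ 2 *+ 3) ?(periodicn (@sinD2pi R)) ?sin0//; ring.
by rewrite oppr0 subrr.
Qed.

(** With c = sqrt(r s) and l = sqrt(r / s) the radii c l and c / l are r and s. *)
Lemma cross_mean_sqrt r s : 0 < s -> s <= r -> r < 1 -> cross_mean r s = square_mean (Num.sqrt (r * s)).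
Proof.
move=> s0 sr r1; have r0 : 0 < r := lt_le_trans s0 sr.
have sqr_inj (x y : R) : 0 <= x -> 0 <= y -> x ^+ 2 = y ^+ 2 -> x = y.
  by move=> x0 y0 /eqP; rewrite eqrXn2// => /eqP.
have E1 : Num.sqrt (r * s) * Num.sqrt (r / s) = r.
  rewrite -sqrtrM ?mulr_ge0 ?(ltW r0) ?(ltW s0)//.
  rewrite (_ : r * s * (r / s) = r ^+ 2) ?sqrtr_sqr ?gtr0_norm//.
  by field; exact: lt0r_neq0.
have E2 : Num.sqrt (r * s) / Num.sqrt (r / s) = s.
  rewrite -sqrtrV ?divr_ge0 ?(ltW r0) ?(ltW s0)// -sqrtrM ?mulr_ge0 ?(ltW r0) ?(ltW s0)//.
  rewrite (_ : r * s * (r / s)^-1 = s ^+ 2) ?sqrtr_sqr ?gtr0_norm//.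
  by field; rewrite !lt0r_neq0.
rewrite -[in LHS]E2 -[X in cross_mean X]E1; apply: polar_cross.
- by rewrite sqrtr_gt0 mulr_gt0.
- by rewrite -[leLHS]sqrtr1 ler_wsqrtr// ler_pdivlMr// mul1r.
- by rewrite E1.
Qed.

Let diff_square r s t : R :=
  (U (polar r t) - U (polar s t)) ^+ 2 + (V (polar r t) - V (polar s t)) ^+ 2.

Let cUU r s a b : 0 <= r < 1 -> 0 <= s < 1 ->
  continuous_on a b (fun t => U (polar r t) * U (polar s t) + V (polar r t) * V (polar s t)).
Proof.
move=> rP sP; apply: continuous_onD; apply: continuous_onM.
- exact: continuous_polar1.
- exact: continuous_polar1.
- exact: continuous_polar2.
- exact: continuous_polar2.
Qed.

Let c2 a b (k : R) f : continuous_on a b f -> continuous_on a b (fun t => k * f t).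
Proof. by move=> cf; apply: continuous_onM => //; exact: continuous_on_cst. Qed.

(** After expanding the square, the cross term is a square mean at the geometric mean of the radii.
    Positivity is thus midpoint convexity in log r, and the same identity later makes dilates close
    in quadratic mean. *)
Lemma segint_diff_square r s : 0 < s -> s <= r -> r < 1 -> segint (- L) L (diff_square r s) =
  square_mean r + square_mean s - 2 * square_mean (Num.sqrt (r * s)).
Proof.
move=> s0 sr r1; have rP : 0 <= r < 1 by lra.
have sP : 0 <= s < 1 by lra.
rewrite -cross_mean_sqrt// /square_mean /cross_mean.
rewrite -(segintZ _ (cUU r s _ _ rP sP)) -segintD; [|exact: cUU..].
rewrite -segintB; [|apply: continuous_onD; exact: cUU|apply: c2; exact: cUU].
by apply: eq_segint => t _; rewrite /diff_square; ring.
Qed.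

Lemma continuous_on_diff_square r s a b : 0 <= r < 1 -> 0 <= s < 1 ->
  continuous_on a b (diff_square r s).
Proof.
move=> rP sP; rewrite /diff_square.
by apply: continuous_onD; rewrite /GRing.exp /=; apply: continuous_onM;
   apply: continuous_onB; first [exact: continuous_polar1|exact: continuous_polar2].
Qed.

Let square_mean_convex r s : 0 < s -> s <= r -> r < 1 ->
  2 * square_mean (Num.sqrt (r * s)) <= square_mean r + square_mean s.
Proof.
move=> s0 sr r1; rewrite -subr_ge0 -segint_diff_square//.
rewrite -(mul0r (L - - L)) -segint_cst//; apply: le_segint.
- exact: continuous_on_cst.
- by apply: continuous_on_diff_square; lra.
- by move=> t _; rewrite addr_ge0 ?sqr_ge0.
Qed.

Variable M : R.
Hypothesis square_mean_bounded : forall r, 0 <= r < 1 -> square_mean r <= M.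

(** If the mean at r were below the mean at a smaller s, convexity along the geometric progression
    r, s, s^2 / r, ... would make it grow at least linearly towards radius 0, against the bound
    [M]. *)
Lemma square_mean_mono s r : 0 < s -> s <= r -> r < 1 -> square_mean s <= square_mean r.
Proof.
move=> s0 sr r1; rewrite leNgt; apply/negP => Nsr.
have r0 : 0 < r := lt_le_trans s0 sr.
set q := s / r; have q0 : 0 < q by rewrite divr_gt0.
have q1 : q <= 1 by rewrite ler_pdivrMr// mul1r.
pose x k := r * q ^+ k.
have x0 k : 0 < x k by rewrite mulr_gt0// exprn_gt0.
have xr k : x k <= r by rewrite -[leRHS]mulr1 ler_wpM2l ?(ltW r0)// exprn_ile1// ltW.
have xd k : x k.+1 <= x k.
  by rewrite /x exprSr mulrA -[leRHS]mulr1 ler_wpM2l// ltW// x0.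
have step k : 2 * square_mean (x k.+1) <= square_mean (x k) + square_mean (x k.+2).
  have -> : x k.+1 = Num.sqrt (x k * x k.+2).
    rewrite (_ : _ * _ = x k.+1 ^+ 2) ?sqrtr_sqr ?gtr0_norm//.
    by rewrite /x !exprSr; ring.
  apply: square_mean_convex => //; first by apply: le_trans (xd k).
  exact: le_lt_trans (xr k) r1.
set d := square_mean s - square_mean r.
have d0 : 0 < d by rewrite subr_gt0.
have inc k : d <= square_mean (x k.+1) - square_mean (x k).
  elim: k => [|k IH]; last by have := step k; lra.
  by rewrite /x expr1 expr0 mulr1 /q mulrCA divff ?mulr1// lt0r_neq0.
have low k : square_mean r + k%:R * d <= square_mean (x k).
  elim: k => [|k IH]; first by rewrite /x expr0 mulr1 mul0r addr0.
  by have := inc k; rewrite -natr1; lra.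
have [k kP] : exists k : nat, M < square_mean r + k%:R * d.
  exists (Num.truncn (`|M - square_mean r| / d)).+1.
  have := truncnS_gt (`|M - square_mean r| / d).
  rewrite ltr_pdivrMr// => H; have := ler_norm (M - square_mean r); lra.
have := square_mean_bounded (x k); rewrite (ltW (x0 k)) (le_lt_trans (xr k) r1) => /(_ isT).
by have := low k; lra.
Qed.

End HardySquare.

(** * L^1 limits and uniform convergence of primitives *)

Section L1Limit.
Context {R : realType}.
Local Notation mu := (@lebesgue_measure R).
Variables (a b C : R) (u : nat -> R -> R).
Hypothesis cu : forall k, continuous_on a b (u k).
Hypothesis du : forall k, segint a b (fun t => `|u k.+1 t - u k t|) <= C / 2 ^+ k.

Let D : set R := `[a, b].
Let d k t : R := `|u k.+1 t - u k t|.

Let cd k : continuous_on a b (d k).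
Proof. by apply: continuous_on_norm; exact: continuous_onB. Qed.

Let mD : measurable D. Proof. exact: measurable_itv. Qed.

Let mcont f : continuous_on a b f -> measurable_fun D (EFin \o f).
Proof. by move=> /continuous_on_integrable/integrableP[]. Qed.

(** Dominates every |u k| by telescoping, and has a finite integral. *)
Let h t : \bar R := (`|u 0%N t|%:E + \sum_(0 <= k <oo) (d k t)%:E)%E.

Let series_ge0 t : (0 <= \sum_(0 <= k <oo) (d k t)%:E)%E.
Proof. by apply: nneseries_ge0 => k _ _; rewrite lee_fin normr_ge0. Qed.

Let mseries : measurable_fun D (fun t => \sum_(0 <= k <oo) (d k t)%:E)%E.
Proof.
apply: ge0_emeasurable_sum => [k x _ _|k _]; first by rewrite lee_fin normr_ge0.
exact: mcont.
Qed.

Let Cge0 : 0 <= C.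
Proof.
have := du 0; rewrite expr0 divr1; apply: le_trans.
by apply: Rintegral_ge0 => x _; exact: normr_ge0.
Qed.

Let integral_series : (\int[mu]_(t in D) (\sum_(0 <= k <oo) (d k t)%:E) < +oo)%E.
Proof.
rewrite integral_nneseries//; last 2 first.
- by move=> k; apply: mcont.
- by move=> k t _; rewrite lee_fin normr_ge0.
have dk k : (\int[mu]_(t in D) (d k t)%:E)%E = (segint a b (d k))%:E.
  rewrite segintE /Rintegral fineK//; apply: integrable_fin_num => //.
  exact: continuous_on_integrable.
apply: (@le_lt_trans _ _ (2 * C)%:E); last by rewrite ltry.
apply: lime_le; first by apply: is_cvg_nneseries => k _ _; apply: integral_ge0 => t _; rewrite lee_fin normr_ge0.
apply: nearW => n; under eq_bigr do rewrite dk.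
rewrite sumEFin lee_fin.
(* The right-hand side is the sum of the first n terms of the geometric series C / 2^k. *)
suff : \sum_(0 <= k < n) segint a b (d k) <= 2 * C - 2 * C / 2 ^+ n.
  by move=> /le_trans; apply; rewrite gerBl divr_ge0 ?exprn_ge0// mulr_ge0.
elim: n => [|n IH]; first by rewrite big_geq// expr0 divr1 subrr.
rewrite big_nat_recr//= exprSr invfM; have := du n; rewrite -/(d n) => dun.
apply: (le_trans (lerD IH dun)); rewrite le_eqVlt; apply/orP; left; apply/eqP.
by field; rewrite expf_neq0.
Qed.

Let ih : mu.-integrable D h.
Proof.
apply: integrableD => //.
  by apply: (continuous_on_integrable (continuous_on_norm (cu 0))).
apply/integrableP; split=> //.
by under eq_integral do rewrite gee0_abs//.
Qed.

(** The upper limit is measurable without further work and is the pointwise limit wherever the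
    series of increments is finite; [fine] sends infinite values to 0. *)
Let g0 t : R := fine (limn_esup (fun k => (u k t)%:E)).

Lemma L1_limit : exists2 g : R -> R, mu.-integrable setT (EFin \o g) &
  forall e : R, 0 < e -> exists N : nat, forall k, (N <= k)%N ->
    forall x, a <= x <= b -> `|segint a x (u k) - segint a x g| <= e.
Proof.
have mg0 : measurable_fun D g0.
  apply: (@measurableT_comp _ _ _ _ _ _ fine); first exact: measurable_realfun.fine_measurable.
  by apply: measurable_realfun.measurable_fun_limn_esup => k; exact: mcont.
have ucvg t : (\sum_(0 <= k <oo) (d k t)%:E < +oo)%E -> u k t @[k --> \oo] --> g0 t.
  move=> /nnseries_is_cvg => /(_ (fun=> normr_ge0 _)) H.
  have : cvgn (series (telescope (fun k => u k t))) by exact: normed_cvg.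
  rewrite telescopeK => /cvg_ex[l ul].
  have {}ul : u k t @[k --> \oo] --> l + u 0%N t.
    have -> : (fun k => u k t) = (fun k => (u k t - u 0%N t) + u 0%N t).
      by apply/funext => k; rewrite subrK.
    exact: cvgD ul (cvg_cst _).
  rewrite /g0; have /cvg_limn_einf_sup[_ ->] : (u k t)%:E @[k --> \oo] --> (l + u 0%N t)%:E.
    by apply: cvg_EFin; [exact: nearW|exact: ul].
  exact: ul.
have [ig gk _] : [/\ mu.-integrable D (EFin \o g0),
  (\int[mu]_(t in D) `|(u k t)%:E - (g0 t)%:E|)%E @[k --> \oo] --> 0%E &
  (\int[mu]_(t in D) (u k t)%:E)%E @[k --> \oo] --> (\int[mu]_(t in D) (g0 t)%:E)%E].
  apply: (@dominated_convergence _ _ _ mu D (measurable_itv _) (fun k t => (u k t)%:E) (EFin \o g0) h) => //.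
  - by move=> k; exact: mcont.
  - exact/measurable_EFinP.
  - have := @integrable_ae _ _ _ mu D (measurable_itv _) h ih; apply: filterS => t ht Dt.
    apply: cvg_EFin; first exact: nearW.
    apply: ucvg; move: (ht Dt); rewrite /h fin_numD => /andP[_].
    by rewrite ge0_fin_numE.
  - apply: nearW => t k Dt; rewrite /h.
    have -> : u k t = u 0%N t + series (telescope (fun k => u k t)) k by exact: eq_sum_telescope.
    apply: (@le_trans _ _ (`|u 0%N t|%:E + \sum_(0 <= j < k) (d j t)%:E)%E).
      rewrite sumEFin -EFinD lee_fin; apply: (le_trans (ler_normD _ _)); rewrite lerD2l.
      exact: ler_norm_sum.
    rewrite leeD2l//; apply: nneseries_lim_ge => j _ _.
    by rewrite lee_fin normr_ge0.
have igT : mu.-integrable setT (EFin \o (g0 \_ D)).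
  by move: ig; rewrite integrable_mkcond//= (restrict_EFin g0).
(* Extension by 0 makes the limit integrable on the whole line, where its primitive will be
   differentiated almost everywhere. *)
exists (g0 \_ D) => //.
move=> e e0; have [N _ NP] : \forall k \near \oo, (\int[mu]_(t in D) `|(u k t)%:E - (g0 t)%:E| < e%:E)%E.
  have [fin /cvgr_lt/(_ _ e0)] := (fine_cvgP _ _).1 gk.
  move=> lt; near=> k; rewrite -[X in (X < _)%E]fineK ?lte_fin; first by near: k.
  by near: k.
exists N => k /NP kN x /andP[ax xb].
have sD : `[a, x] `<=` D by apply: subset_itvl; rewrite bnd_simp.
have igx : mu.-integrable `[a, x] (EFin \o (g0 \_ D)).
  exact: (@integrableS _ _ _ mu setT).
have iux : mu.-integrable `[a, x] (EFin \o u k).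
  by apply: continuous_on_integrable; apply: continuous_onS (cu k) _ _.
have ugx : mu.-integrable `[a, x] (EFin \o (fun t => u k t - (g0 \_ D) t)).
  by apply: (@integrableB _ _ _ mu `[a, x] (measurable_itv _) (EFin \o u k) (EFin \o (g0 \_ D))).
rewrite !segintE -RintegralB//; apply: (le_trans (le_normr_Rintegral _ _)) => //.
rewrite -lee_fin /Rintegral fineK; last first.
  by apply: integrable_fin_num => //; exact: (integrable_norm ugx).
apply: le_trans (ltW kN).
apply: (@le_trans _ _ (\int[mu]_(t in `[a, x]) `|(u k t)%:E - (g0 t)%:E|)%E).
  rewrite le_eqVlt; apply/orP; left; apply/eqP; apply: eq_integral => t /[!inE] /sD tD.
  by rewrite patchE mem_set.
apply: ge0_subset_integral => //.
apply: measurableT_comp => //; apply: emeasurable_funB; first exact: mcont.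
exact/measurable_EFinP.
Unshelve. all: by end_near. Qed.

End L1Limit.

(** * Estimates of the Poisson kernel *)

Section PoissonKernel.
Context {R : realType}.
Implicit Types (r t x : R).

Lemma sin_le_id x : 0 <= x -> sin x <= x.
Proof.
move=> x0; have -> : sin x = segint 0 x cos.
  rewrite (segint_FTC2 (F := sin) x0) ?sin0 ?subr0// => [t _|t _].
    exact: continuous_cos.
  exact: has_deriv_sin.
rewrite -[leRHS]mul1r -{2}[x]subr0 -segint_cst//; apply: le_segint.
- by move=> t _; exact: continuous_cos.
- exact: continuous_on_cst.
- by move=> t _; exact: cos_le1.
Qed.

Lemma cos_ge_taylor x : 0 <= x -> 1 - x ^+ 2 / 2 <= cos x.
Proof.
move=> x0; have -> : cos x = 1 - segint 0 x sin.
  rewrite (segint_FTC2 (F := fun t => - cos t) x0).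
  - by rewrite cos0; ring.
  - by move=> t _; exact: continuous_sin.
  - by move=> t _; apply: (has_deriv_eq (has_derivN (has_deriv_cos t))); rewrite opprK.
have id x' : continuous_on 0 x' (fun t => t) by move=> t _; exact: cvg_id.
have -> : x ^+ 2 / 2 = segint 0 x (fun t => t).
  rewrite (segint_FTC2 (F := fun t => 2^-1 * (t * t)) x0) ?expr2//; first by ring.
  move=> t _; apply: (has_deriv_eq (has_derivZ _ (has_derivM (has_deriv_id t) (has_deriv_id t)))).
  by field.
rewrite lerD2l lerN2; apply: le_segint => //.
- by move=> t _; exact: continuous_sin.
- by move=> t /andP[t0 _]; exact: sin_le_id.
Qed.

Lemma sin_ge_taylor x : 0 <= x -> x - x ^+ 3 / 6 <= sin x.
Proof.
move=> x0; have -> : sin x = segint 0 x cos.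
  rewrite (segint_FTC2 (F := sin) x0) ?sin0 ?subr0// => [t _|t _].
    exact: continuous_cos.
  exact: has_deriv_sin.
have ct : continuous_on 0 x (fun t => 1 - t ^+ 2 / 2).
  apply: continuous_onB; first exact: continuous_on_cst.
  apply: continuous_onM; last exact: continuous_on_cst.
  by move=> t _; exact: exprn_continuous.
have -> : x - x ^+ 3 / 6 = segint 0 x (fun t => 1 - t ^+ 2 / 2).
  rewrite (segint_FTC2 (F := fun t => t - 6^-1 * (t * (t * t))) x0)//; first by ring.
  move=> t _; apply: (has_deriv_eq (has_derivB (has_deriv_id t) (has_derivZ _
    (has_derivM (has_deriv_id t) (has_derivM (has_deriv_id t) (has_deriv_id t)))))).
  by field.
apply: le_segint => //; first by move=> t _; exact: continuous_cos.
by move=> t /andP[t0 _]; exact: cos_ge_taylor.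
Qed.

Let pi_le4 : pi <= 4 :> R. Proof. by have := @pihalf_lt2 R; lra. Qed.

(** Half-angle formula 1 - cos x = 2 sin(x/2)^2. The cubic Taylor bound gives sin(x/2) >= x/6 for x
    <= 4, hence up to pi, and 2 (x/6)^2 = x^2 / 18. *)
Lemma onem_cos_ge t : `|t| <= pi -> t ^+ 2 / 18 <= 1 - cos t.
Proof.
move=> tpi; rewrite -cos_norm; set x := `|t|; have x0 : 0 <= x by exact: normr_ge0.
have -> : t ^+ 2 = x ^+ 2 by rewrite /x -normrX ger0_norm// sqr_ge0.
have x4 : x <= 4 by apply: le_trans tpi _; exact pi_le4.
have -> : 1 - cos x = 2 * sin (x / 2) ^+ 2.
  have -> : x = x / 2 + x / 2 by field.
  rewrite cosD -[X in X - _](cos2Dsin2 (x / 2)).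
  rewrite (_ : (x / 2 + x / 2) / 2 = x / 2); last by field.
  by ring.
have H : x / 6 <= sin (x / 2).
  apply: le_trans (sin_ge_taylor _ _); last by rewrite divr_ge0.
  have : 0 <= x * (4 - x) * (4 + x) by rewrite !mulr_ge0 ?subr_ge0// addr_ge0.
  by nra.
have : (x / 6) ^+ 2 <= sin (x / 2) ^+ 2 by rewrite lerXn2r ?nnegrE ?(le_trans _ H) ?divr_ge0.
by nra.
Qed.

(** The denominator is (1 - r)^2 + 2 r (1 - cos t). For r >= 1/4 the second term is at least t^2 /
    36; for r < 1/4 the first exceeds 9/16, whereas t^2 <= 16. *)
Lemma poisson_den_ge_sq r t : 0 <= r < 1 -> `|t| <= pi ->
  (1 - r) ^+ 2 + t ^+ 2 <= 36 * poisson_den r t.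
Proof.
move=> /andP[r0 r1] tpi; have H := onem_cos_ge _ tpi.
have -> : poisson_den r t = (1 - r) ^+ 2 + 2 * r * (1 - cos t) by rewrite /poisson_den; ring.
have t16 : t ^+ 2 <= 16.
  have : `|t| <= 4 := le_trans tpi pi_le4.
  rewrite ler_norml => /andP[t4 t4']; have : 0 <= (4 - t) * (4 + t) by rewrite mulr_ge0//; lra.
  by lra.
have t0 := sqr_ge0 t.
have [r4|r4] := leP (4^-1) r.
  have : 4^-1 * (t ^+ 2 / 18) <= r * (1 - cos t) by apply: ler_pM => //; lra.
  have := sqr_ge0 (1 - r); lra.
have : 0 <= r * (1 - cos t) by rewrite mulr_ge0// subr_ge0 cos_le1.
by nra.
Qed.

Definition dpoisson r t : R := - (2 * r * (1 - r ^+ 2) * sin t) / poisson_den r t ^+ 2.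

Definition ddpoisson r t : R := - (2 * r * (1 - r ^+ 2)) *
  (cos t / poisson_den r t ^+ 2 - 4 * r * sin t ^+ 2 / poisson_den r t ^+ 3).

Let den_neq0 r t : 0 <= r < 1 -> poisson_den r t != 0.
Proof. by move=> r01; rewrite gt_eqF// poisson_den_gt0. Qed.

Lemma has_deriv_poisson r t : 0 <= r < 1 -> has_deriv (poisson r) t (dpoisson r t).
Proof.
move=> r01; apply: (has_deriv_eq (has_derivZ _ (has_derivV (den_neq0 r t r01)
  (has_deriv_poisson_den r t)))).
by rewrite /dpoisson; ring.
Qed.

Lemma has_deriv_dpoisson r t : 0 <= r < 1 -> has_deriv (dpoisson r) t (ddpoisson r t).
Proof.
move=> r01; have Q0 := den_neq0 r t r01.
have D := has_deriv_poisson_den r t.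
have Q2 : poisson_den r t * poisson_den r t != 0 by rewrite mulf_neq0.
have -> : dpoisson r = fun t => (- (2 * r * (1 - r ^+ 2))) *
    (sin t * (poisson_den r t * poisson_den r t)^-1).
  by apply/funext => x; rewrite /dpoisson expr2; ring.
have V := has_derivV (f := fun t => poisson_den r t * poisson_den r t) Q2 (has_derivM D D).
apply: (has_deriv_eq (has_derivZ (- (2 * r * (1 - r ^+ 2))) (has_derivM (has_deriv_sin t) V))).
by rewrite /ddpoisson; field.
Qed.

Lemma continuous_on_dpoisson r a b : 0 <= r < 1 -> continuous_on a b (dpoisson r).
Proof. by move=> r01 t _; exact: has_deriv_cvg (has_deriv_dpoisson r t r01). Qed.

Lemma continuous_on_ddpoisson r a b : 0 <= r < 1 -> continuous_on a b (ddpoisson r).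
Proof.
move=> r01; have cV n : continuous_on a b (fun t => (poisson_den r t ^+ n)^-1).
  move=> t _; apply: continuousV; first by rewrite expf_neq0// den_neq0.
  apply: (@continuous_comp _ _ _ (poisson_den r) (fun y => y ^+ n)).
    exact: has_deriv_cvg (has_deriv_poisson_den r t).
  exact: exprn_continuous.
have cs : continuous_on a b sin by move=> t _; exact: continuous_sin.
have cc : continuous_on a b cos by move=> t _; exact: continuous_cos.
apply: continuous_onM; first exact: continuous_on_cst.
apply: continuous_onB; first exact: continuous_onM cc (cV 2).
apply: continuous_onM (cV 3); apply: continuous_onM; first exact: continuous_on_cst.
by rewrite /GRing.exp /=; exact: continuous_onM.
Qed.

Let neg_pi_le : - pi <= pi :> R. Proof. by have := @pi_ge0 R; lra. Qed.

Lemma segint_poisson r : 0 <= r < 1 -> segint (- pi) pi (poisson r) = 2 * pi.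
Proof.
move=> r01; have z01 : 0 <= (0 : R) < 1 by rewrite lexx ltr01.
have := poisson_formula (fun=> 1) (fun=> 0) 0 r 0 (fun p _ => cauchy_riemann_cst 1 0 p) z01 r01.
by rewrite mulr1 => <-; apply: eq_segint => t _; rewrite mul1r.
Qed.

Lemma poissonN r t : poisson r (- t) = poisson r t.
Proof. by rewrite /poisson /poisson_den cosN. Qed.

Lemma segint_dpoisson r : 0 <= r < 1 -> segint (- pi) pi (dpoisson r) = 0.
Proof.
move=> r01; rewrite (segint_FTC2 (F := poisson r) neg_pi_le (continuous_on_dpoisson _ _ _ r01)).
  by rewrite poissonN subrr.
by move=> t _; exact: has_deriv_poisson.
Qed.

(** Paired with t, the derivative of the kernel gives -2 pi up to the value at pi, which vanishes as
    r -> 1. This is what extracts the slope of [G] in [radial_limit]. *)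
Lemma segint_dpoisson_id r : 0 <= r < 1 ->
  segint (- pi) pi (fun t => t * dpoisson r t) = 2 * pi * poisson r pi - 2 * pi.
Proof.
move=> r01; rewrite (segint_by_parts (F := fun t => t) (f := fun=> 1) (G := poisson r) neg_pi_le
  (continuous_on_cst 1) (continuous_on_dpoisson _ _ _ r01) (fun t _ => has_deriv_id t)
  (fun t _ => has_deriv_poisson r t r01)).
rewrite (@eq_segint _ _ _ _ (poisson r)); last by move=> t _; rewrite mul1r.
by rewrite segint_poisson// poissonN mulNr opprK -mulrDl -mulr2n -[X in X * _]mulr_natl.
Qed.

Lemma poisson_pi_le r : 0 <= r < 1 -> 0 <= poisson r pi <= 1 - r ^+ 2.
Proof.
move=> r01; have /andP[r0 r1] := r01.
have Q0 := poisson_den_gt0 r pi r01.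
have H : 0 <= 1 - r ^+ 2 by rewrite subr_ge0 expr_le1// ltW.
rewrite /poisson divr_ge0 ?(ltW Q0)//= ler_pdivrMr// -[leLHS]mulr1 ler_wpM2l//.
by rewrite /poisson_den cospi; nra.
Qed.

(** The kernel is even and decreases away from 0, so [t * dpoisson r t] is never positive; the
    integral of |t| against the absolute derivative is therefore known exactly. *)
Lemma dpoisson_sign r t : 0 <= r < 1 -> `|t| <= pi -> `|dpoisson r t| * `|t| = - (t * dpoisson r t).
Proof.
move=> r01; have /andP[r0 r1] := r01; rewrite ler_norml => /andP[t1 t2].
rewrite -normrM mulrC -normrN ger0_norm//.
rewrite /dpoisson mulrA -mulNr divr_ge0 ?sqr_ge0// mulrN opprK.
have H : 0 <= 1 - r ^+ 2 by rewrite subr_ge0 expr_le1// ltW.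
have st : 0 <= t * sin t.
  have [t0|t0] := leP 0 t; first by rewrite mulr_ge0// sin_ge0_pi// t0.
  by rewrite -mulrNN -sinN mulr_ge0 ?sin_ge0_pi ?oppr_ge0 ?(ltW t0)//= lerNl.
by rewrite mulrCA (mulr_ge0 _ st)// (mulr_ge0 _ H)// mulr_ge0.
Qed.

Let sin_abs t : `|sin t| <= 1. Proof. by rewrite ler_norml sin_geN1 sin_le1. Qed.
Let cos_abs t : `|cos t| <= 1. Proof. by rewrite ler_norml cos_geN1 cos_le1. Qed.

(** The square of [poisson_den_ge_sq]. The constant 36^2 is hidden here and travels as a parameter
    [K] through all later estimates. *)
Lemma poisson_den_sq_bound : exists2 K : R, 0 <= K & forall r t, 0 <= r < 1 -> `|t| <= pi ->
  ((1 - r) ^+ 2 + t ^+ 2) ^+ 2 <= K * poisson_den r t ^+ 2.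
Proof.
exists (36 ^+ 2); first exact: sqr_ge0.
move=> r t r01 tpi; have Q0 := poisson_den_gt0 r t r01.
rewrite -exprMn lerXn2r ?nnegrE ?addr_ge0 ?sqr_ge0 ?mulr_ge0 ?ler0n ?(ltW Q0)//.
exact: poisson_den_ge_sq.
Qed.

Lemma exprn4_ge0 t : 0 <= t ^+ 4.
Proof. by rewrite (_ : t ^+ 4 = (t ^+ 2) ^+ 2) ?sqr_ge0// -exprM. Qed.

(** The factor t^4 absorbs the squared denominator; the remaining bound is uniform in t and tends to
    0 as r -> 1. *)
Lemma dpoisson_le (K : R) r t : 0 <= K ->
  (forall r t, 0 <= r < 1 -> `|t| <= pi ->
    ((1 - r) ^+ 2 + t ^+ 2) ^+ 2 <= K * poisson_den r t ^+ 2) ->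
  0 <= r < 1 -> `|t| <= pi -> `|dpoisson r t| * t ^+ 4 <= 2 * K * (1 - r ^+ 2).
Proof.
move=> K0 KP r01 tpi; have /andP[r0 r1] := r01; have Q0 := poisson_den_gt0 r t r01.
have H : 0 <= 1 - r ^+ 2 by rewrite subr_ge0 expr_le1// ltW.
rewrite /dpoisson normrM normrN !normrM normfV (ger0_norm H) (ger0_norm r0) (gtr0_norm (ltr0n R 2)).
rewrite (ger0_norm (sqr_ge0 _)) mulrAC ler_pdivrMr ?exprn_gt0//.
have Qt : t ^+ 4 <= K * poisson_den r t ^+ 2.
  apply: le_trans (KP _ _ r01 tpi); rewrite (_ : t ^+ 4 = (t ^+ 2) ^+ 2); last by rewrite -exprM.
  by rewrite lerXn2r ?nnegrE ?addr_ge0 ?sqr_ge0// lerDr sqr_ge0.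
have -> : 2 * K * (1 - r ^+ 2) * poisson_den r t ^+ 2 =
  (2 * 1 * (1 - r ^+ 2) * 1) * (K * poisson_den r t ^+ 2) by ring.
apply: ler_pM => //; first by rewrite !mulr_ge0.
  exact: exprn4_ge0.
by apply: ler_pM => //; rewrite ?mulr_ge0// ler_wpM2r// ler_wpM2l// ltW.
Qed.

(** Since r sin(t)^2 <= 2 r (1 - cos t) <= [poisson_den r t], the two terms left after factoring out
    the squared denominator are at most 1 and 4. *)
Lemma ddpoisson_le r t : 0 <= r < 1 ->
  `|ddpoisson r t| <= 10 * r * (1 - r ^+ 2) / poisson_den r t ^+ 2.
Proof.
move=> r01; have /andP[r0 r1] := r01; have Q0 := poisson_den_gt0 r t r01.
have H : 0 <= 1 - r ^+ 2 by rewrite subr_ge0 expr_le1// ltW.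
have S : 4 * r * sin t ^+ 2 <= 4 * poisson_den r t.
  have -> : sin t ^+ 2 = (1 - cos t) * (1 + cos t) by rewrite sin2cos2; ring.
  have : 0 <= r * (1 - cos t) * (1 - cos t).
    by rewrite !mulr_ge0// subr_ge0 cos_le1.
  by rewrite /poisson_den; have := sqr_ge0 (1 - r); nra.
have -> : ddpoisson r t = - (2 * r * (1 - r ^+ 2)) / poisson_den r t ^+ 2 *
  (cos t - (4 * r * sin t ^+ 2) / poisson_den r t).
  by rewrite /ddpoisson; field; rewrite gt_eqF.
have K0 : 0 <= 2 * r * (1 - r ^+ 2) / poisson_den r t ^+ 2.
  by rewrite divr_ge0 ?sqr_ge0// !mulr_ge0.
rewrite normrM mulNr normrN (ger0_norm K0).
have -> : 10 * r * (1 - r ^+ 2) / poisson_den r t ^+ 2 =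
   2 * r * (1 - r ^+ 2) / poisson_den r t ^+ 2 * 5 by ring.
rewrite ler_wpM2l//; apply: (le_trans (ler_normB _ _)).
have : `|4 * r * sin t ^+ 2 / poisson_den r t| <= 4.
  rewrite ger0_norm; first by rewrite ler_pdivrMr.
  by rewrite divr_ge0 ?(ltW Q0)// mulr_ge0 ?sqr_ge0// mulr_ge0.
by have := cos_abs t; lra.
Qed.

Lemma dpoisson_pi r : dpoisson r pi = 0.
Proof. by rewrite /dpoisson sinpi mulr0 oppr0 mul0r. Qed.

Lemma dpoissonN_pi r : dpoisson r (- pi) = 0.
Proof. by rewrite /dpoisson sinN sinpi oppr0 mulr0 oppr0 mul0r. Qed.

Lemma ddpoissonN r t : ddpoisson r (- t) = ddpoisson r t.
Proof. by rewrite /ddpoisson /poisson_den cosN sinN sqrrN. Qed.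

Lemma poisson0 t : poisson 0 t = 1.
Proof. by rewrite /poisson /poisson_den expr0n /= mulr0 mul0r subr0 addr0 divr1. Qed.

Lemma dpoisson0 t : dpoisson 0 t = 0.
Proof. by rewrite /dpoisson mulr0 !mul0r oppr0 mul0r. Qed.

End PoissonKernel.

#[global] Opaque poisson dpoisson ddpoisson.

(** * The boundary function *)

Section BoundaryFunction.
Context {R : realType}.
Local Notation mu := (@lebesgue_measure R).
Variables (U V : R * R -> R) (M : R).
Hypothesis crUV : forall p, p.1 ^+ 2 + p.2 ^+ 2 < 1 -> cauchy_riemann U V p.
Hypothesis hardy : forall r, 0 <= r < 1 -> square_mean U V r <= M.

Let L : R := 6 * pi.
Let pi0 : 0 < pi :> R. Proof. exact: pi_gt0. Qed.
Let LL : - L <= L. Proof. by rewrite /L; have := pi0; lra. Qed.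

(** Square means increase to their supremum. Once the mean at r_k is within 16^{-k} of it, so are
    those at r_{k+1} and at the geometric mean of both, which is not below r_k. The distance to 1 is
    at least halved at each step. The rate 16^{-k} leaves room for a later factor 2^k. *)
Let square_mean_cauchy : exists r : nat -> R, [/\ forall k, 0 < r k < 1,
  forall k, r k <= r k.+1, forall k, 1 - r k <= (1 / 2) ^+ k &
  forall k, square_mean U V (r k) + square_mean U V (r k.+1) -
    2 * square_mean U V (Num.sqrt (r k * r k.+1)) <= 2 / 16 ^+ k].
Proof.
pose S := [set square_mean U V r | r in [set r : R | 0 < r < 1]].
have ubS : has_ubound S by exists M => _ [r /andP[r0 r1] <-]; apply: hardy; rewrite r1 ltW.
have S0 : S !=set0 by exists (square_mean U V (1 / 2)), (1 / 2) => //=; lra.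
have leS r : 0 < r < 1 -> square_mean U V r <= sup S.
  by move=> rP; apply: ub_le_sup => //; exists r.
have ex (k : nat) : exists r : R, 0 < r < 1 /\ sup S - 1 / 16 ^+ k < square_mean U V r.
  have e0 : 0 < 1 / 16 ^+ k :> R by rewrite divr_gt0// exprn_gt0.
  have [_ [r rP <-] rS] := sup_adherent e0 (conj S0 ubS).
  by exists r.
have [rho rhoP] := choice ex.
pose fix r (k : nat) : R := if k is j.+1 then Num.max (rho k) ((1 + r j) / 2) else rho 0%N.
have r01 k : 0 < r k < 1.
  elim: k => [|k /andP[IH1 IH2]]; first by have [] := rhoP 0%N.
  have [/andP[h1 h2] _] := rhoP k.+1.
  by rewrite /= lt_max h1 gt_max h2 /=; lra.
have rS k : r k <= r k.+1.
  by have := r01 k; rewrite /= le_max; have [//|H] := leP (r k) (rho k.+1); lra.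
have rhor k : rho k <= r k by case: k => //= k; rewrite le_max lexx.
have near1 k : 1 - r k <= (1 / 2) ^+ k.
  elim: k => [|k IH]; first by rewrite expr0; have := r01 0%N; lra.
  have : (1 + r k) / 2 <= r k.+1 by rewrite /= le_max lexx orbT.
  by rewrite exprS; lra.
exists r; split => // k.
have low s : r k <= s -> s < 1 -> sup S - 1 / 16 ^+ k < square_mean U V s.
  move=> rs s1; have [/andP[h1 h2] h3] := rhoP k; apply: lt_le_trans h3 _.
  by apply: (square_mean_mono U V crUV M hardy) => //; apply: le_trans rs.
have /andP[a0 a1] := r01 k; have /andP[b0 b1] := r01 k.+1.
have s1 : r k <= Num.sqrt (r k * r k.+1).
  rewrite -[leLHS]gtr0_norm// -sqrtr_sqr ler_wsqrtr// expr2 ler_wpM2l ?(ltW a0)//.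
have s2 : Num.sqrt (r k * r k.+1) < 1.
  rewrite -[ltRHS]sqrtr1 ltr_sqrt// -[ltRHS]mulr1 (@le_lt_trans _ _ (1 * r k.+1))//.
    by apply: ler_wpM2r; exact: ltW.
  by rewrite mul1r mulr1.
have := low _ s1 s2; have := leS _ (r01 k); have := leS _ (r01 k.+1).
rewrite !mul1r => h1 h2 h3; lra.
Qed.

Let u0 (r t : R) : R := U (polar r t).

(** The integration by parts is carried out at radius r_k, where everything is smooth, and only then
    k tends to infinity: the resulting formula contains nothing but primitives, which converge
    uniformly. *)
Lemma boundary_function : exists2 g : R -> R, mu.-integrable setT (EFin \o g) &
  forall th r, `|th| <= 4 * pi -> 0 <= r < 1 ->
  2 * pi * U (polar r th) = 2 * pi * poisson r pi * U (0, 0) -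
    segint (- pi) pi (fun t => dpoisson r t * segint (- L) (th + t) g).
Proof.
have [r [r01 rS near1 cauchy]] := square_mean_cauchy.
have r01' k : 0 <= r k < 1 by have /andP[/ltW -> ->] := r01 k.
have cu k a b : continuous_on a b (u0 (r k)) by exact: (continuous_polar1 U V crUV).
have cdiff k : continuous_on (- L) L (fun t => u0 (r k.+1) t - u0 (r k) t).
  exact: continuous_onB.
(* 2 L is the length of the segment, integrating the constant 2^{-k}; the other 2 comes from 2^k * 2
   / 16^k <= 2 / 2^k. *)
pose C : R := 2 * L + 2.
have du k : segint (- L) L (fun t => `|u0 (r k.+1) t - u0 (r k) t|) <= C / 2 ^+ k.
  have /andP[a0 a1] := r01 k; have /andP[b0 b1] := r01 k.+1.
  have p2 : 0 < 2 ^+ k :> R by rewrite exprn_gt0.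
  have cD := continuous_on_diff_square U V crUV (r k.+1) (r k) (- L) L (r01' _) (r01' _).
  apply: (@le_trans _ _ (segint (- L) L (fun t => (2 ^+ k)^-1 + 2 ^+ k *
      ((U (polar (r k.+1) t) - U (polar (r k) t)) ^+ 2 +
       (V (polar (r k.+1) t) - V (polar (r k) t)) ^+ 2)))).
    apply: le_segint; first exact: continuous_on_norm.
      by apply: continuous_onD; [|apply: continuous_onM => //]; exact: continuous_on_cst.
    move=> t _; set x := U _ - U _; set y := V _ - V _.
    apply: (@le_trans _ _ ((2 ^+ k)^-1 + 2 ^+ k * `|x| ^+ 2)).
      (* AM-GM: [2 |x| <= 2^-k + 2^k x^2] *)
      have -> : (2 ^+ k)^-1 + 2 ^+ k * `|x| ^+ 2 = 2 ^+ k * ((2 ^+ k)^-1 ^+ 2 + `|x| ^+ 2).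
        by field; exact: lt0r_neq0.
      rewrite -ler_pdivrMl// -[(2 ^+ k)^-1]/((2 ^+ k)^-1); set a := (2 ^+ k)^-1.
      by have := sqr_ge0 (a - `|x|); have := sqr_ge0 a; have := sqr_ge0 `|x|; rewrite sqrrB; nra.
    by rewrite lerD2l ler_wpM2l ?(ltW p2)// real_normK ?num_real// lerDl sqr_ge0.
  rewrite segintD; [|exact: continuous_on_cst|by apply: continuous_onM => //; exact: continuous_on_cst].
  rewrite segint_cst// segintZ// (segint_diff_square U V crUV)//.
  rewrite [r k.+1 * r k]mulrC [square_mean U V (r k.+1) + _]addrC.
  apply: (@le_trans _ _ ((2 ^+ k)^-1 * (L - - L) + 2 ^+ k * (2 / 16 ^+ k))).
    by rewrite lerD2l ler_wpM2l ?(ltW p2).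
  have -> : 2 ^+ k * (2 / 16 ^+ k) = 2 / 8 ^+ k :> R.
    rewrite (_ : 16 = 2 * 8 :> R); last by ring.
    by rewrite exprMn; field; rewrite !expf_neq0.
  have : 2 / 8 ^+ k <= 2 / 2 ^+ k :> R.
    by rewrite ler_wpM2l// lef_pV2 ?posrE ?exprn_gt0// lerXn2r ?nnegrE//; lra.
  rewrite /C; set a := (2 ^+ k)^-1; lra.
have [g ig gP] := L1_limit (- L) L C (fun k => u0 (r k)) (fun k => cu k _ _) du.
exists g => // th s thP s01.
pose G x := segint (- L) x g.
pose Gk k x := segint (- L) x (u0 (r k)).
have thin t : - pi <= t <= pi -> - L < th + t < L.
  by move: thP; rewrite ler_norml /L => /andP[? ?] /andP[? ?]; have := pi0; lra.
have dGk k t : - pi <= t <= pi -> has_deriv (fun t => Gk k (th + t)) t (u0 (r k) (th + t)).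
  move=> tP; apply: (has_deriv_eq (has_deriv_comp (has_derivD (has_deriv_cst th t) (has_deriv_id t))
    (segint_primitive (th + t) (thin t tP) (cu k _ _)))).
  by rewrite add0r mulr1.
have cuth k : continuous_on (- pi) pi (fun t => u0 (r k) (th + t)).
  move=> t _; apply: (@continuous_comp _ _ _ (fun t => th + t) (u0 (r k))).
    by apply: continuousD; [exact: cvg_cst|exact: cvg_id].
  by apply: (cu k (th + t) (th + t)); rewrite lexx.
have Npi : - pi <= pi :> R by have := pi0; lra.
have cGk k : continuous_on (- pi) pi (fun t => Gk k (th + t)).
  by move=> t tP; exact: has_deriv_cvg (dGk k t tP).
have level k q : 0 <= q < 1 -> 2 * pi * U (polar (r k * q) th) =
    poisson q pi * (Gk k (th + pi) - Gk k (th - pi)) -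
    segint (- pi) pi (fun t => dpoisson q t * Gk k (th + t)).
  move=> q01; rewrite -(poisson_formula U V (r k) q th crUV (r01' k) q01).
  rewrite (@eq_segint _ _ _ _ (fun t => poisson q t * u0 (r k) (th + t))); last first.
    by move=> t _; rewrite mulrC.
  rewrite (@segint_by_parts _ _ _ (poisson q) (dpoisson q) (fun t => Gk k (th + t)))//.
  - by rewrite poissonN; ring.
  - exact: continuous_on_dpoisson.
  - by move=> t _; exact: has_deriv_poisson.
  - exact: dGk.
(* For q = 0 the kernel is constant: the increment of the primitive over a full turn is 2 pi times
   the value at the centre, whatever [th]. This evaluates the boundary term. *)
have level0 k : Gk k (th + pi) - Gk k (th - pi) = 2 * pi * U (0, 0).
  have z01 : 0 <= (0 : R) < 1 by rewrite lexx ltr01.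
  have := level k 0 z01; rewrite mulr0 /polar !mul0r => ->.
  rewrite (@eq_segint _ _ _ _ (fun=> 0)) ?segint_cst ?mul0r ?subr0//.
    by rewrite poisson0 mul1r.
  by move=> t _; rewrite dpoisson0 mul0r.
have cG : continuous_on (- pi) pi (fun t => G (th + t)).
  move=> t tP; apply: (@continuous_comp _ _ _ (fun t => th + t) G).
    by apply: continuousD; [exact: cvg_cst|exact: cvg_id].
  have cL : {within `[- L, L], continuous G}.
    apply: parameterized_integral_continuous => //.
    exact: (@integrableS _ _ _ mu setT).
  apply: (@within_continuous_continuous _ _ _ (- L) L _ _ _ cL).
    by rewrite /L; have := pi0; lra.
  by rewrite in_itv /=; exact: thin.
apply/eqP; rewrite -subr_eq0 -normr_le0; apply/ler_addgt0Pr => /= e e0; rewrite add0r.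
have K : exists2 K : R, 0 < K & forall t, - pi <= t <= pi -> `|dpoisson s t| <= K.
  have [c _ cP] := @EVT_max R (fun t => `|dpoisson s t|) (- pi) pi Npi
    (continuous_on_within (continuous_on_norm (continuous_on_dpoisson s _ _ s01))).
  exists (`|dpoisson s c| + 1); first by rewrite ltr_wpDl.
  by move=> t tP; apply: (@le_trans _ _ `|dpoisson s c|); [apply: cP; rewrite in_itv|rewrite lerDl].
have {K}[K K0 KP] := K.
(* One half of [e] pays for moving the radius from r_n s to s, the other for replacing the primitive
   [Gk] by [G]. *)
pose e1 : R := e / (2 * (2 * pi)); have e10 : 0 < e1 by rewrite divr_gt0// !mulr_gt0.
pose e2 : R := e / (2 * (K * (2 * pi))); have e20 : 0 < e2 by rewrite divr_gt0// !mulr_gt0.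
have cUs : {for polar s th, continuous U}.
  by apply: (cauchy_riemann_continuous (crUV _ _)).1; rewrite polar_sq; have /andP[? ?] := s01; rewrite expr_lt1.
have [d d0 dP] := continuous_delta cUs e1 e10.
have [N NP] := gP e2 e20.
have [n [nN nd]] : exists n : nat, (N <= n)%N /\ 1 - r n < d.
  have := @cvg_geometric R 1 (1 / 2) _.
  rewrite ger0_norm ?divr_ge0// => /(_ ltac:(lra))/cvgr0_norm_lt/(_ _ d0)[m _ mP].
  exists (maxn N m); split; first exact: leq_maxl.
  apply: le_lt_trans (near1 _) _; have := mP (maxn N m) (leq_maxr _ _).
  by apply: le_lt_trans; rewrite /geometric /= !mul1r ler_norm.
have H := level n s s01; rewrite level0 in H.
have near : `|U (polar (r n * s) th) - U (polar s th)| <= e1.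
  have /andP[s0 s1] := s01; have /andP[rn0 rn1] := r01 n.
  have small z : `|z| <= 1 -> `|r n * s * z - s * z| < d.
    move=> z1; apply: le_lt_trans nd.
    have -> : r n * s * z - s * z = - ((1 - r n) * (s * z)) by ring.
    rewrite normrN normrM ger0_norm ?subr_ge0 ?(ltW rn1)//.
    rewrite -[leRHS]mulr1 ler_wpM2l ?subr_ge0 ?(ltW rn1)// normrM (ger0_norm s0).
    by rewrite -[leRHS]mulr1; apply: ler_pM => //; exact: ltW.
  apply/ltW/dP; apply: small; rewrite ler_norml; first by rewrite cos_geN1 cos_le1.
  by rewrite sin_geN1 sin_le1.
set I := segint _ _ _; set In := segint _ _ _ in H.
have II : `|In - I| <= K * e2 * (pi - - pi).
  have cI := continuous_onM (continuous_on_dpoisson s _ _ s01) cG.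
  have cIn := continuous_onM (continuous_on_dpoisson s _ _ s01) (cGk n).
  rewrite /In /I -(segintB cIn cI); apply: norm_segint_le => //; first exact: continuous_onB.
  move=> t tP; rewrite -mulrBr normrM; apply: ler_pM => //; first exact: KP.
  by apply: NP => //; have /andP[/ltW -> /ltW ->] := thin t tP.
have -> : 2 * pi * U (polar s th) - (2 * pi * poisson s pi * U (0, 0) - I) =
  - (2 * pi * (U (polar (r n * s) th) - U (polar s th))) - (In - I).
  by rewrite mulrBr H; ring.
have P2 : 0 <= 2 * pi :> R by have := pi0; lra.
apply: (le_trans (ler_normB _ _)); rewrite normrN normrM (ger0_norm P2).
have div2 (x y : R) : 0 < x -> x * (y / (2 * x)) = y / 2.
  by move=> x0; field; exact: lt0r_neq0.
have E1 : 2 * pi * e1 = e / 2 by rewrite /e1 div2// mulr_gt0.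
have E2 : K * e2 * (pi - - pi) = e / 2.
  by rewrite -(div2 (K * (2 * pi)) e) ?mulr_gt0// /e2; ring.
have : 2 * pi * `|U (polar (r n * s) th) - U (polar s th)| <= 2 * pi * e1.
  by rewrite ler_wpM2l.
lra.
Qed.

End BoundaryFunction.

(** * Radial limits *)

Lemma continuous_on_primitive {R : realType} (g : R -> R) (L a b : R) : 0 < L ->
  (@lebesgue_measure R).-integrable setT (EFin \o g) -> - L < a -> b < L ->
  continuous_on a b (fun x => segint (- L) x g).
Proof.
move=> L0 ig aL bL x /andP[ax xb]; have LL : - L < L by lra.
have cL : {within `[- L, L], continuous (fun x => segint (- L) x g)}.
  apply: parameterized_integral_continuous; first by lra.
  exact: (@integrableS _ _ _ (@lebesgue_measure R) setT).
apply: (@within_continuous_continuous _ _ _ (- L) L _ _ _ cL) => //.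
by rewrite in_itv /=; lra.
Qed.

Lemma continuous_on_shift {R : realType} (f : R -> R) (th a b : R) :
  continuous_on (th + a) (th + b) f -> continuous_on a b (fun t => f (th + t)).
Proof.
move=> cf t tab; apply: (@continuous_comp _ _ _ (fun t => th + t) f).
  by apply: continuousD; [exact: cvg_cst|exact: cvg_id].
by apply: cf; lra.
Qed.

Section RadialEstimates.
Context {R : realType}.
Local Notation mu := (@lebesgue_measure R).
Variables (U : R * R -> R) (g : R -> R).
Hypothesis ig : mu.-integrable setT (EFin \o g).
Let L : R := 6 * pi.
Let G x : R := segint (- L) x g.
Hypothesis poissonG : forall th r, `|th| <= 4 * pi -> 0 <= r < 1 ->
  2 * pi * U (polar r th) = 2 * pi * poisson r pi * U (0, 0) -
    segint (- pi) pi (fun t => dpoisson r t * G (th + t)).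

Let pi0 : 0 < pi :> R. Proof. exact: pi_gt0. Qed.
Let pi_ge2 : 2 <= pi :> R. Proof. exact: pi_ge2. Qed.
Let pi_le4 : pi <= 4 :> R. Proof. by have := @pihalf_lt2 R; lra. Qed.
Let Npi : - pi <= pi :> R. Proof. by have := pi0; lra. Qed.

Variable K : R.
Hypothesis K0 : 0 <= K.
Hypothesis den_bound : forall r t, 0 <= r < 1 -> `|t| <= pi ->
  ((1 - r) ^+ 2 + t ^+ 2) ^+ 2 <= K * poisson_den r t ^+ 2.

Let cG a b : - L < a -> b < L -> continuous_on a b G.
Proof. by apply: continuous_on_primitive => //; rewrite /L mulr_gt0. Qed.

Let cshift := @continuous_on_shift R.

Lemma ae_has_deriv_primitive : {ae mu, forall x, - L < x -> has_deriv G x (g x)}.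
Proof.
have ig' y : mu.-integrable [set` Interval (BLeft (- L)) (BRight y)] (EFin \o g).
  exact: (@integrableS _ _ _ mu setT).
have [N [mN N0 NP]] := FTC1 ig' (open_integrable_locally openT ig).
exists N; split => //; apply: subset_trans NP.
apply: subsetC => x /= H Lx.
by have [|d1 d2] := H; [rewrite lte_fin|exact: has_derivP].
Qed.

(** Write G(th + t) = G(th) + g(th) t + E(t). The kernel derivative annihilates the constant and
    turns the linear term into g(th), up to [poisson r pi]. Near t = 0 the remainder is small
    against |t|; away from 0 the kernel derivative itself is small. *)
Lemma radial_limit th : `|th| <= 4 * pi -> has_deriv G th (g th) ->
  forall e : R, 0 < e -> exists2 d : R, 0 < d & forall r, 0 <= r < 1 -> 1 - r < d ->
  `|U (polar r th) - g th| <= e.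
Proof.
move=> thP dG e e0.
have e3 : 0 < e / 3 by rewrite divr_gt0.
have [eta eta0 etaP] := has_deriv_littleo dG _ e3.
pose E t : R := G (th + t) - G th - g th * t.
have thin : - L < th + - pi /\ th + pi < L.
  by move: thP; rewrite ler_norml /L => /andP[? ?]; have := pi0; lra.
have cGt : continuous_on (- pi) pi (fun t => G (th + t)).
  by apply: cshift; apply: cG; lra.
have cid : continuous_on (- pi) pi (fun t : R => t) by exact: continuous_on_id.
have cgt : continuous_on (- pi) pi (fun t => g th * t).
  by apply: continuous_onM => //; exact: continuous_on_cst.
have cE : continuous_on (- pi) pi E.
  by apply: continuous_onB => //; apply: continuous_onB => //; exact: continuous_on_cst.
have [N N0 NP] : exists2 N : R, 0 < N & forall t, - pi <= t <= pi -> `|E t| <= N.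
  have [c _ cP] := @EVT_max R (fun t => `|E t|) (- pi) pi Npi
    (continuous_on_within (continuous_on_norm cE)).
  exists (`|E c| + 1); first by rewrite ltr_wpDl.
  by move=> t tP; apply: (@le_trans _ _ `|E c|); [apply: cP; rewrite in_itv|rewrite lerDl].
(* Outside |t| < eta the crude bound [N] becomes a multiple of t^4, to be absorbed by
   [dpoisson_le]. *)
pose C : R := N / eta ^+ 4.
have C0 : 0 < C by rewrite divr_gt0// exprn_gt0.
have Eb t : - pi <= t <= pi -> `|E t| <= e / 3 * `|t| + C * t ^+ 4.
  move=> tP; have t4 := exprn4_ge0 t.
  have [teta|teta] := ltP `|t| eta.
    by apply: (le_trans (etaP _ teta)); rewrite lerDl mulr_ge0// ltW.
  apply: (@le_trans _ _ (C * t ^+ 4)); last by rewrite lerDr mulr_ge0// divr_ge0// ltW.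
  apply: (le_trans (NP t tP)); rewrite /C -mulrA -[leLHS]mulr1 ler_wpM2l ?(ltW N0)//.
  rewrite ler_pdivlMl ?exprn_gt0// mulr1 -(ger0_norm t4) normrX.
  by rewrite lerXn2r ?nnegrE// ltW.
pose M : R := `|U (0, 0) - g th| + C * (2 * K).
have M0 : 0 <= M by rewrite addr_ge0// mulr_ge0 ?(ltW C0)// mulr_ge0.
(* [M] collects the coefficients of 1 - r^2, and 1 - r^2 <= 2 (1 - r) makes their contribution at
   most e / 3. *)
exists (e / (6 * (M + 1))).
  by rewrite divr_gt0// mulr_gt0// ltr_wpDl.
move=> r r01 rd; have /andP[r0 r1] := r01.
have P := poisson_pi_le r r01.
have cd := continuous_on_dpoisson r (- pi) pi r01.
have I1 : segint (- pi) pi (fun t => dpoisson r t * G (th + t)) =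
    g th * (2 * pi * poisson r pi - 2 * pi) + segint (- pi) pi (fun t => dpoisson r t * E t).
  rewrite -segint_dpoisson_id// -[LHS]subr0 -(mulr0 (G th)) -(segint_dpoisson r r01).
  rewrite -(segintZ _ cd) -(segintZ _ (continuous_onM cid cd)).
  rewrite -segintB; [|exact: continuous_onM|by apply: continuous_onM => //; exact: continuous_on_cst].
  rewrite -segintD; [|by apply: continuous_onM; [exact: continuous_on_cst|exact: continuous_onM]|exact: continuous_onM].
  by apply: eq_segint => t _; rewrite /E; ring.
have I2 : `|segint (- pi) pi (fun t => dpoisson r t * E t)| <=
    e / 3 * (2 * pi - 2 * pi * poisson r pi) + C * ((2 * K) * (1 - r ^+ 2)) * (pi - - pi).
  apply: (le_trans (norm_segint (continuous_onM cd cE))).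
  have ctd : continuous_on (- pi) pi (fun t => t * dpoisson r t) by exact: continuous_onM.
  have -> : e / 3 * (2 * pi - 2 * pi * poisson r pi) + C * ((2 * K) * (1 - r ^+ 2)) * (pi - - pi) =
    segint (- pi) pi (fun t => - (e / 3) * (t * dpoisson r t) + C * ((2 * K) * (1 - r ^+ 2))).
    rewrite segintD; [|by apply: continuous_onM => //; exact: continuous_on_cst|exact: continuous_on_cst].
    by rewrite segint_cst// (segintZ _ ctd) segint_dpoisson_id//; ring.
  apply: le_segint.
  - by apply: continuous_on_norm; exact: continuous_onM.
  - apply: continuous_onD; last exact: continuous_on_cst.
    by apply: continuous_onM => //; exact: continuous_on_cst.
  - move=> t tP; have tpi : `|t| <= pi by rewrite ler_norml.
    rewrite normrM; apply: (@le_trans _ _ (`|dpoisson r t| * (e / 3 * `|t| + C * t ^+ 4))).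
      by rewrite ler_wpM2l// Eb.
    rewrite mulrDr mulrCA dpoisson_sign// mulrN mulNr lerD2l mulrCA ler_wpM2l ?(ltW C0)//.
    exact: dpoisson_le.
have H := poissonG th r thP r01; rewrite I1 in H.
have {}H : 2 * pi * (U (polar r th) - g th) = 2 * pi * (poisson r pi * (U (0, 0) - g th)) -
    segint (- pi) pi (fun t => dpoisson r t * E t) by rewrite mulrBr H; ring.
have P2 : 0 <= 2 * pi :> R by have := pi0; lra.
have P3 : 0 < 2 * pi :> R by have := pi0; lra.
rewrite -(ler_pM2l P3) -[X in X * `|_|](ger0_norm P2) -normrM H.
apply: (le_trans (ler_normB _ _)); rewrite normrM (ger0_norm P2) normrM.
have /andP[p0 p1] := P; rewrite (ger0_norm p0).
have r2 : 1 - r ^+ 2 <= 2 * (e / (6 * (M + 1))).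
  have -> : 1 - r ^+ 2 = (1 - r) * (1 + r) by ring.
  by rewrite [leRHS]mulrC ler_pM ?subr_ge0 ?(ltW r1) ?(ltW rd)//; lra.
have ME : M * (2 * (e / (6 * (M + 1)))) <= e / 3.
  rewrite (_ : M * _ = e / 3 * (M / (M + 1))); last first.
    by field; rewrite lt0r_neq0// ltr_wpDl.
  by rewrite ger_pMr ?divr_gt0// ler_pdivrMr ?ltr_wpDl// mul1r lerDl.
have MR : M * (1 - r ^+ 2) <= e / 3 by apply: le_trans ME; rewrite ler_wpM2l.
have h1 : poisson r pi * `|U (0, 0) - g th| <= (1 - r ^+ 2) * `|U (0, 0) - g th|.
  by rewrite ler_wpM2r.
have h2 : e / 3 * (2 * pi - 2 * pi * poisson r pi) <= e / 3 * (2 * pi).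
  by rewrite ler_wpM2l ?divr_ge0 ?(ltW e0)// gerBl mulr_ge0.
have h3 : poisson r pi * `|U (0, 0) - g th| + C * ((2 * K) * (1 - r ^+ 2)) <= e / 3.
  apply: le_trans MR; rewrite /M [leRHS]mulrDl [X in _ <= X + _]mulrC; apply: lerD => //.
  by rewrite mulrA.
have h4 : 2 * pi * (poisson r pi * `|U (0, 0) - g th| + C * ((2 * K) * (1 - r ^+ 2))) <= 2 * pi * (e / 3).
  by rewrite ler_wpM2l.
move: I2 h2 h4; rewrite mulrDr; set p := (pi : R); move: (segint _ _ _) => I I2 h2 h4.
have -> : 2 * p * e = e / 3 * (2 * p) + 2 * p * (e / 3) + e / 3 * (2 * p) by field.
have h5 : 0 <= e / 3 * (2 * p) by rewrite mulr_ge0 ?divr_ge0// ltW.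
have h6 : C * ((2 * K) * (1 - r ^+ 2)) * (p - - p) = 2 * p * (C * ((2 * K) * (1 - r ^+ 2))) by ring.
rewrite h6 in I2; lra.
Qed.

End RadialEstimates.

(** * Tangential Lipschitz estimate *)

Section KernelBound.
Context {R : realType}.
Variable K : R.
Hypothesis K0 : 0 <= K.
Hypothesis den_bound : forall r t : R, 0 <= r < 1 -> `|t| <= pi ->
  ((1 - r) ^+ 2 + t ^+ 2) ^+ 2 <= K * poisson_den r t ^+ 2.

Let pi0 : 0 < pi :> R. Proof. exact: pi_gt0. Qed.
Let Npi : - pi <= pi :> R. Proof. by have := pi0; lra. Qed.

Lemma segint_reflect (f : R -> R) (c : R) : 0 <= c -> continuous_on (- c) c f ->
  segint (- c) c (fun t => f (- t)) = segint (- c) c f.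
Proof.
move=> c0 cf; rewrite !segintE /Rintegral; congr fine.
have := @integration_by_substitution_oppr R f (- c) c; rewrite opprK => -> //.
  by lra.
exact: continuous_on_within.
Qed.

Let continuous_abs_kernel (d a b : R) : 0 < d ->
  continuous_on a b (fun t : R => `|t| / (d ^+ 2 + t ^+ 2) ^+ 2).
Proof.
move=> d0; apply: continuous_onM; first by apply: continuous_on_norm; exact: continuous_on_id.
move=> t _; apply: continuousV; first by rewrite expf_neq0// gt_eqF// ltr_pwDl ?sqr_ge0// exprn_gt0.
apply: (@continuous_comp _ _ _ (fun t : R => d ^+ 2 + t ^+ 2) (fun y : R => y ^+ 2)).
  by apply: continuousD; [exact: cvg_cst|exact: exprn_continuous].
exact: exprn_continuous.
Qed.

(** On either half of the segment a primitive is 1 / (2 (d^2 + t^2)) up to sign, and each half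
    contributes at most 1 / (2 d^2). *)
Let segint_abs_kernel (d : R) : 0 < d ->
  segint (- pi) pi (fun t => `|t| / (d ^+ 2 + t ^+ 2) ^+ 2) <= d ^- 2.
Proof.
move=> d0; have p0 t : 0 < d ^+ 2 + t ^+ 2 by rewrite ltr_pwDl ?sqr_ge0// exprn_gt0.
have cinv a b : continuous_on a b (fun t : R => ((d ^+ 2 + t ^+ 2) ^+ 2)^-1).
  move=> t _; apply: continuousV; first by rewrite expf_neq0// gt_eqF.
  apply: (@continuous_comp _ _ _ (fun t : R => d ^+ 2 + t ^+ 2) (fun y : R => y ^+ 2)).
    by apply: continuousD; [exact: cvg_cst|exact: exprn_continuous].
  exact: exprn_continuous.
have cabs a b := continuous_abs_kernel d a b d0.
(* [s] stands for the sign of t: -1 on the left half, 1 on the right half. *)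
have dF (s t : R) : has_deriv (fun t => - (s / 2) * (d ^+ 2 + t * t)^-1) t
    (s * t / (d ^+ 2 + t ^+ 2) ^+ 2).
  have q0 : d ^+ 2 + t * t != 0 by rewrite -expr2 gt_eqF.
  apply: (has_deriv_eq (has_derivZ (- (s / 2)) (has_derivV (f := fun t => d ^+ 2 + t * t) q0
    (has_derivD (has_deriv_cst (d ^+ 2) t) (has_derivM (has_deriv_id t) (has_deriv_id t)))))).
  by rewrite -expr2 in q0 *; field.
have cst s a b : continuous_on a b (fun t : R => s * t / (d ^+ 2 + t ^+ 2) ^+ 2).
  apply: continuous_onM => //; apply: continuous_onM; first exact: continuous_on_cst.
  exact: continuous_on_id.
rewrite (segint_split 0)//; last by rewrite (ltW pi0) oppr_le0 (ltW pi0).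
have -> : segint (- pi) 0 (fun t => `|t| / (d ^+ 2 + t ^+ 2) ^+ 2) =
    segint (- pi) 0 (fun t => (- 1) * t / (d ^+ 2 + t ^+ 2) ^+ 2).
  by apply: eq_segint => t /andP[_ t0]; rewrite ler0_norm// mulN1r.
have -> : segint 0 pi (fun t => `|t| / (d ^+ 2 + t ^+ 2) ^+ 2) =
    segint 0 pi (fun t => 1 * t / (d ^+ 2 + t ^+ 2) ^+ 2).
  by apply: eq_segint => t /andP[t0 _]; rewrite ger0_norm// mul1r.
rewrite (segint_FTC2 (F := fun t => - ((- 1) / 2) * (d ^+ 2 + t * t)^-1))//; last first.
  by rewrite oppr_le0 ltW.
rewrite (segint_FTC2 (F := fun t => - (1 / 2) * (d ^+ 2 + t * t)^-1))//; last exact: ltW.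
rewrite mul0r addr0 mulrNN.
have : 0 <= (d ^+ 2 + pi * pi)^-1 by rewrite -expr2 invr_ge0 ltW.
by rewrite -exprVn; lra.
Qed.

(** The part 2 B |t| is integrated by [segint_abs_kernel]; in the quartic part t^4 cancels the
    squared denominator and only the length of the segment remains. [D] will be the length of an
    arc. *)
Lemma kernel_bound (r D B C : R) (Z : R -> R) : 0 <= r < 1 -> 0 <= D -> 0 <= B -> 0 <= C ->
  continuous_on (- pi) pi Z ->
  (forall t, - pi <= t <= pi -> `|Z t| <= (2 * B * `|t| + C * t ^+ 4) * D) ->
  `|segint (- pi) pi (fun t => ddpoisson r t * Z t)| <=
  20 * K * B * r * (1 - r ^+ 2) * D * (1 - r) ^- 2 +
  10 * K * C * r * (1 - r ^+ 2) * D * (pi - - pi).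
Proof.
move=> r01 D0 B0 C0 cZ ZP; have /andP[r0 r1] := r01.
have cdd := continuous_on_ddpoisson r (- pi) pi r01.
set w := 1 - r ^+ 2.
have w0 : 0 < w by rewrite subr_gt0 expr_lt1.
set d := 1 - r.
have d0 : 0 < d by rewrite subr_gt0.
pose k (t : R) : R := `|t| / (d ^+ 2 + t ^+ 2) ^+ 2.
have p0 t : 0 < d ^+ 2 + t ^+ 2 by rewrite ltr_pwDl ?sqr_ge0// exprn_gt0.
have ck : continuous_on (- pi) pi k := continuous_abs_kernel d _ _ d0.
have bound t : - pi <= t <= pi -> `|ddpoisson r t * Z t| <=
    20 * K * B * r * w * D * k t + 10 * K * C * r * w * D.
  move=> tP; have tn : `|t| <= pi by rewrite ler_norml.
  have Q0 := poisson_den_gt0 r t r01.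
  have t4 := exprn4_ge0 t.
  have S : `|ddpoisson r t| <= 10 * K * r * w / (d ^+ 2 + t ^+ 2) ^+ 2.
    apply: (le_trans (ddpoisson_le r t r01)).
    have -> : 10 * K * r * w / (d ^+ 2 + t ^+ 2) ^+ 2 = 10 * r * w * (K / (d ^+ 2 + t ^+ 2) ^+ 2).
      by ring.
    rewrite ler_wpM2l//; first by rewrite mulr_ge0 ?(ltW w0)// mulr_ge0.
    rewrite -[leLHS]mul1r ler_pdivrMr ?exprn_gt0// mulrAC ler_pdivlMr ?exprn_gt0// mul1r.
    exact: den_bound.
  rewrite normrM; apply: (le_trans (ler_pM _ _ S (ZP t tP))) => //.
  have -> : 10 * K * r * w / (d ^+ 2 + t ^+ 2) ^+ 2 * ((2 * B * `|t| + C * t ^+ 4) * D) =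
    20 * K * B * r * w * D * k t + 10 * K * C * r * w * D * (t ^+ 4 / (d ^+ 2 + t ^+ 2) ^+ 2).
    by rewrite /k; ring.
  rewrite lerD2l -[leRHS]mulr1 ler_wpM2l//.
    by rewrite mulr_ge0// mulr_ge0 ?(ltW w0)// mulr_ge0// mulr_ge0// mulr_ge0.
  rewrite ler_pdivrMr ?exprn_gt0// mul1r (_ : t ^+ 4 = (t ^+ 2) ^+ 2); last by rewrite -exprM.
  by rewrite lerXn2r ?nnegrE ?sqr_ge0 ?(ltW (p0 _))// lerDr sqr_ge0.
have ckk : continuous_on (- pi) pi (fun t => 20 * K * B * r * w * D * k t).
  by apply: continuous_onM => //; exact: continuous_on_cst.
apply: (le_trans (norm_segint _)); first exact: continuous_onM cdd cZ.
apply: (@le_trans _ _ (segint (- pi) pi (fun t => 20 * K * B * r * w * D * k t + 10 * K * C * r * w * D))).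
  apply: le_segint bound; first by apply: continuous_on_norm; exact: continuous_onM cdd cZ.
  exact: continuous_onD ckk (continuous_on_cst _).
rewrite (segintD ckk (continuous_on_cst _)) (segint_cst _ Npi) lerD2r (segintZ _ ck).
apply: ler_wpM2l; last exact: segint_abs_kernel.
by rewrite mulr_ge0// mulr_ge0 ?(ltW w0)// mulr_ge0// mulr_ge0// mulr_ge0.
Qed.

(** Since 1 - r^2 = (1 - r)(1 + r) with 1 + r <= 2, the quotient (1 - r^2) / (1 - r)^2 is at most 4
    / (1 - r^2); dividing the resulting 80 by 4 pi >= 8 leaves 10. *)
Lemma final_bound (r D B C u : R) : 0 <= r < 1 -> 0 <= D -> 0 <= B -> 0 <= C ->
  2 * (2 * pi * u) <= 20 * K * B * r * (1 - r ^+ 2) * D * (1 - r) ^- 2 +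
    10 * K * C * r * (1 - r ^+ 2) * D * (pi - - pi) ->
  u <= (10 * K * B / (1 - r ^+ 2) + 5 * K * C * (1 - r ^+ 2)) * r * D.
Proof.
move=> /andP[r0 r1] D0 B0 C0.
have w0 : 0 < 1 - r ^+ 2 by rewrite subr_gt0 expr_lt1.
set w := 1 - r ^+ 2 in w0 *.
set d := 1 - r.
have d0 : 0 < d by rewrite subr_gt0.
have wd : w * d ^- 2 <= 4 / w.
  rewrite ler_pdivlMr// mulrAC ler_pdivrMr ?exprn_gt0//.
  have -> : w * w = (1 + r) ^+ 2 * d ^+ 2 by rewrite /w /d; ring.
  by rewrite ler_wpM2r ?sqr_ge0//; nra.
have fin2 : 20 * K * B * r * w * D * d ^- 2 <= 20 * K * B * r * D * (4 / w).
  have -> : 20 * K * B * r * w * D * d ^- 2 = 20 * K * B * r * D * (w * d ^- 2) by ring.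
  by rewrite ler_wpM2l// mulr_ge0// mulr_ge0// mulr_ge0// mulr_ge0.
have e0 : 0 <= K * B * r * D / w.
  by rewrite divr_ge0 ?(ltW w0)// mulr_ge0// mulr_ge0// mulr_ge0.
have pi2 := @pi_ge2 R.
have p4 : 0 < 4 * pi :> R by have := pi0; lra.
move=> H; rewrite -(ler_pM2l p4).
have -> : 4 * pi * ((10 * K * B / w + 5 * K * C * w) * r * D) =
  40 * (K * B * r * D / w) * pi + 10 * K * C * r * w * D * (pi - - pi) by ring.
have : 40 * (K * B * r * D / w) * 2 <= 40 * (K * B * r * D / w) * pi.
  by rewrite ler_wpM2l// mulr_ge0.
have -> : 40 * (K * B * r * D / w) * 2 = 20 * K * B * r * D * (4 / w) by ring.
move: fin2 H; move: (20 * K * B * r * w * D * d ^- 2) (20 * K * B * r * D * (4 / w)) => x y.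
move: (40 * _ * _) (10 * _ * _ * _ * _ * _ * _) => z t; lra.
Qed.

End KernelBound.

(** * Lipschitz bound along circles *)

Section RadialLipschitz.
Context {R : realType}.
Local Notation mu := (@lebesgue_measure R).
Variables (U : R * R -> R) (g : R -> R).
Hypothesis ig : mu.-integrable setT (EFin \o g).
Let L : R := 6 * pi.
Let G x : R := segint (- L) x g.
Hypothesis poissonG : forall th r, `|th| <= 4 * pi -> 0 <= r < 1 ->
  2 * pi * U (polar r th) = 2 * pi * poisson r pi * U (0, 0) -
    segint (- pi) pi (fun t => dpoisson r t * G (th + t)).

Let pi0 : 0 < pi :> R. Proof. exact: pi_gt0. Qed.
Let pi_ge2 : 2 <= pi :> R. Proof. exact: pi_ge2. Qed.
Let pi_le4 : pi <= 4 :> R. Proof. by have := @pihalf_lt2 R; lra. Qed.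
Let Npi : - pi <= pi :> R. Proof. by have := pi0; lra. Qed.

Variable K : R.
Hypothesis K0 : 0 <= K.
Hypothesis den_bound : forall r t, 0 <= r < 1 -> `|t| <= pi ->
  ((1 - r) ^+ 2 + t ^+ 2) ^+ 2 <= K * poisson_den r t ^+ 2.

Let cG a b : - L < a -> b < L -> continuous_on a b G.
Proof. by apply: continuous_on_primitive => //; rewrite /L mulr_gt0. Qed.

Let cshift := @continuous_on_shift R.

Section Lipschitz.
Variables B C : R.
Hypothesis B0 : 0 <= B.
Hypothesis C0 : 0 <= C.
Hypothesis zygmund : forall th t, `|th| <= 2 * pi -> `|t| <= pi ->
  `|G (th + t) + G (th - t) - 2 * G th| <= 2 * B * `|t| + C * t ^+ 4.

(** Increments of [U] stand in for a derivative under the integral sign. With [H] a primitive of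
    [G], a second integration by parts moves [X t] = H(th2 + t) - H(th1 + t) against [ddpoisson].
    This kernel is even with integral zero, so [X] may be replaced by its second difference, which
    is the integral over [th1, th2] of the second difference of [G]. *)
Lemma radial_lipschitz (r th1 th2 : R) : 0 <= r < 1 -> - (2 * pi) <= th1 -> th1 <= th2 -> th2 <= 2 * pi ->
  `|U (polar r th2) - U (polar r th1)| <=
  (10 * K * B / (1 - r ^+ 2) + 5 * K * C * (1 - r ^+ 2)) * r * (th2 - th1).
Proof.
move=> r01 th1P th12 th2P; have /andP[r0 r1] := r01.
pose H x : R := segint (- (5 * pi)) x G.
have dH x : - (5 * pi) < x < 5 * pi -> has_deriv H x (G x).
  move=> xP; apply: (segint_primitive x xP); apply: cG; rewrite /L; have := pi0; lra.
have dHs th t : `|th| <= 2 * pi -> `|t| <= pi -> has_deriv (fun t => H (th + t)) t (G (th + t)).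
  move=> thP tP; apply: (has_deriv_eq (has_deriv_comp (has_derivD (has_deriv_cst th t) (has_deriv_id t))
    (dH (th + t) _))); last by rewrite add0r mulr1.
  by move: thP tP; rewrite !ler_norml => /andP[? ?] /andP[? ?]; have := pi0; lra.
have n1 : `|th1| <= 2 * pi by rewrite ler_norml; lra.
have n2 : `|th2| <= 2 * pi by rewrite ler_norml; lra.
pose X t : R := H (th2 + t) - H (th1 + t).
have dX t : - pi <= t <= pi -> has_deriv X t (G (th2 + t) - G (th1 + t)).
  by move=> tP; apply: has_derivB; apply: dHs => //; rewrite ler_norml.
have cX := has_deriv_continuous_on dX.
have cGs th : `|th| <= 2 * pi -> continuous_on (- pi) pi (fun t => G (th + t)).
  rewrite ler_norml => /andP[? ?]; apply: cshift; apply: cG; rewrite /L; have := pi0; lra.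
have cd := continuous_on_dpoisson r (- pi) pi r01.
have cdd := continuous_on_ddpoisson r (- pi) pi r01.
have cG1 := cGs _ n1; have cG2 := cGs _ n2.
(* The boundary terms vanish because the kernel derivative is 0 at both end points, not because [X]
   is periodic. *)
have dpi := dpoisson_pi r; have dNpi := dpoissonN_pi r.
have I1 : 2 * pi * (U (polar r th2) - U (polar r th1)) =
    segint (- pi) pi (fun t => ddpoisson r t * X t).
  have n4 (th : R) : `|th| <= 2 * pi -> `|th| <= 4 * pi by move=> h; have := pi0; lra.
  rewrite mulrBr !poissonG ?n4//.
  transitivity (- segint (- pi) pi (fun t => dpoisson r t * (G (th2 + t) - G (th1 + t)))).
    rewrite [X in _ = - X](@eq_segint _ _ _ _ (fun t => dpoisson r t * G (th2 + t) - dpoisson r t * G (th1 + t))).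
      have aux (x y z : R) : x - y - (x - z) = - (y - z) by ring.
      by rewrite (segintB (continuous_onM cd cG2) (continuous_onM cd cG1)); exact: aux.
    by move=> t _; rewrite mulrBr.
  rewrite (segint_by_parts Npi cdd (continuous_onB cG2 cG1)
    (fun t _ => has_deriv_dpoisson r t r01) dX).
  by rewrite dpi dNpi !mul0r subrr sub0r opprK.
have I0 : segint (- pi) pi (ddpoisson r) = 0.
  rewrite (segint_FTC2 Npi cdd (fun t _ => has_deriv_dpoisson r t r01)).
  by rewrite dpi dNpi subrr.
have cXN : continuous_on (- pi) pi (fun t => X (- t)).
  move=> t tP; apply: (@continuous_comp _ _ _ (fun t => - t) X); first exact: continuousN.
  by apply: cX; lra.
have I2 : segint (- pi) pi (fun t => ddpoisson r t * X (- t)) =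
    segint (- pi) pi (fun t => ddpoisson r t * X t).
  rewrite -(segint_reflect _ _ (ltW pi0) (continuous_onM cdd cX)).
  by apply: eq_segint => t _; rewrite ddpoissonN.
pose Z t : R := X t + X (- t) - 2 * X 0.
have cZ : continuous_on (- pi) pi Z.
  by apply: continuous_onB; [exact: continuous_onD|exact: continuous_on_cst].
have I3 : 2 * (2 * pi * (U (polar r th2) - U (polar r th1))) =
    segint (- pi) pi (fun t => ddpoisson r t * Z t).
  have -> : 2 * (2 * pi * (U (polar r th2) - U (polar r th1))) =
    segint (- pi) pi (fun t => ddpoisson r t * X t) +
    segint (- pi) pi (fun t => ddpoisson r t * X (- t)) -
    2 * X 0 * segint (- pi) pi (ddpoisson r).
    by rewrite I1 I2 I0 mulr0 subr0 mulrDl mul1r.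
  have c1 := continuous_onM cdd cX; have c2 := continuous_onM cdd cXN.
  rewrite -(segintZ (2 * X 0) cdd) -(segintD c1 c2).
  rewrite -(segintB (continuous_onD c1 c2) (continuous_onM (continuous_on_cst _) cdd)).
  by apply: eq_segint => t _; rewrite /Z; ring.
have ZP t : - pi <= t <= pi -> `|Z t| <= (2 * B * `|t| + C * t ^+ 4) * (th2 - th1).
  clear I1 I0 I2 I3; move=> tP; have tn : `|t| <= pi by rewrite ler_norml.
  have th th : th1 <= th <= th2 -> `|th| <= 2 * pi.
    by move=> /andP[a b]; rewrite ler_norml (le_trans th1P a) (le_trans b th2P).
  have -> : Z t = segint th1 th2 (fun th => G (th + t) + G (th - t) - 2 * G th).
    rewrite (segint_FTC2 (F := fun th => H (th + t) + H (th - t) - 2 * H th) th12).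
    - rewrite /Z /X !addr0; move: (H _) (H _) (H _) (H _) (H _) (H _) => x1 x2 x3 x4 x5 x6; ring.
    - have := pi0; move: tP => /andP[? ?] ?.
      apply: continuous_onB; last first.
        by apply: continuous_onM; [exact: continuous_on_cst|apply: cG; rewrite /L; lra].
      apply: continuous_onD.
        rewrite (_ : (fun th => _) = (fun th => G (t + th))); last by apply/funext => ?; rewrite addrC.
        by apply: cshift; apply: cG; rewrite /L; lra.
      rewrite (_ : (fun th => _) = (fun th => G (- t + th))); last by apply/funext => ?; rewrite addrC.
      by apply: cshift; apply: cG; rewrite /L; lra.
    - move=> x xP; have := pi0; move: tP => /andP[? ?] ?.
      apply: has_derivB; last by apply: has_derivZ; apply: dH; lra.
      apply: has_derivD.
        apply: (has_deriv_eq (has_deriv_comp (has_derivD (has_deriv_id x) (has_deriv_cst t x))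
          (dH (x + t) _))); last by rewrite addr0 mulr1.
        by lra.
      apply: (has_deriv_eq (has_deriv_comp (has_derivB (has_deriv_id x) (has_deriv_cst t x))
          (dH (x - t) _))); last by rewrite subr0 mulr1.
      by lra.
  apply: (norm_segint_le _ th12); last by move=> x xP; apply: zygmund => //; exact: th.
  have := pi0; move: tP => /andP[? ?] ?.
  apply: continuous_onB; last first.
    by apply: continuous_onM; [exact: continuous_on_cst|apply: cG; rewrite /L; lra].
  apply: continuous_onD.
    rewrite (_ : (fun th => _) = (fun th => G (t + th))); last by apply/funext => ?; rewrite addrC.
    by apply: cshift; apply: cG; rewrite /L; lra.
  rewrite (_ : (fun th => _) = (fun th => G (- t + th))); last by apply/funext => ?; rewrite addrC.
  by apply: cshift; apply: cG; rewrite /L; lra.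
have fin := kernel_bound K K0 den_bound r (th2 - th1) B C Z r01 _ B0 C0 cZ ZP.
apply: (final_bound K K0 _ _ _ _ _ r01 _ B0 C0 _); first by rewrite subr_ge0.
have -> : 2 * (2 * pi * `|U (polar r th2) - U (polar r th1)|) =
    `|2 * (2 * pi * (U (polar r th2) - U (polar r th1)))|.
  by rewrite 3!normrM (ger0_norm (ltW pi0)) (ger0_norm (ler0n R 2)).
by rewrite I3; apply: fin; rewrite subr_ge0.
Qed.

End Lipschitz.
End RadialLipschitz.

(** * Slices *)

Section Quaternions.
Context {R : realType}.
Implicit Types (x y q i s : quat R) (p : R * R) (r t : R).

(** The Euclidean inner product, that is the real part of [x * quat_conj q]. *)
Definition qdot q x : R := q0 x * q0 q + q1 x * q1 q + q2 x * q2 q + q3 x * q3 q.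

Lemma qdot_is_linear q : linear (qdot q).
Proof. by move=> a x y; rewrite /qdot /= /GRing.scale /=; ring. Qed.

HB.instance Definition _ q := GRing.isLinear.Build R (quat R) R _ (qdot q) (qdot_is_linear q).

Lemma quat_norm_sq x : `|x| ^+ 2 = quat_sqnorm x.
Proof. by rewrite quat_normE sqr_sqrtr// quat_sqnorm_ge0. Qed.

Lemma qdot_le q x : `|qdot q x| <= `|x| * `|q|.
Proof.
rewrite -(ler_pXn2r (n := 2))// ?nnegrE ?mulr_ge0// real_normK ?num_real// exprMn !quat_norm_sq.
rewrite -subr_ge0.
have -> : quat_sqnorm x * quat_sqnorm q - qdot q x ^+ 2 =
  (q0 x * q1 q - q1 x * q0 q) ^+ 2 + (q0 x * q2 q - q2 x * q0 q) ^+ 2 +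
  (q0 x * q3 q - q3 x * q0 q) ^+ 2 + (q1 x * q2 q - q2 x * q1 q) ^+ 2 +
  (q1 x * q3 q - q3 x * q1 q) ^+ 2 + (q2 x * q3 q - q3 x * q2 q) ^+ 2.
  by rewrite /quat_sqnorm /qdot; ring.
by rewrite !addr_ge0 ?sqr_ge0.
Qed.

Lemma qdot_continuous q : continuous (qdot q).
Proof.
move=> x; apply/(@cvgrPdist_lt _ _ _ (nbhs x)) => e e0; have q1 : 0 < `|q| + 1 by rewrite ltr_wpDl.
apply/nbhs_normP; exists (e / (`|q| + 1)) => /=; first by rewrite divr_gt0.
move=> y /=; rewrite ltr_pdivlMr// => xy; rewrite -linearB.
apply: (le_lt_trans (qdot_le _ _)); apply: le_lt_trans xy.
by rewrite ler_wpM2l// lerDl.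
Qed.

Lemma quat_scalar_norm (a : R) : `|a%:A : quat R| = `|a|.
Proof.
rewrite normrZ quat_normE /quat_sqnorm /= expr1n expr0n /= !addr0 sqrtr1 mulr1.
by [].
Qed.

Lemma quat_le_sum x : `|x| <= `|q0 x| + `|q1 x| + `|q2 x| + `|q3 x|.
Proof.
rewrite -(ler_pXn2r (n := 2))// ?nnegrE ?addr_ge0// quat_norm_sq /quat_sqnorm.
rewrite -(real_normK (num_real (q0 x))) -(real_normK (num_real (q1 x))).
rewrite -(real_normK (num_real (q2 x))) -(real_normK (num_real (q3 x))).
have := normr_ge0 (q0 x); have := normr_ge0 (q1 x); have := normr_ge0 (q2 x); have := normr_ge0 (q3 x).
move: `|q0 x| `|q1 x| `|q2 x| `|q3 x| => a b c d a0 b0 c0 d0; rewrite -subr_ge0.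
have -> : (a + b + c + d) ^+ 2 - (a ^+ 2 + b ^+ 2 + c ^+ 2 + d ^+ 2) =
  2 * (a * b + a * c + a * d + b * c + b * d + c * d) by ring.
by rewrite mulr_ge0// !addr_ge0// mulr_ge0.
Qed.

Definition cart i (p : R * R) : quat R := p.1%:A + p.2 *: i.

Lemma imag_sphere_sq i : imag_sphere i -> q0 i = 0 /\ q1 i ^+ 2 + q2 i ^+ 2 + q3 i ^+ 2 = 1.
Proof.
move=> [i0 i1]; split=> //; have := quat_norm_sq i; rewrite i1 expr1n /quat_sqnorm.
by rewrite (_ : q0 i = 0)// expr0n /= add0r.
Qed.

Lemma imag_sphere_mul i : imag_sphere i -> i * i = - 1.
Proof.
case: i => a b c d /imag_sphere_sq /= [-> H].
by apply: quatP; rewrite /= -1?H; ring.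
Qed.

Lemma cart_norm i p : imag_sphere i -> `|cart i p| ^+ 2 = p.1 ^+ 2 + p.2 ^+ 2.
Proof.
move=> iS; rewrite quat_norm_sq /quat_sqnorm /cart /=; move: iS.
case: i => a b c d /imag_sphere_sq /= [-> H].
rewrite !mulr0 !addr0 mulr1 !add0r !exprMn -!addrA -!mulrDr !addrA H mulr1.
by [].
Qed.

Lemma cart_disc i p : imag_sphere i -> (`|cart i p| < 1) = (p.1 ^+ 2 + p.2 ^+ 2 < 1).
Proof. by move=> iS; rewrite -(cart_norm i)// expr_lt1. Qed.

Lemma cart_Re i p : imag_sphere i -> quat_Re (cart i p) = p.1.
Proof. by move=> [i0 _]; rewrite /cart /quat_Re /= mulr1 [q0 i]i0 mulr0 addr0. Qed.

Lemma cart_Im i p : imag_sphere i -> quat_Im (cart i p) = p.2 *: i.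
Proof.
by case: i => a b c d [/= -> _]; apply: quatP; rewrite /= ?mulr0 ?add0r.
Qed.

Lemma cart_imag_unit s : s = cart (imag_unit s) (quat_Re s, `|quat_Im s|).
Proof. exact: imag_unitE. Qed.

Lemma polar_cis i r t : cart i (polar r t) = r *: cis i t.
Proof. by rewrite /cart /cis /polar /= scalerDr !scalerA. Qed.

Lemma qdot_mul i q x : imag_sphere i -> qdot q (i * x) = - qdot (i * q) x.
Proof.
case: i => a b c d [/= i0 _]; rewrite /quat_Re /= in i0; rewrite i0 /qdot /=; ring.
Qed.

(** Left multiplication by a unit [i] is an isometry as well as skew-adjoint, which is why the
    pairings of [f] with [q] and with [i * q] form a conjugate pair. *)
Lemma qdot_mul2 i q x : imag_sphere i -> qdot (i * q) (i * x) = qdot q x.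
Proof.
move=> iS; rewrite qdot_mul// mulrA imag_sphere_mul// mulN1r.
by rewrite /qdot /=; ring.
Qed.

End Quaternions.

(** * Complex differentiability on a slice *)

Section Slice.
Context {R : realType}.
Implicit Types (f : quat R -> quat R) (q i s : quat R) (p h : R * R).

Lemma cart_is_diff i p : is_diff p (cart i) (cart i).
Proof.
have -> : cart i = fun p => p.1 *: (1 : quat R) + p.2 *: i by [].
have d1 : is_diff p (fst : R * R -> R) fst.
  have cf : continuous (fst : R * R -> R) by move=> z; exact: cvg_fst.
  by apply: DiffDef; [exact: (linear_differentiable _ cf)|exact: (diff_lin _ cf)].
have d2 : is_diff p (snd : R * R -> R) snd.
  have cf : continuous (snd : R * R -> R) by move=> z; exact: cvg_snd.
  by apply: DiffDef; [exact: (linear_differentiable _ cf)|exact: (diff_lin _ cf)].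
have s1 := is_diff_scalel p.1 (1 : quat R).
have s2 := is_diff_scalel p.2 i.
exact: (is_diffD (is_diff_comp d1 s1) (is_diff_comp d2 s2)).
Qed.

Lemma qdot_is_diff q x : is_diff x (qdot q) (qdot q).
Proof.
by apply: DiffDef; [exact: (linear_differentiable _ (qdot_continuous q))|
  exact: (diff_lin _ (qdot_continuous q))].
Qed.

Lemma qdot_eq (x y : quat R) : (forall q, qdot q x = qdot q y) -> x = y.
Proof.
move=> H; apply: quatP.
- by have := H (Quat 1 0 0 0); rewrite /qdot /= !mulr1 !mulr0 !addr0.
- by have := H (Quat 0 1 0 0); rewrite /qdot /= !mulr1 !mulr0 !addr0 !add0r.
- by have := H (Quat 0 0 1 0); rewrite /qdot /= !mulr1 !mulr0 !addr0 !add0r.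
- by have := H (Quat 0 0 0 1); rewrite /qdot /= !mulr1 !mulr0 !add0r.
Qed.

Lemma has_deriv_qdot q (h : R -> quat R) (u : R) : derivable h u 1 ->
  has_deriv (fun t => qdot q (h t)) u (qdot q (derive1 h u)).
Proof.
move=> dh; have dh' : is_diff u h ('d h u).
  by apply: DiffDef => //; exact/derivable1_diffP.
apply: has_deriv_diff; apply: (is_diff_eq (is_diff_comp dh' (qdot_is_diff q _))).
by apply/funext => t /=; rewrite deriv1E// linearZ mulrC.
Qed.

Lemma has_deriv_near_eq (g k : R -> R) (x a b : R) : (\near x, g x = k x) ->
  has_deriv g x a -> has_deriv k x b -> a = b.
Proof.
move=> gk ga kb.
have ka := near_eq_is_derive gk ga.
by rewrite -(@derive_val _ _ _ _ _ _ _ ka) -(@derive_val _ _ _ _ _ _ _ kb).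
Qed.

(** The representation of [f] is given for v = |Im x| >= 0. Parity of [al] and [be] carries it to v
    < 0; at v = 0, where the unit is a default value, oddness forces [be] to vanish. *)
Lemma slice_expansion f (al be : R -> R -> quat R) i p :
  (forall x, `|x| < 1 -> f x = al (quat_Re x) `|quat_Im x| +
    imag_unit x * be (quat_Re x) `|quat_Im x|) ->
  (forall u v : R, u ^+ 2 + v ^+ 2 < 1 -> al u (- v) = al u v /\ be u (- v) = - be u v) ->
  imag_sphere i -> p.1 ^+ 2 + p.2 ^+ 2 < 1 ->
  f (cart i p) = al p.1 p.2 + i * be p.1 p.2.
Proof.
move=> fE par iS pd; rewrite fE ?cart_disc//.
have i1 : `|i| = 1 by case: iS.
have i0 : i != 0 by rewrite -normr_eq0 i1 oner_eq0.
rewrite cart_Re// /imag_unit cart_Im// scaler_eq0 (negbTE i0) orbF normrZ i1 mulr1.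
have [p2|p2|p2] := ltrgt0P p.2.
- by rewrite scalerA mulVf ?scale1r// gt_eqF.
- have [-> ->] := par _ _ pd.
  by rewrite invrN scaleNr scalerA mulVf ?lt_eqF// scale1r mulrNN.
- have [_ H] := par _ _ pd; rewrite p2 oppr0 in H.
  have b0 : be p.1 0 = 0.
    have : be p.1 0 *+ 2 = 0 by rewrite mulr2n {1}H addNr.
    rewrite -scaler_nat => /eqP; rewrite scaler_eq0 pnatr_eq0 /= => /eqP; exact.
  by rewrite p2 b0 !mulr0.
Qed.

Lemma disc_near1 p : p.1 ^+ 2 + p.2 ^+ 2 < 1 -> \forall u \near p.1, u ^+ 2 + p.2 ^+ 2 < 1.
Proof.
move=> pd; have c : {for p.1, continuous (fun u : R => u * u + p.2 * p.2)}.
  exact: has_deriv_cvg (has_derivD (has_derivM (has_deriv_id _) (has_deriv_id _)) (has_deriv_cst _ _)).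
exact: (cvgr_lt _ c).
Qed.

Lemma disc_near2 p : p.1 ^+ 2 + p.2 ^+ 2 < 1 -> \forall v \near p.2, p.1 ^+ 2 + v ^+ 2 < 1.
Proof.
move=> pd; have pd' : (p.2, p.1).1 ^+ 2 + (p.2, p.1).2 ^+ 2 < 1 by rewrite addrC.
by apply: filterS (disc_near1 _ pd') => v /=; rewrite addrC.
Qed.

(** The equations between [al] and [be] make the derivative in direction [i] equal to [i] times the
    derivative [D] in the real direction. Derivatives are compared coordinatewise through [qdot],
    since [f] and its expansion agree only near the point. *)
Lemma slice_diff f i p : slice_hyperholomorphic f -> imag_sphere i -> p.1 ^+ 2 + p.2 ^+ 2 < 1 ->
  exists D, is_diff p (fun z => f (cart i z)) (fun h => cart i h * D).
Proof.
move=> [df [al [be [fE par CR]]]] iS pd.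
have pd' : `|cart i p| < 1 by rewrite cart_disc.
have fd : is_diff (cart i p) f ('d f (cart i p)) by apply: DiffDef => //; exact: df.
have Fd := is_diff_comp (cart_is_diff i p) fd.
set D1 := 'd f (cart i p) 1; set D2 := 'd f (cart i p) i.
have lin h : 'd f (cart i p) (cart i h) = h.1 *: D1 + h.2 *: D2.
  by rewrite /cart linearD !linearZ.
have Fq q : has_diff (fun z => qdot q (f (cart i z))) p (qdot q D1) (qdot q D2).
  apply: (is_diff_eq (is_diff_comp Fd (qdot_is_diff q _))).
  by apply/funext => h /=; rewrite lin linearD !linearZ /= /GRing.scale /=; ring.
have [[dau dav] [dbu dbv] e1 e2] := CR _ _ pd.
have E1 : D1 = derive1 (al ^~ p.2) p.1 + i * derive1 (be ^~ p.2) p.1.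
  apply: qdot_eq => q; rewrite linearD /= qdot_mul//.
  have := has_derivB (has_deriv_qdot q _ _ dau) (has_deriv_qdot (i * q) _ _ dbu).
  have : has_deriv (fun u => qdot q (f (cart i (u, p.2)))) p.1 (qdot q D1).
    by apply: (@has_diff_sect1 _ (fun z => qdot q (f (cart i z))) _ _ _ (qdot q D2)); rewrite -surjective_pairing.
  apply: has_deriv_near_eq; near=> u.
  rewrite (slice_expansion _ _ _ _ _ fE par)//=; first by rewrite linearD /= qdot_mul.
  by near: u; exact: disc_near1.
have E2 : D2 = derive1 (al p.1) p.2 + i * derive1 (be p.1) p.2.
  apply: qdot_eq => q; rewrite linearD /= qdot_mul//.
  have := has_derivB (has_deriv_qdot q _ _ dav) (has_deriv_qdot (i * q) _ _ dbv).
  have : has_deriv (fun v => qdot q (f (cart i (p.1, v)))) p.2 (qdot q D2).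
    by apply: (@has_diff_sect2 _ (fun z => qdot q (f (cart i z))) _ _ (qdot q D1)); rewrite -surjective_pairing.
  apply: has_deriv_near_eq; near=> v.
  rewrite (slice_expansion _ _ _ _ _ fE par)//=; first by rewrite linearD /= qdot_mul.
  by near: v; exact: disc_near2.
have E3 : D2 = i * D1.
  by rewrite E1 E2 mulrDr mulrA imag_sphere_mul// -e1 e2 mulrN mulN1r opprK addrC.
exists D1; apply: (is_diff_eq Fd); apply/funext => h.
by rewrite /= lin E3 /cart mulrDl -!scalerAl mul1r.
Unshelve. all: by end_near. Qed.

Lemma slice_cauchy_riemann f i p D q : imag_sphere i ->
  is_diff p (fun z => f (cart i z)) (fun h => cart i h * D) ->
  has_diff (fun z => qdot q (f (cart i z))) p (qdot q D) (- qdot (i * q) D) /\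
  has_diff (fun z => qdot (i * q) (f (cart i z))) p (qdot (i * q) D) (qdot q D).
Proof.
move=> iS dF; split.
- apply: (is_diff_eq (is_diff_comp dF (qdot_is_diff q _))); apply/funext => h /=.
  rewrite /cart mulrDl -!scalerAl mul1r linearD !linearZ /= qdot_mul//.
  by rewrite /GRing.scale /=; ring.
- apply: (is_diff_eq (is_diff_comp dF (qdot_is_diff (i * q) _))); apply/funext => h /=.
  rewrite /cart mulrDl -!scalerAl mul1r linearD !linearZ /= qdot_mul2//.
  by rewrite /GRing.scale /=; ring.
Qed.

(** The difference quotient carries its inverse on the left, where it cancels the factor [cart i h]
    of the differential. *)
Lemma slice_derivativeE f s D : is_diff (quat_Re s, `|quat_Im s|)
    (fun z => f (cart (imag_unit s) z)) (fun h => cart (imag_unit s) h * D) ->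
  slice_derivative f s = D.
Proof.
set i := imag_unit s; set p := (_, _); move=> dF.
have iS : imag_sphere i := imag_unit_sphere s.
have sE : s = cart i p := cart_imag_unit s.
(* The limit is unique because the punctured slice accumulates at s: it contains s + e / 2. *)
have pf : ProperFilter (within (slice_plane i) s^').
  apply: Build_ProperFilter_ex => P /nbhs_normP[e /= e0 eP].
  have e2 : 0 < e / 2 by rewrite divr_gt0.
  exists (s + (e / 2)%:A); apply: eP.
  - rewrite /= opprD addrA subrr sub0r normrN quat_scalar_norm gtr0_norm//.
    by rewrite ltr_pdivrMr// ltr_pMr// ltr1n.
  - rewrite -subr_eq0 addrC addKr -normr_eq0 quat_scalar_norm gtr0_norm//.
    by rewrite gt_eqF.
  - exists (quat_Re s + e / 2), `|quat_Im s|.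
    by rewrite [in LHS]sE /cart /= scalerDl addrAC.
apply: cvg_lim; first exact: norm_hausdorff.
apply/cvgrPdist_le => e e0.
have := dF; case=> dFp dE; have /diff_locallyP[_] := dFp.
rewrite dE => /eqaddoP/(_ e e0)/nbhs_normP[d /= d0 dP].
suff : nbhs s [set x | x != s -> slice_plane i x -> `|D - (x - s)^-1 * (f x - f s)| <= e] by [].
apply/nbhs_normP; exists d => //= x /= xs xNs [u [v xE]].
pose h : R * R := (u - p.1, v - p.2).
have eta : x - s = cart i h.
  rewrite xE [in LHS]sE /cart /h; move: p.1 p.2 => a b.
  by apply: quatP; rewrite /=; ring.
(* The plane carries the maximum norm, the quaternions the Euclidean one. *)
have hn : `|h| <= `|x - s|.
  have H := cart_norm i h iS; rewrite -eta in H.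
  rewrite prod_normE ge_max; apply/andP; split.
    rewrite -(ler_pXn2r (n := 2))// ?nnegrE// H real_normK ?num_real// lerDl sqr_ge0//.
  by rewrite -(ler_pXn2r (n := 2))// ?nnegrE// H real_normK ?num_real// lerDr sqr_ge0.
have n0 : 0 < `|x - s| by rewrite normr_gt0 subr_eq0.
have x0 : x - s \is a GRing.unit by rewrite -subr_eq0 in xNs.
have inv_norm : `|(x - s)^-1| = `|x - s|^-1.
  apply: (mulIf (lt0r_neq0 n0)); rewrite -quat_normM mulVr// mulVf ?lt0r_neq0//.
  by rewrite -[1]scale1r quat_scalar_norm normr1.
have fx : f x - f s - (x - s) * D = f (cart i (h + p)) - f (cart i p) - cart i h * D.
  by rewrite -eta -sE xE /h /cart /= !subrK.
have := dP h; rewrite /ball_ /= sub0r normrN => /(_ _).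
rewrite !fctE /= opprD addrA -fx => H.
have {}H : `|f x - f s - (x - s) * D| <= e * `|h|.
  by apply: H; apply: (le_lt_trans hn); rewrite distrC.
have -> : D - (x - s)^-1 * (f x - f s) = - ((x - s)^-1 * (f x - f s - (x - s) * D)).
  by rewrite [in RHS]mulrBr mulrA mulVr// mul1r opprB.
rewrite normrN quat_normM inv_norm ler_pdivrMl// mulrC.
by apply: (le_trans H); rewrite ler_wpM2l// ltW.
Qed.

End Slice.

(** * Hardy bounds on a slice *)

Section SliceHardy.
Context {R : realType}.
Implicit Types (f : quat R -> quat R) (q i s : quat R) (r t : R).

Definition slice_re f i q (z : R * R) : R := qdot q (f (cart i z)).

(** Circular means are bounded only for radii close to one: this is what a finite limit yields, and
    it is stable under differences. *)
Definition hardy_near f i : Prop := exists M r0 : R, [/\ 0 <= r0, r0 < 1 & forall r, r0 < r < 1 ->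
  segint 0 (2 * pi) (fun t => `|f (r *: cis i t)| ^+ 2) <= M].

Let pi0 : 0 < pi :> R. Proof. exact: pi_gt0. Qed.

(** For a primitive P, the function P(x + 2 pi) - P(x) has derivative zero, hence is constant; six
    turns make up the segment. *)
Lemma segint_periodic (phi : R -> R) : (forall a b, continuous_on a b phi) ->
  (forall t, phi (t + 2 * pi) = phi t) ->
  segint (- (6 * pi)) (6 * pi) phi = 6 * segint 0 (2 * pi) phi.
Proof.
move=> cphi per; have pip := pi0.
pose P x := segint (- (8 * pi)) x phi.
have dP x : - (8 * pi) < x < 8 * pi -> has_deriv P x (phi x).
  by move=> xP; exact: segint_primitive xP (cphi _ _).
have FTC a b : - (8 * pi) < a -> a <= b -> b < 8 * pi -> segint a b phi = P b - P a.
  by move=> a8 ab b8; apply: segint_FTC2 => // x xab; apply: dP; lra.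
pose W x := P (x + 2 * pi) - P x.
have dW x : - (6 * pi) <= x <= 4 * pi -> has_deriv W x 0.
  move=> xP; apply: has_deriv_eq.
    apply: has_derivB; last by apply: dP; lra.
    apply: (has_deriv_comp (has_derivD (has_deriv_id x) (has_deriv_cst _ x)) (dP (x + 2 * pi) _)).
    by lra.
  by rewrite per addr0 mulr1 subrr.
have cW a : - (6 * pi) <= a -> a <= 4 * pi -> W a = W (- (6 * pi)).
  move=> a1 a2; apply/eqP; rewrite -subr_eq0; apply/eqP.
  rewrite -(segint_FTC2 (F := W) (f := fun=> 0) a1 (continuous_on_cst 0)).
    by rewrite segint_cst// mul0r.
  by move=> x xP; apply: dW; lra.
have W0 : segint 0 (2 * pi) phi = W (- (6 * pi)).
  rewrite FTC; [|lra..]; rewrite -(cW 0) /W ?add0r//; lra.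
rewrite FTC; [|lra..]; rewrite W0.
have E k : - (6 * pi) <= k -> k <= 4 * pi -> P (k + 2 * pi) = P k + W (- (6 * pi)).
  by move=> k1 k2; rewrite -(cW k k1 k2) /W; ring.
set w := W _ in E *.
have e1 : P (6 * pi) = P (4 * pi) + w by rewrite -E; [congr P; ring|lra..].
have e2 : P (4 * pi) = P (2 * pi) + w by rewrite -E; [congr P; ring|lra..].
have e3 : P (2 * pi) = P 0 + w by rewrite -E; [congr P; ring|lra..].
have e4 : P 0 = P (- (2 * pi)) + w by rewrite -E; [congr P; ring|lra..].
have e5 : P (- (2 * pi)) = P (- (4 * pi)) + w by rewrite -E; [congr P; ring|lra..].
have e6 : P (- (4 * pi)) = P (- (6 * pi)) + w by rewrite -E; [congr P; ring|lra..].
rewrite e1 e2 e3 e4 e5 e6; generalize (P (- (6 * pi))) w => x y; ring.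
Qed.

Lemma slice_pair f i q : slice_hyperholomorphic f -> imag_sphere i ->
  forall z, z.1 ^+ 2 + z.2 ^+ 2 < 1 -> cauchy_riemann (slice_re f i q) (slice_re f i (i * q)) z.
Proof.
move=> sf iS z zd; have [D dD] := slice_diff f i z sf iS zd.
have [d1 d2] := slice_cauchy_riemann f i z D q iS dD.
by exists (qdot q D), (qdot (i * q) D).
Qed.

Lemma quat_norm_basis (x : quat R) : `|x| ^+ 2 = qdot (Quat 1 0 0 0) x ^+ 2 +
  qdot (Quat 0 1 0 0) x ^+ 2 + qdot (Quat 0 0 1 0) x ^+ 2 + qdot (Quat 0 0 0 1) x ^+ 2.
Proof. by rewrite quat_norm_sq /quat_sqnorm /qdot /=; ring. Qed.

Lemma continuous_on_slice_sq f i r : slice_hyperholomorphic f -> imag_sphere i -> 0 <= r < 1 ->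
  forall a b, continuous_on a b (fun t => `|f (r *: cis i t)| ^+ 2).
Proof.
move=> sf iS r01 a b.
have c q : continuous_on a b (fun t => qdot q (f (r *: cis i t)) ^+ 2).
  have H := continuous_polar1 _ _ (slice_pair f i q sf iS) r r01 a b.
  rewrite (_ : (fun t => _) = (fun t => slice_re f i q (polar r t) * slice_re f i q (polar r t))).
    exact: continuous_onM.
  by apply/funext => t; rewrite /slice_re polar_cis expr2.
rewrite (_ : (fun t => _) = (fun t => qdot (Quat 1 0 0 0) (f (r *: cis i t)) ^+ 2 +
  qdot (Quat 0 1 0 0) (f (r *: cis i t)) ^+ 2 + qdot (Quat 0 0 1 0) (f (r *: cis i t)) ^+ 2 +
  qdot (Quat 0 0 0 1) (f (r *: cis i t)) ^+ 2)).
  by do 3!(apply: continuous_onD; last exact: c); exact: c.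
by apply/funext => t; exact: quat_norm_basis.
Qed.

Lemma cis_period i t : cis i (t + 2 * pi) = cis i t.
Proof. by rewrite /cis (mulrC 2) mulr_natr cosD2pi sinD2pi. Qed.

(** Near radius one, U^2 + V^2 <= 2 |f|^2 over six periods gives 12 M. On the remaining radii the
    integrand is continuous on a compact rectangle. *)
Lemma square_mean_bound f i q : slice_hyperholomorphic f -> imag_sphere i -> hardy_near f i ->
  `|q| <= 1 -> exists M : R, forall r, 0 <= r < 1 ->
    square_mean (slice_re f i q) (slice_re f i (i * q)) r <= M.
Proof.
move=> sf iS [M [r0 [r00 r01 HM]]] q1; have pip := pi0.
set U := slice_re f i q; set V := slice_re f i (i * q).
have crUV := slice_pair f i q sf iS.
have iq1 : `|i * q| <= 1 by rewrite quat_normM; case: iS => _ ->; rewrite mul1r.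
have LL : - (6 * pi) <= 6 * pi :> R by lra.
have cUV r : 0 <= r < 1 -> forall a b,
    continuous_on a b (fun t => U (polar r t) * U (polar r t) + V (polar r t) * V (polar r t)).
  move=> rP a b; have c1 := continuous_polar1 U V crUV r rP a b.
  have c2 := continuous_polar2 U V crUV r rP a b.
  exact: continuous_onD (continuous_onM c1 c1) (continuous_onM c2 c2).
have near1 r : r0 < r < 1 -> square_mean U V r <= 2 * (6 * M).
  move=> /andP[ra rb]; have rP : 0 <= r < 1 by rewrite rb (le_trans r00 (ltW ra)).
  have cs := continuous_on_slice_sq f i r sf iS rP.
  apply: (@le_trans _ _ (segint (- (6 * pi)) (6 * pi) (fun t => 2 * `|f (r *: cis i t)| ^+ 2))).
    apply: le_segint; first exact: cUV.
      exact: continuous_onM (continuous_on_cst _) (cs _ _).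
    have sq x (p : quat R) : `|p| <= 1 -> qdot p x * qdot p x <= `|x| ^+ 2.
      move=> p1; rewrite -expr2 -(real_normK (num_real _)) lerXn2r ?nnegrE//.
      by apply: (le_trans (qdot_le _ _)); rewrite -[leRHS]mulr1 ler_wpM2l.
    move=> t _; rewrite -polar_cis mulr_natl mulr2n.
    by apply: lerD; exact: sq.
  rewrite (segintZ _ (cs _ _)) ler_wpM2l// (segint_periodic _ cs).
    by rewrite ler_wpM2l// HM// ra.
  by move=> t; rewrite cis_period.
pose r1 := (1 + r0) / 2.
have r1P : r0 < r1 < 1 by rewrite /r1; lra.
pose F (z : R * R) : R := U (polar z.1 z.2) * U (polar z.1 z.2) + V (polar z.1 z.2) * V (polar z.1 z.2).
have cF z : 0 <= z.1 < 1 -> {for z, continuous F}.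
  case: z => r t /= rP; have /andP[ra rb] := rP.
  have [|a [b [Ua Vb]]] := crUV (polar r t); first by rewrite polar_sq expr_lt1.
  have X := has_diff_fst (r, t); have T := has_diff_snd (r, t).
  have C := has_diff_comp1 T (has_deriv_cos t); have S := has_diff_comp1 T (has_deriv_sin t).
  have U' := has_diff_comp2 (has_diffM X C) (has_diffM X S) Ua.
  have V' := has_diff_comp2 (has_diffM X C) (has_diffM X S) Vb.
  exact: has_diff_continuous (has_diffD (has_diffM U' U') (has_diffM V' V')).
pose A := `[0, r1]%classic `*` `[- (6 * pi), 6 * pi]%classic : set (R * R).
have [||| c _ cP] := @compact_EVT_max (R * R)%type R F A.
- exists (0, 0); split; rewrite /= in_itv /=; have /andP[? ?] := r1P; lra.
- by apply: compact_setX; exact: segment_compact.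
- apply: continuous_in_subspaceT => z; rewrite inE /A /= !in_itv /= => -[/andP[z1 z2] _].
  by apply: cF; rewrite z1 (le_lt_trans z2)//; case/andP: r1P.
exists (Num.max (2 * (6 * M)) (F c * (6 * pi - - (6 * pi)))) => r rP.
rewrite le_max; have [rr|rr] := ltP r0 r; first by rewrite near1// rr; case/andP: rP.
apply/orP; right; rewrite -segint_cst//; apply: le_segint; [exact: cUV|exact: continuous_on_cst|].
move=> t tP; apply: (cP (r, t)); rewrite inE /A /= !in_itv /=; split => //.
by have /andP[? ?] := rP; have /andP[? ?] := r1P; lra.
Qed.

Lemma slice_boundary f i : slice_hyperholomorphic f -> imag_sphere i -> hardy_near f i ->
  exists g : quat R -> R -> R, forall q, `|q| <= 1 ->
    (@lebesgue_measure R).-integrable setT (EFin \o g q) /\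
    forall th r, `|th| <= 4 * pi -> 0 <= r < 1 ->
    2 * pi * slice_re f i q (polar r th) = 2 * pi * poisson r pi * slice_re f i q (0, 0) -
      segint (- pi) pi (fun t => dpoisson r t * segint (- (6 * pi)) (th + t) (g q)).
Proof.
move=> sf iS fH.
have ex q : exists g : R -> R, `|q| <= 1 ->
    (@lebesgue_measure R).-integrable setT (EFin \o g) /\
    forall th r, `|th| <= 4 * pi -> 0 <= r < 1 ->
    2 * pi * slice_re f i q (polar r th) = 2 * pi * poisson r pi * slice_re f i q (0, 0) -
      segint (- pi) pi (fun t => dpoisson r t * segint (- (6 * pi)) (th + t) g).
  have [q1|q1] := leP `|q| 1; last by exists (fun=> 0).
  have [M HM] := square_mean_bound f i q sf iS fH q1.
  have [g ig gP] := boundary_function _ _ _ (slice_pair f i q sf iS) HM.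
  by exists g.
by have [g gP] := choice ex; exists g.
Qed.

End SliceHardy.

(** * Mean oscillation *)

Section BoundaryValues.
Context {R : realType}.
Local Notation mu := (@lebesgue_measure R).
Implicit Types (f : quat R -> quat R) (q i s : quat R) (r t : R).

(** Restricting to finitely many directions lets a single null set serve all of them. *)
Definition quat_basis q : Prop :=
  [\/ q = Quat 1 0 0 0, q = Quat 0 1 0 0, q = Quat 0 0 1 0 | q = Quat 0 0 0 1].

Lemma quat_basis_norm q : quat_basis q -> `|q| <= 1.
Proof.
by case=> ->; rewrite quat_normE /quat_sqnorm /= expr1n expr0n /= ?addr0 ?add0r sqrtr1.
Qed.

Lemma quat_le_basis (x : quat R) (k : R) : (forall q, quat_basis q -> `|qdot q x| <= k) -> `|x| <= 4 * k.
Proof.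
move=> H; apply: (le_trans (quat_le_sum x)).
have h0 := H _ (Or41 _ _ _ erefl); have h1 := H _ (Or42 _ _ _ erefl).
have h2 := H _ (Or43 _ _ _ erefl); have h3 := H _ (Or44 _ _ _ erefl).
move: h0 h1 h2 h3; rewrite /qdot /= !mulr0 !mulr1 !add0r !addr0; lra.
Qed.

(* No measurability is needed for [k]: the integral of a nonnegative function is
   a supremum over the simple functions below it. *)
Lemma le_integral_sub (A D : set R) (h k : R -> \bar R) : A `<=` D ->
  (forall x, A x -> 0 <= h x)%E -> (forall x, D x -> 0 <= k x)%E ->
  (forall x, A x -> h x <= k x)%E ->
  (\int[mu]_(x in A) h x <= \int[mu]_(x in D) k x)%E.
Proof.
move=> AD h0 k0 hk; rewrite !ge0_integralE//.
apply: le_ereal_sup => _ [s sh <-]; exists s => // x; apply: (le_trans (sh x)).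
rewrite !patchE; case: ifPn => [/set_mem Ax|_].
  by rewrite mem_set; [exact: hk|exact: AD].
by case: ifPn => // /set_mem; exact: k0.
Qed.

Section Slice.
Variables (f : quat R -> quat R) (i : quat R) (g : quat R -> R -> R).
Hypothesis ig : forall q, quat_basis q -> mu.-integrable setT (EFin \o g q).
Hypothesis gP : forall q, quat_basis q -> forall th r, `|th| <= 4 * pi -> 0 <= r < 1 ->
  2 * pi * slice_re f i q (polar r th) = 2 * pi * poisson r pi * slice_re f i q (0, 0) -
    segint (- pi) pi (fun t => dpoisson r t * segint (- (6 * pi)) (th + t) (g q)).

Let pi0 : 0 < pi :> R. Proof. exact: pi_gt0. Qed.

(** Outside the union of four null sets the primitive of each coordinate has derivative [g q], and
    radial convergence of the coordinates is that of [f]. *)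
Lemma boundary_valueE : exists2 N : set R, measurable N /\ mu N = 0%E &
  forall t, `|t| <= 4 * pi -> ~ N t -> forall q, quat_basis q ->
    qdot q (boundary_value f i t) = g q t.
Proof.
have [K K0 KP] := @poisson_den_sq_bound R.
have b1 : quat_basis (Quat 1 0 0 0) by exact: Or41.
have b2 : quat_basis (Quat 0 1 0 0) by exact: Or42.
have b3 : quat_basis (Quat 0 0 1 0) by exact: Or43.
have b4 : quat_basis (Quat 0 0 0 1) by exact: Or44.
have ae q (bq : quat_basis q) := ae_has_deriv_primitive (g q) (ig q bq).
have [N [mN N0 NP]] := negligibleU (negligibleU (ae _ b1) (ae _ b2)) (negligibleU (ae _ b3) (ae _ b4)).
exists N => // t tP Nt.
have dG q : quat_basis q -> has_deriv (fun x => segint (- (6 * pi)) x (g q)) t (g q t).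
  move=> bq; have Lt : - (6 * pi) < t by move: tP; rewrite ler_norml => /andP[? ?]; have := pi0; lra.
  apply: contrapT => nd; apply: Nt; apply: NP.
  have nH : ~ (- (6 * pi) < t -> has_deriv (fun x => segint (- (6 * pi)) x (g q)) t (g q t)) by move=> /(_ Lt).
  by case: bq nH => -> nH; [left; left|left; right|right; left|right; right].
pose l : quat R := Quat (g (Quat 1 0 0 0) t) (g (Quat 0 1 0 0) t) (g (Quat 0 0 1 0) t) (g (Quat 0 0 0 1) t).
have lq q : quat_basis q -> qdot q l = g q t.
  by case=> ->; rewrite /qdot /l /= !mulr0 !mulr1 ?addr0 ?add0r.
suff -> : boundary_value f i t = l by [].
apply: cvg_lim; first exact: norm_hausdorff.
apply/cvgrPdist_le => e e0; have e4 : 0 < e / 4 by rewrite divr_gt0.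
have rad q : quat_basis q -> \forall r \near (1 : R)^'-, `|slice_re f i q (polar r t) - g q t| <= e / 4.
  move=> bq; have [d d0 dP] := radial_limit _ _ (ig q bq) (gP q bq) K K0 KP t tP (dG q bq) _ e4.
  near=> r; apply: dP; last by near: r; exact: nbhs_left_ltBl.
  by apply/andP; split; near: r; [exact: nbhs_left_ge|exact: nbhs_left_lt].
have r1 := rad _ b1; have r2 := rad _ b2; have r3 := rad _ b3; have r4 := rad _ b4.
near=> r; rewrite (_ : e = 4 * (e / 4)); last by field.
apply: quat_le_basis => q bq; rewrite linearB /= lq// distrC -polar_cis.
by case: bq => ->; [near: r; exact: r1|near: r; exact: r2|near: r; exact: r3|near: r; exact: r4].
Unshelve. all: by end_near. Qed.

(** The second difference is the integral of [g q] over the right half of the interval minus that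
    over the left half. Both have length t, so the mean [c] can be subtracted from the integrand;
    the integral of |g - c| is then controlled by that of its square. *)
Lemma zygmund_oscillation q (B th t : R) : quat_basis q -> 0 < B -> `|th| <= 2 * pi -> 0 < t <= pi ->
  (oscillation f i (th - t) (th + t) <= (B ^+ 2)%:E)%E ->
  `|segint (- (6 * pi)) (th + t) (g q) + segint (- (6 * pi)) (th - t) (g q) -
    2 * segint (- (6 * pi)) th (g q)| <= 2 * B * t.
Proof.
move=> bq B0 thP /andP[t0 tpi] osc.
have [N [mN N0] NP] := boundary_valueE.
move: thP; rewrite ler_norml => /andP[th1 th2].
set a := th - t in osc *; set b := th + t in osc *.
have bE : b - a = 2 * t by rewrite /a /b; ring.
have ab2 : 0 < b - a by rewrite bE mulr_gt0.
have aP : - (3 * pi) <= a by rewrite /a; have := pi0; lra.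
have bP : b <= 3 * pi by rewrite /b; have := pi0; lra.
have ath : a <= th by rewrite /a; lra.
have thb : th <= b by rewrite /b; lra.
set m := interval_mean f i a b in osc; pose c : R := qdot q m.
have mg : measurable_fun setT (g q).
  by have /integrableP[/measurable_EFinP] := ig q bq.
have iS (A : set R) : measurable A -> mu.-integrable A (EFin \o g q).
  by move=> mA; exact: (@integrableS _ _ _ mu setT _ _ measurableT mA _ (ig q bq)).
pose h x : R := (g q x - c) ^+ 2.
have mh A : measurable A -> measurable_fun A (fun x => (h x)%:E).
  move=> mA; apply/measurable_EFinP; apply: measurable_funX.
  by apply: measurable_funB; [exact: measurable_funS mg|exact: measurable_cst].
have h0 x : 0 <= h x by exact: sqr_ge0.
have int_h : (\int[mu]_(x in `]a, b[) (h x)%:E <= (B ^+ 2 * (2 * t))%:E)%E.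
  (* The null set is removed on the side of the measurable function [h]; [boundary_value] is
     afterwards only compared pointwise. *)
  rewrite (@ge0_negligible_integral _ _ _ mu `]a, b[ N)//; last 2 first.
  - exact: mh.
  - by move=> x _; rewrite lee_fin.
  apply: (@le_trans _ _ (\int[mu]_(x in `]a, b[) (`|boundary_value f i x - m| ^+ 2)%:E)%E).
    apply: le_integral_sub => //.
    - by move=> x _; rewrite lee_fin.
    - move=> x [/=]; rewrite in_itv /= => /andP[ax xb] Nx.
      have x4 : `|x| <= 4 * pi by rewrite ler_norml; have := pi0; lra.
      rewrite lee_fin /h /c -(NP x x4 Nx q bq) -linearB -(real_normK (num_real _)).
      rewrite lerXn2r ?nnegrE//; apply: (le_trans (qdot_le _ _)).
      by rewrite -[leRHS]mulr1 ler_wpM2l// quat_basis_norm.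
  move: osc; rewrite /oscillation lee_pdivrMl//.
  by rewrite -/m bE -EFinM mulrC.
have cint (A : set R) : measurable A -> (mu A < +oo)%E -> mu.-integrable A (EFin \o (fun=> c : R)).
  move=> mA muA; apply: measurable_bounded_integrable => //; last exact: bounded_cst.
have muI (x y : R) : (mu `]x, y] < +oo)%E by rewrite lebesgue_measure_itv /=; case: ifP; rewrite ?ltry.
have iB x y : mu.-integrable `]x, y] (EFin \o (fun z => g q z - c)).
  apply: (@integrableB _ _ _ mu `]x, y] _ (EFin \o g q) (EFin \o (fun=> c))) => //.
    exact: iS.
  exact: cint.
have G x y : - (6 * pi) <= x -> x <= y -> segint (- (6 * pi)) y (g q) - segint (- (6 * pi)) x (g q) =
    \int[mu]_(z in `]x, y]) (g q z - c) + c * (y - x).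
  move=> Lx xy; rewrite !segintE (@Rintegral_itvB R (g q) (BLeft (- (6 * pi))) (BRight y))//.
  - rewrite RintegralB//; [|exact: iS|exact: cint].
    rewrite Rintegral_cst//= lebesgue_measure_itv/= lte_fin.
    move: xy; rewrite le_eqVlt => /predU1P[->|->]; rewrite ?ltxx ?subrr /= ?mulr0 ?addr0 ?subr0//.
    by rewrite subrK.
  - exact: iS.
have -> : segint (- (6 * pi)) b (g q) + segint (- (6 * pi)) a (g q) - 2 * segint (- (6 * pi)) th (g q) =
    (segint (- (6 * pi)) b (g q) - segint (- (6 * pi)) th (g q)) -
    (segint (- (6 * pi)) th (g q) - segint (- (6 * pi)) a (g q)).
  by generalize (segint (- (6 * pi)) b (g q)) (segint (- (6 * pi)) a (g q)) (segint (- (6 * pi)) th (g q)) => x y z; ring.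
rewrite (G th b)//; last by have := pi0; lra.
rewrite (G a th)//; last by have := pi0; lra.
have -> : b - th = t by rewrite /b; ring.
have -> : th - a = t by rewrite /a; ring.
set I1 := \int[mu]_(z in `]th, b]) _; set I2 := \int[mu]_(z in `]a, th]) _.
have -> : I1 + c * t - (I2 + c * t) = I1 - I2 by ring.
pose k x : R := `|g q x - c|.
have ik x y : mu.-integrable `]x, y] (EFin \o k).
  exact: (integrable_norm (iB x y)).
apply: (@le_trans _ _ (\int[mu]_(z in `]a, b]) k z)).
  have -> : \int[mu]_(z in `]a, b]) k z = \int[mu]_(z in `]a, th]) k z + \int[mu]_(z in `]th, b]) k z.
    apply/eqP; rewrite addrC -subr_eq; apply/eqP.
    by apply: (@Rintegral_itvB R k (BRight a) (BRight b) th).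
  apply: (le_trans (ler_normB _ _)); rewrite addrC; apply: lerD.
    by apply: le_normr_Rintegral => //; exact: iB.
  by apply: le_normr_Rintegral => //; exact: iB.
rewrite -lee_fin /Rintegral fineK; last by apply: integrable_fin_num => //; exact: ik.
have mab : mu `]a, b] = (2 * t)%:E.
  by rewrite lebesgue_measure_itv /= lte_fin -subr_gt0 ab2 -EFinD bE.
apply: (@le_trans _ _ (\int[mu]_(x in `]a, b]) ((B / 2)%:E + ((2 * B)^-1)%:E * (h x)%:E)%E)%E).
  apply: ge0_le_integral => //.
  - by move=> x _; rewrite lee_fin /k normr_ge0.
  - by have /integrableP[] := ik a b.
  - apply: emeasurable_funD; first exact: measurable_cst.
    by apply: emeasurable_funM; [exact: measurable_cst|exact: mh].
  - (* AM-GM: [2 B k <= B^2 + k^2] *)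
    move=> x _; rewrite -EFinM -EFinD lee_fin /h -(real_normK (num_real _)) -/(k x).
    rewrite -(ler_pM2l (_ : 0 < 2 * B)) ?mulr_gt0// mulrDr mulVKf ?mulf_neq0 ?gt_eqF//.
    by have := sqr_ge0 (B - k x); rewrite sqrrB; nra.
rewrite ge0_integralD//; last 3 first.
- by move=> x _; rewrite lee_fin divr_ge0 ?(ltW B0).
- by move=> x _; rewrite -EFinM lee_fin mulr_ge0 // invr_ge0 mulr_ge0 // ltW.
- by apply: emeasurable_funM; [exact: measurable_cst|exact: mh].
rewrite integral_cst//= ge0_integralZl//; last 3 first.
- exact: mh.
- by move=> x _; rewrite lee_fin.
- by rewrite lee_fin invr_ge0 mulr_ge0 ?(ltW B0).
rewrite (integral_itv_bndoo false false); last exact: mh.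
(* The two terms of the AM-GM bound contribute B t each. *)
apply: (@le_trans _ _ ((B / 2 * (2 * t))%:E + ((2 * B)^-1 * (B ^+ 2 * (2 * t)))%:E)%E).
  apply: leeD; first by rewrite mab.
  by rewrite [leRHS]EFinM lee_wpmul2l// lee_fin invr_ge0 mulr_ge0 ?(ltW B0).
rewrite -EFinD lee_fin le_eqVlt; apply/orP; left; apply/eqP.
by field; exact: lt0r_neq0.
Qed.

End Slice.
End BoundaryValues.

(** * Gradient bounds on a slice *)

Section SliceGradient.
Context {R : realType}.
Local Notation mu := (@lebesgue_measure R).
Variables (f : quat R -> quat R) (i : quat R) (g : quat R -> R -> R).
Hypothesis iS : imag_sphere i.
Hypothesis ig : forall q, quat_basis q -> mu.-integrable setT (EFin \o g q).
Hypothesis gP : forall q, quat_basis q -> forall th r, `|th| <= 4 * pi -> 0 <= r < 1 ->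
  2 * pi * slice_re f i q (polar r th) = 2 * pi * poisson r pi * slice_re f i q (0, 0) -
    segint (- pi) pi (fun t => dpoisson r t * segint (- (6 * pi)) (th + t) (g q)).
Local Notation G q x := (segint (- (6 * pi)) x (g q)).

Let pi0 : 0 < pi :> R. Proof. exact: pi_gt0. Qed.

Lemma zygmund_oscillation_norm q (B th t : R) : quat_basis q -> 0 < B -> `|th| <= 2 * pi ->
  `|t| <= pi -> (t != 0 -> (oscillation f i (th - `|t|) (th + `|t|) <= (B ^+ 2)%:E)%E) ->
  `|G q (th + t) + G q (th - t) - 2 * G q th| <= 2 * B * `|t|.
Proof.
move=> bq B0 thP tP osc; have [->|t0] := eqVneq t 0.
  rewrite addr0 subr0 normr0 mulr0; generalize (G q th) => x.
  by rewrite (_ : x + x - 2 * x = 0) ?normr0//; ring.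
have tP' : 0 < `|t| <= pi by rewrite normr_gt0 t0.
have := zygmund_oscillation f i g ig gP q B th `|t| bq B0 thP tP' (osc t0).
have [t1|t1] := ltP 0 t; first by rewrite (gtr0_norm t1).
by rewrite (ler0_norm t1) opprK (addrC (G q (th - t))).
Qed.

Lemma zygmund_bmo q (B th t : R) : quat_basis q -> 0 < B -> `|th| <= 2 * pi -> `|t| <= pi ->
  (forall a b, a < b -> b - a <= 2 * pi -> (oscillation f i a b <= (B ^+ 2)%:E)%E) ->
  `|G q (th + t) + G q (th - t) - 2 * G q th| <= 2 * B * `|t| + 0 * t ^+ 4.
Proof.
move=> bq B0 thP tP osc; rewrite mul0r addr0.
apply: zygmund_oscillation_norm => // t0; have t1 : 0 < `|t| by rewrite normr_gt0.
by apply: osc; lra.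
Qed.

(** For |t| < d / 2 the interval has length below d and the small bound [e] applies. For |t| >= d /
    2 the bound 2 B |t| is at most 2 B / (d / 2)^3 t^4, because |t|^3 >= (d / 2)^3. *)
Lemma zygmund_vmo q (B e d th t : R) : quat_basis q -> 0 < B -> 0 < e -> 0 < d ->
  `|th| <= 2 * pi -> `|t| <= pi ->
  (forall a b, a < b -> b - a <= 2 * pi -> (oscillation f i a b <= (B ^+ 2)%:E)%E) ->
  (forall a b, a < b -> b - a < d -> (oscillation f i a b <= (e ^+ 2)%:E)%E) ->
  `|G q (th + t) + G q (th - t) - 2 * G q th| <= 2 * e * `|t| + 2 * B / (d / 2) ^+ 3 * t ^+ 4.
Proof.
move=> bq B0 e0 d0 thP tP oscB osce.
have C0 : 0 <= 2 * B / (d / 2) ^+ 3 by rewrite divr_ge0 ?exprn_ge0 ?mulr_ge0 ?divr_ge0 ?ltW.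
have t4 := exprn4_ge0 t.
have [td|td] := ltP `|t| (d / 2).
  rewrite -[leLHS]addr0; apply: lerD; last exact: mulr_ge0.
  apply: zygmund_oscillation_norm => // t0; have t1 : 0 < `|t| by rewrite normr_gt0.
  by apply: osce; lra.
have H : 2 * B * `|t| <= 2 * B / (d / 2) ^+ 3 * t ^+ 4.
  have -> : t ^+ 4 = `|t| ^+ 3 * `|t| by rewrite -exprSr (exprM t 2 2) (exprM `|t| 2 2) (real_normK (num_real t)).
  rewrite mulrA ler_wpM2r// -mulrA ler_peMr ?mulr_ge0 ?(ltW B0)// mulrC.
  rewrite ler_pdivlMr ?mul1r ?exprn_gt0 ?divr_gt0// lerXn2r// nnegrE//.
  by rewrite divr_ge0// ltW.
apply: (le_trans (zygmund_bmo q B th t bq B0 thP tP oscB)).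
rewrite mul0r addr0; apply: (le_trans H).
by rewrite lerDr mulr_ge0// mulr_ge0// ltW.
Qed.

Variable K : R.
Hypothesis K0 : 0 <= K.
Hypothesis den_bound : forall r t : R, 0 <= r < 1 -> `|t| <= pi ->
  ((1 - r) ^+ 2 + t ^+ 2) ^+ 2 <= K * poisson_den r t ^+ 2.
Variables B C : R.
Hypothesis B0 : 0 <= B.
Hypothesis C0 : 0 <= C.
Hypothesis zygmund : forall q, quat_basis q -> forall th t : R, `|th| <= 2 * pi -> `|t| <= pi ->
  `|G q (th + t) + G q (th - t) - 2 * G q th| <= 2 * B * `|t| + C * t ^+ 4.

(** [E] is the unit tangent i e^{i th}, so [qdot q (E * D) * r] is the angular derivative of the
    coordinate; the factor r also occurs in the Lipschitz bound and cancels. As |D| = |E D|, the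
    four coordinates account for the factor 4. *)
Lemma slice_gradient_le (r th : R) (D : quat R) : 0 < r < 1 -> `|th| <= pi ->
  is_diff (polar r th) (fun z => f (cart i z)) (fun h => cart i h * D) ->
  `|D| <= 4 * (10 * K * B / (1 - r ^+ 2) + 5 * K * C * (1 - r ^+ 2)).
Proof.
move=> /andP[r0 r1] thP dF; move: (thP); rewrite ler_norml => /andP[th1 th2].
set bd := 10 * K * B / (1 - r ^+ 2) + 5 * K * C * (1 - r ^+ 2).
pose E := cart i (- sin th, cos th).
have E1 : `|E| = 1.
  apply/eqP; rewrite -(@eqrXn2 _ 2)// expr1n; apply/eqP.
  by rewrite /E cart_norm//= sqrrN addrC cos2Dsin2.
have -> : `|D| = `|E * D| by rewrite quat_normM E1 mul1r.
apply: quat_le_basis => q bq.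
have [dq _] := slice_cauchy_riemann f i _ D q iS dF.
have r01 : 0 <= r < 1 by rewrite r1 ltW.
have H := has_deriv_le (bd * r) pi (has_deriv_polar _ r th _ _ dq) pi0.
rewrite -(ler_pM2r r0) -{1}(gtr0_norm r0) -normrM.
have -> : qdot q (E * D) * r = qdot q D * - (r * sin th) + - qdot (i * q) D * (r * cos th).
  have -> : E * D = - sin th *: D + cos th *: (i * D) by rewrite /E /cart mulrDl -!scalerAl mul1r.
  rewrite linearD !linearZ /= qdot_mul// /GRing.scale /=.
  by generalize (qdot q D) (qdot (i * q) D) (sin th) (cos th) => x y s c; ring.
apply: H => t /andP[t0 tpi].
have := radial_lipschitz _ _ (ig q bq) (gP q bq) K K0 den_bound B C B0 C0 (zygmund q bq) r th (th + t) r01.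
rewrite -/bd (addrC th) addrK => -> //; lra.
Qed.

(** At the origin the angular derivative carries no information. Instead t i and -t i are joined by
    a half circle of length pi; the Lipschitz bound on it has a factor t, hence bounds the
    derivative in direction [i]. *)
Lemma slice_gradient_center_le (D : quat R) :
  is_diff (0, 0) (fun z => f (cart i z)) (fun h => cart i h * D) ->
  `|D| <= 4 * (30 * K * B + 10 * K * C).
Proof.
move=> dF; have i1 : `|i| = 1 by case: iS.
have -> : `|D| = `|i * D| by rewrite quat_normM i1 mul1r.
apply: quat_le_basis => q bq.
have [dq _] := slice_cauchy_riemann f i _ D q iS dF.
rewrite qdot_mul// normrN; set X := qdot (i * q) D in dq *.
have s : has_deriv (fun v => slice_re f i q (0, v)) 0 (- X) by exact: has_diff_sect2 dq.
have sN : has_deriv (fun v => slice_re f i q (0, - v)) 0 X.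
  apply: has_deriv_eq.
    apply: (has_deriv_comp (has_derivN (has_deriv_id 0)) (_ : has_deriv (fun v => slice_re f i q (0, v)) (- 0) (- X))).
    by rewrite oppr0.
  by rewrite mulrN1 opprK.
have p4 : pi <= 4 :> R by have := @pihalf_lt2 R; lra.
have h0 : 0 < 2^-1 :> R by rewrite invr_gt0.
have H := has_deriv_le (2 * (30 * K * B + 10 * K * C)) 2^-1 (has_derivB s sN) h0.
(* For t < 1/2 and pi <= 4: 10 * 4/3 <= 15 and 15 * 4 = 2 * 30, while 5 * 4 = 2 * 10. *)
have : `|- X - X| <= 2 * (30 * K * B + 10 * K * C).
  apply: H => t /andP[t0 th]; rewrite !add0r oppr0 subrr subr0.
  have t01 : 0 <= t < 1 by rewrite (ltW t0) /=; apply: (lt_trans th); rewrite invf_lt1// ltr1n.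
  have t2 : t ^+ 2 <= 1 / 4.
    rewrite (_ : 1 / 4 = 2^-1 ^+ 2); last by field.
    by rewrite lerXn2r ?nnegrE ?(ltW t0) ?(ltW th) ?invr_ge0.
  have t2' : 0 <= t ^+ 2 by exact: sqr_ge0.
  have lip := radial_lipschitz _ _ (ig q bq) (gP q bq) K K0 den_bound B C B0 C0 (zygmund q bq)
    t (- (pi / 2)) (pi / 2) t01.
  have e1 : polar t (pi / 2) = (0, t) by rewrite /polar cos_pihalf sin_pihalf mulr0 mulr1.
  have e2 : polar t (- (pi / 2)) = (0, - t) by rewrite /polar cosN sinN cos_pihalf sin_pihalf mulr0 mulrN1.
  rewrite e1 e2 in lip.
  have l1 : - (2 * pi) <= - (pi / 2) :> R by have := pi0; lra.
  have l2 : - (pi / 2) <= pi / 2 :> R by have := pi0; lra.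
  have l3 : pi / 2 <= 2 * pi :> R by have := pi0; lra.
  apply: (le_trans (lip l1 l2 l3)).
  rewrite (_ : pi / 2 - - (pi / 2) = pi); last by field.
  have KB : 0 <= K * B by exact: mulr_ge0.
  have KC : 0 <= K * C by exact: mulr_ge0.
  have i2 : (1 - t ^+ 2)^-1 <= 4 / 3.
    rewrite -[leLHS]mul1r ler_pdivrMr; lra.
  have b1 : 10 * K * B / (1 - t ^+ 2) <= 15 * (K * B).
    apply: (@le_trans _ _ (10 * (K * B) * (4 / 3))); last by lra.
    by rewrite -(mulrA 10 K B) ler_wpM2l// mulr_ge0.
  have b2 : 5 * K * C * (1 - t ^+ 2) <= 5 * (K * C).
    by rewrite -!mulrA ler_wpM2l// mulrA ler_piMr//; lra.
  rewrite mulrAC ler_wpM2r ?(ltW t0)//.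
  apply: (@le_trans _ _ ((15 * (K * B) + 5 * (K * C)) * 4)); last by lra.
  apply: ler_pM => //; [|exact: ltW|exact: lerD].
  rewrite addr_ge0// ?mulr_ge0// ?mulr_ge0// ?invr_ge0; lra.
rewrite (_ : - X - X = - (2 * X)); last by ring.
by rewrite normrN normrM ger0_norm// ler_pM2l.
Qed.

End SliceGradient.

(** * The Bloch estimates *)

Section SliceBloch.
Context {R : realType}.
Implicit Types (f : quat R -> quat R) (i : quat R) (p : R * R).

Lemma polar_exists p (r : R) : 0 < r -> p.1 ^+ 2 + p.2 ^+ 2 = r ^+ 2 ->
  exists2 th, `|th| <= pi & polar r th = p.
Proof.
case: p => u v /= r0 E; have rn : r != 0 by rewrite gt_eqF.
have u1 : -1 <= u / r <= 1.
  rewrite -ler_norml -(ler_pXn2r (n := 2))// ?nnegrE// expr1n real_normK ?num_real//.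
  by rewrite expr_div_n ler_pdivrMr ?exprn_gt0// mul1r -E lerDl sqr_ge0.
have vE : r * Num.sqrt (1 - (u / r) ^+ 2) = `|v|.
  rewrite -{1}(gtr0_norm r0) -sqrtr_sqr -sqrtrM ?sqr_ge0// -sqrtr_sqr; congr Num.sqrt.
  by rewrite mulrBr mulr1 -exprMn mulrC divfK// -E addrC addKr.
have a0 : 0 <= acos (u / r) <= pi by rewrite acos_ge0 ?acos_lepi.
have [v0|v0] := leP 0 v.
  exists (acos (u / r)); first by rewrite ger0_norm; case/andP: a0.
  by rewrite /polar acosK// sin_acos// vE ger0_norm// mulrC divfK.
exists (- acos (u / r)); first by rewrite normrN ger0_norm; case/andP: a0.
by rewrite /polar cosN sinN acosK// sin_acos// mulrN vE ltr0_norm// opprK mulrC divfK.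
Qed.

(** The constant 120 K is 4 * 30 K from the origin and exceeds the 40 K of the other points. It is
    chosen before [f] and [i], so the bound is uniform over slices. *)
Lemma bmo_gradient : exists2 C : R, 0 <= C & forall f i B, slice_hyperholomorphic f ->
  imag_sphere i -> hardy_near f i -> 0 < B ->
  (forall a b, a < b -> b - a <= 2 * pi -> (oscillation f i a b <= (B ^+ 2)%:E)%E) ->
  forall p D, p.1 ^+ 2 + p.2 ^+ 2 < 1 ->
    is_diff p (fun z => f (cart i z)) (fun h => cart i h * D) ->
    (1 - (p.1 ^+ 2 + p.2 ^+ 2)) * `|D| <= C * B.
Proof.
have [K K0 KP] := @poisson_den_sq_bound R.
exists (120 * K); first by rewrite mulr_ge0.
move=> f i B sf iS fH B0 osc p D pd dF.
have [g gP] := slice_boundary f i sf iS fH.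
have ig q (bq : quat_basis q) := (gP q (quat_basis_norm q bq)).1.
have pg q (bq : quat_basis q) := (gP q (quat_basis_norm q bq)).2.
have zyg q (bq : quat_basis q) th t thP tP := zygmund_bmo f i g ig pg q B th t bq B0 thP tP osc.
have [s0|s0] := eqVneq (p.1 ^+ 2 + p.2 ^+ 2) 0.
  have p0 : p = (0, 0).
    move: s0 => /eqP; rewrite paddr_eq0 ?sqr_ge0// !sqrf_eq0 => /andP[/eqP x /eqP y].
    by case: p x y {pd dF} => u v /= -> ->.
  rewrite s0 subr0 mul1r; rewrite p0 in dF.
  apply: (le_trans (slice_gradient_center_le f i g iS ig pg K K0 KP B 0 (ltW B0) (lexx 0) zyg D dF)).
  by rewrite mulr0 addr0 !mulrA -natrM.
set s := p.1 ^+ 2 + p.2 ^+ 2 in s0 pd *.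
have s1 : 0 < s by rewrite lt_def s0 /s addr_ge0 ?sqr_ge0.
pose r := Num.sqrt s.
have r0 : 0 < r by rewrite sqrtr_gt0.
have rs : r ^+ 2 = s by rewrite sqr_sqrtr// ltW.
have r1 : r < 1 by rewrite -(expr_lt1 (n := 2))// ?rs// ltW.
have [th thP E] := polar_exists p r r0 (esym rs).
have r01 : 0 < r < 1 by rewrite r0.
rewrite -E in dF.
have := slice_gradient_le f i g iS ig pg K K0 KP B 0 (ltW B0) (lexx 0) zyg r th D r01 thP dF.
have s2 : 0 < 1 - s by rewrite subr_gt0.
rewrite rs mulr0 mul0r addr0 mulrA ler_pdivlMr// mulrC => /le_trans; apply.
by rewrite !mulrA ler_wpM2r ?(ltW B0)// ler_wpM2r// -natrM ler_nat.
Qed.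

(** The Zygmund bound 2 k |t| + C t^4 yields 40 K k + 20 K C (1 - |p|^2)^2. Here k depends on [e]
    and [K] only; it determines d, hence C, and the distance to the boundary is fixed last so as to
    make the second term small. *)
Lemma vmo_gradient f i (B e : R) : slice_hyperholomorphic f ->
  imag_sphere i -> hardy_near f i -> 0 < B ->
  (forall a b, a < b -> b - a <= 2 * pi -> (oscillation f i a b <= (B ^+ 2)%:E)%E) ->
  (forall k : R, 0 < k -> exists2 d : R, 0 < d &
    forall a b : R, a < b -> b - a < d -> (oscillation f i a b < k%:E)%E) ->
  0 < e -> exists2 s : R, 0 <= s < 1 & forall p D, s < p.1 ^+ 2 + p.2 ^+ 2 < 1 ->
    is_diff p (fun z => f (cart i z)) (fun h => cart i h * D) ->
    (1 - (p.1 ^+ 2 + p.2 ^+ 2)) * `|D| <= e.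
Proof.
move=> sf iS fH B0 osc vosc e0.
have [K K0 KP] := @poisson_den_sq_bound R.
have [g gP] := slice_boundary f i sf iS fH.
have ig q (bq : quat_basis q) := (gP q (quat_basis_norm q bq)).1.
have pg q (bq : quat_basis q) := (gP q (quat_basis_norm q bq)).2.
(* With this [k], and [h] below, each of the two terms is at most e / 2; the [+ 1] keeps the
   denominators positive. *)
pose k := e / (80 * K + 1).
have K1 : 0 < 80 * K + 1 by rewrite ltr_wpDl// mulr_ge0.
have k0 : 0 < k by rewrite divr_gt0.
have [d d0 dP] := vosc (k ^+ 2) (exprn_gt0 2 k0).
have osc2 a b ab bd : (oscillation f i a b <= (k ^+ 2)%:E)%E := ltW (dP a b ab bd).
pose C := 2 * B / (d / 2) ^+ 3.
have C0 : 0 <= C by apply: divr_ge0; [rewrite mulr_ge0// ltW|rewrite exprn_ge0// divr_ge0// ltW].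
have zyg q (bq : quat_basis q) th t thP tP :=
  zygmund_vmo f i g ig pg q B k d th t bq B0 k0 d0 thP tP osc osc2.
pose h := e / (40 * K * C + 1).
have K2 : 0 < 40 * K * C + 1 by rewrite ltr_wpDl// (mulr_ge0 (mulr_ge0 _ K0) C0).
have h0 : 0 < h by rewrite divr_gt0.
exists (Num.max 0 (1 - h)).
  by rewrite le_max lexx /= gt_max ltr01 ltrBlDr ltrDl.
move=> p D; set s := p.1 ^+ 2 + p.2 ^+ 2; rewrite gt_max => /andP[/andP[s0 sh] s1] dF.
pose r := Num.sqrt s.
have r0 : 0 < r by rewrite sqrtr_gt0.
have rs : r ^+ 2 = s by rewrite sqr_sqrtr// ltW.
have r1 : r < 1 by rewrite -(expr_lt1 (n := 2))// ?rs// ltW.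
have [th thP E] := polar_exists p r r0 (esym rs).
have r01 : 0 < r < 1 by rewrite r0.
rewrite -E in dF.
have := slice_gradient_le f i g iS ig pg K K0 KP k C (ltW k0) C0 zyg r th D r01 thP dF.
rewrite rs => H; have t0 : 0 < 1 - s by rewrite subr_gt0.
have th' : 1 - s < h by rewrite ltrBlDr addrC -ltrBlDr.
set t := 1 - s in H t0 th' *.
apply: (@le_trans _ _ (t * (4 * (10 * K * k / t + 5 * K * C * t)))); first by rewrite ler_pM2l.
have -> : t * (4 * (10 * K * k / t + 5 * K * C * t)) = 40 * K * k + 20 * K * C * t ^+ 2.
  by field; rewrite gt_eqF.
have b1 : 80 * K * k <= e.
  by rewrite /k mulrA ler_pdivrMr// mulrC ler_pM2l// lerDl.
have b2 : 40 * K * C * t ^+ 2 <= e.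
  apply: (@le_trans _ _ (40 * K * C * h)).
    rewrite ler_wpM2l ?(mulr_ge0 (mulr_ge0 _ K0) C0)//; apply: le_trans (ltW th').
    by rewrite expr2 ler_piMr ?(ltW t0)// /t gerBl ltW.
  by rewrite /h mulrA ler_pdivrMr// mulrC ler_pM2l// lerDl.
have -> : 40 * K * k + 20 * K * C * t ^+ 2 = (80 * K * k + 40 * K * C * t ^+ 2) / 2 by field.
by rewrite ler_pdivrMr// mulr_natr mulr2n lerD.
Qed.

End SliceBloch.

(** * The inclusions and their continuity *)

Section Bloch.
Context {R : realType}.
Local Notation mu := (@lebesgue_measure R).
Implicit Types (f g : quat R -> quat R) (i s : quat R) (p : R * R).

Let pi0 : 0 < pi :> R. Proof. exact: pi_gt0. Qed.

Lemma circle_meanE f i (r : R) : slice_hyperholomorphic f -> imag_sphere i -> 0 <= r < 1 ->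
  circle_mean f i r = ((2 * pi)^-1 * segint 0 (2 * pi) (fun t => `|f (r *: cis i t)| ^+ 2))%:E.
Proof.
move=> sf iS r01; have cf := continuous_on_slice_sq f i r sf iS r01 0 (2 * pi).
rewrite /circle_mean EFinM segintE; congr (_ * _)%E.
by rewrite /Rintegral fineK//; apply: integrable_fin_num => //; exact: continuous_on_integrable cf.
Qed.

(** The limit lies below a finite supremum, so the means stay below some [M] on a left neighbourhood
    of 1. *)
Lemma hardy_near_hardy2 f i : hardy2 f -> imag_sphere i -> hardy_near f i.
Proof.
move=> [sf cf supf] iS; have pip := pi0.
have lt_l : (lim (circle_mean f i r @[r --> 1^'-]) < +oo)%E.
  by apply: le_lt_trans supf; apply: ereal_sup_ubound; exists i.
have [M lM] : exists M : R, (lim (circle_mean f i r @[r --> 1^'-]) < M%:E)%E.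
  move: lt_l; case: (lim _) => [l _| //|_]; last by exists 0; rewrite ltNyr.
  by exists (l + 1); rewrite lte_fin ltrDl.
have /nbhs_normP[d /= d0 dP] := cf i iS _ (open_ereal_lt' lM).
exists (2 * pi * M), (Num.max 0 (1 - d)); split.
- by rewrite le_max lexx.
- by rewrite gt_max ltr01 ltrBlDr ltrDl.
move=> r; rewrite gt_max => /andP[/andP[r0 rd] r1].
have rb : `|1 - r| < d by rewrite ger0_norm ?subr_ge0 ?ltW// ltrBlDr addrC -ltrBlDr.
have := dP r rb r1; rewrite /= circle_meanE//; last by rewrite r1 ltW.
rewrite lte_fin.
by rewrite ltr_pdivrMl ?mulr_gt0// => /ltW.
Qed.

Lemma derive1B (h k : R -> quat R) (x : R) : derivable h x 1 -> derivable k x 1 ->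
  derive1 (fun t => h t - k t) x = derive1 h x - derive1 k x.
Proof. by move=> dh dk; rewrite !derive1E -(deriveB dh dk). Qed.

Lemma slice_hyperholomorphicB f g : slice_hyperholomorphic f -> slice_hyperholomorphic g ->
  slice_hyperholomorphic (g \- f).
Proof.
move=> [df [al [be [fE par CR]]]] [dg [al' [be' [gE par' CR']]]]; split.
  by move=> x x1; apply: differentiableB; [exact: dg|exact: df].
exists (fun u v => al' u v - al u v), (fun u v => be' u v - be u v); split.
- by move=> x x1; rewrite /= fE// gE// mulrBr opprD addrACA.
- move=> u v uv; have [-> ->] := par u v uv; have [-> ->] := par' u v uv.
  by split=> //; rewrite opprB opprK addrC.
- move=> u v uv; have [[a1 a2] [b1 b2] e1 e2] := CR u v uv.
  have [[a1' a2'] [b1' b2'] e1' e2'] := CR' u v uv.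
  split; [by split; exact: derivableB|by split; exact: derivableB|..].
    by rewrite (derive1B _ _ _ a1' a1) (derive1B _ _ _ b2' b2) e1 e1'.
  by rewrite (derive1B _ _ _ b1' b1) (derive1B _ _ _ a2' a2) e2 e2' opprB opprK addrC.
Qed.

(** Pointwise, |x - y|^2 <= 2 |x|^2 + 2 |y|^2. *)
Lemma hardy_nearB f g i : slice_hyperholomorphic f -> slice_hyperholomorphic g -> imag_sphere i ->
  hardy_near f i -> hardy_near g i -> hardy_near (g \- f) i.
Proof.
move=> sf sg iS [M [r [r0 r1 H]]] [M' [r' [r0' r1' H']]].
exists (2 * M' + 2 * M), (Num.max r r'); split.
- by rewrite le_max r0.
- by rewrite gt_max r1.
move=> s; rewrite gt_max => /andP[/andP[rs rs'] s1].
have s01 : 0 <= s < 1 by rewrite s1 (le_trans r0 (ltW rs)).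
have cf := continuous_on_slice_sq f i s sf iS s01 0 (2 * pi).
have cg := continuous_on_slice_sq g i s sg iS s01 0 (2 * pi).
have ch := continuous_on_slice_sq _ i s (slice_hyperholomorphicB f g sf sg) iS s01 0 (2 * pi).
have cst2 := @continuous_on_cst R 0 (2 * pi) 2.
apply: (le_trans (le_segint ch (continuous_onD (continuous_onM cst2 cg) (continuous_onM cst2 cf)) _)).
  move=> t _ /=; move: (g _) (f _) => x y.
  apply: (@le_trans _ _ ((`|x| + `|y|) ^+ 2)); first by rewrite lerXn2r ?nnegrE ?addr_ge0 ?ler_normB.
  by have := sqr_ge0 (`|x| - `|y|); nra.
rewrite (segintD (continuous_onM cst2 cg) (continuous_onM cst2 cf)).
rewrite (segintZ 2 cg) (segintZ 2 cf).
have h' := H' s; rewrite rs' s1 in h'; have h := H s; rewrite rs s1 in h.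
exact: lerD (ler_wpM2l (ler0n _ 2) (h' isT)) (ler_wpM2l (ler0n _ 2) (h isT)).
Qed.

Lemma slice_derivative_bound f s (C : R) : slice_hyperholomorphic f -> `|s| < 1 ->
  (forall p D, p.1 ^+ 2 + p.2 ^+ 2 = `|s| ^+ 2 ->
    is_diff p (fun z => f (cart (imag_unit s) z)) (fun h => cart (imag_unit s) h * D) ->
    (1 - (p.1 ^+ 2 + p.2 ^+ 2)) * `|D| <= C) ->
  (1 - `|s| ^+ 2) * `|slice_derivative f s| <= C.
Proof.
move=> sf s1 H; have iS := imag_unit_sphere s.
have sE : (quat_Re s, `|quat_Im s|).1 ^+ 2 + (quat_Re s, `|quat_Im s|).2 ^+ 2 = `|s| ^+ 2.
  by rewrite -(cart_norm (imag_unit s) _ iS) -cart_imag_unit.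
have [|D dD] := slice_diff f _ (quat_Re s, `|quat_Im s|) sf iS; first by rewrite sE expr_lt1.
by rewrite (slice_derivativeE f s D dD) -sE; exact: H.
Qed.

Lemma oscillation_le_seminorm f i (B : R) : imag_sphere i -> 0 < B -> (bmosh_seminorm f <= B%:E)%E ->
  forall a b, a < b -> b - a <= 2 * pi -> (oscillation f i a b <= (B ^+ 2)%:E)%E.
Proof.
move=> iS B0 fB a b ab b2.
have : (bmosh_slice_seminorm f i <= B%:E)%E.
  by apply: le_trans fB; apply: ereal_sup_ubound; exists i.
rewrite -{1}(gtr0_norm B0) -abse_EFin -sqrte_sqr lee_sqrt ?sqre_ge0//.
by apply: le_trans; apply: ereal_sup_ubound; exists (a, b).
Qed.

Lemma bmosh_seminorm_ge0 f : (0 <= bmosh_seminorm f)%E.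
Proof.
apply: (@le_trans _ _ (bmosh_slice_seminorm f (imag_unit 0))); first exact: sqrte_ge0.
by apply: ereal_sup_ubound; exists (imag_unit 0) => //; exact: imag_unit_sphere.
Qed.

(** The hypothesis is [hardy_near] on every slice rather than membership in [bmosh], so that the
    estimate applies to differences of two functions. The constant C + 1 is positive and, being at
    least 1, also covers |f 0|. *)
Lemma bloch_le_bmosh : exists2 C : R, 0 < C & forall f, slice_hyperholomorphic f ->
  (forall i, imag_sphere i -> hardy_near f i) -> (bmosh_seminorm f < +oo)%E ->
  (bloch_norm f <= C%:E * bmosh_norm f)%E.
Proof.
have [C C0 HC] := @bmo_gradient R; exists (C + 1); first by rewrite ltr_wpDl.
move=> f sf fH fS; have := bmosh_seminorm_ge0 f; rewrite /bmosh_norm.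
have fin : bmosh_seminorm f \is a fin_num by rewrite ge0_fin_numE// bmosh_seminorm_ge0.
rewrite -(fineK fin); set S := fine _; rewrite lee_fin => S0.
rewrite -EFinD -EFinM mulrDr EFinD /bloch_norm; apply: leeD.
  by rewrite lee_fin ler_peMl// lerDr.
apply: ge_ereal_sup => _ [s /= s1 <-]; rewrite lee_fin.
apply: (@le_trans _ _ (C * S)); last by rewrite ler_wpM2r// lerDl.
apply: slice_derivative_bound => // p D pE dD; apply/ler_addgt0Pr => e e0.
have C1 : 0 < C + 1 by rewrite ltr_wpDl.
(* The gradient bound takes a positive [B], whereas the seminorm may be 0; the excess e / (C + 1)
   costs at most [e]. *)
pose B := S + e / (C + 1); have B0 : 0 < B by rewrite ltr_wpDl// divr_gt0.
have iS := imag_unit_sphere s.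
have SB : (bmosh_seminorm f <= B%:E)%E by rewrite -(fineK fin) lee_fin lerDl divr_ge0// ltW.
apply: (le_trans (HC f _ B sf iS (fH _ iS) B0 (oscillation_le_seminorm f _ B iS B0 SB) p D _ dD)).
  by rewrite pE expr_lt1.
rewrite mulrDr lerD2l mulrCA ler_piMr ?(ltW e0)// ler_pdivrMr// mul1r lerDl.
exact: ler01.
Qed.

(* The derivative of the representation formula
   [f (u + v i) = (1 - i j) / 2 * f (u + v j) + (1 + i j) / 2 * f (u - v j)]. *)
Lemma slice_derivative_representation f i j p (D D1 D2 : quat R) : slice_hyperholomorphic f ->
  imag_sphere i -> imag_sphere j -> p.1 ^+ 2 + p.2 ^+ 2 < 1 ->
  is_diff p (fun z => f (cart i z)) (fun h => cart i h * D) ->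
  is_diff p (fun z => f (cart j z)) (fun h => cart j h * D1) ->
  is_diff (p.1, - p.2) (fun z => f (cart j z)) (fun h => cart j h * D2) ->
  `|D| <= `|D1| + `|D2|.
Proof.
move=> [_ [al [be [fE par _]]]] iS jS pd dD dD1 dD2.
pose rep (x y : quat R) := 2^-1 *: (x + y) - 2^-1 *: (i * (j * (x - y))).
suff -> : D = rep D1 D2.
  apply: (le_trans (ler_normB _ _)); rewrite !normrZ ger0_norm ?invr_ge0// !quat_normM.
  have [[_ ->] [_ ->]] := (iS, jS); rewrite !mul1r -mulrDr mulrC ler_pdivrMr// mulr_natr mulr2n.
  by apply: lerD; [exact: ler_normD|exact: ler_normB].
apply: qdot_eq => q.
have repE x y : qdot q (rep x y) =
    2^-1 * (qdot q x + qdot q y) - 2^-1 * (qdot (j * (i * q)) x - qdot (j * (i * q)) y).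
  have L z : qdot q (i * (j * z)) = qdot (j * (i * q)) z by rewrite !qdot_mul// opprK.
  have E z (c : R) : qdot q (z - c *: (i * (j * (x - y)))) =
      qdot q z - c * (qdot (j * (i * q)) x - qdot (j * (i * q)) y).
    by rewrite linearB linearZ /= L linearB.
  have S : qdot q (x + y) = qdot q x + qdot q y by rewrite linearD.
  by rewrite /rep E linearZ /= S.
have s1 h k (E : quat R) (v : R) : is_diff (p.1, v) (fun z => f (cart h z)) (fun z => cart h z * E) ->
    imag_sphere h -> has_deriv (fun u => qdot k (f (cart h (u, v)))) p.1 (qdot k E).
  move=> dE hS; have [dq _] := slice_cauchy_riemann f h _ E k hS dE.
  exact: has_diff_sect1 dq.
have dD' : is_diff (p.1, p.2) (fun z => f (cart i z)) (fun h => cart i h * D) by rewrite -surjective_pairing.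
have dD1' : is_diff (p.1, p.2) (fun z => f (cart j z)) (fun h => cart j h * D1) by rewrite -surjective_pairing.
rewrite repE; have H1 k := s1 j k D1 p.2 dD1' jS; have H2 k := s1 j k D2 (- p.2) dD2 jS.
have := has_derivB (has_derivZ 2^-1 (has_derivD (H1 q) (H2 q)))
  (has_derivZ 2^-1 (has_derivB (H1 (j * (i * q))) (H2 (j * (i * q))))).
apply: has_deriv_near_eq (s1 i q D p.2 dD' iS).
near=> u; rewrite -repE; congr qdot.
have ud : u ^+ 2 + p.2 ^+ 2 < 1 by near: u; exact: disc_near1.
have E k v : imag_sphere k -> u ^+ 2 + v ^+ 2 < 1 -> f (cart k (u, v)) = al u v + k * be u v.
  by move=> kS uv; exact: (slice_expansion _ _ _ _ (u, v) fE par kS uv).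
have [a1 b1] := par u p.2 ud.
rewrite !E ?sqrrN// a1 b1 mulrN; move: (al _ _) (be _ _) => x y.
have e1 : x + j * y + (x - j * y) = 2 *: x by rewrite addrACA subrr addr0 scaler_nat mulr2n.
have e2 : x + j * y - (x - j * y) = 2 *: (j * y).
  by rewrite opprD opprK addrACA subrr add0r scaler_nat mulr2n.
rewrite /rep e1 e2 -!scalerAr !scalerA mulVf ?pnatr_eq0// !scale1r (mulrA j) imag_sphere_mul//.
by rewrite mulN1r mulrN opprK.
Unshelve. all: by end_near. Qed.

(** Both inclusions carry the same pair of norms, so only the inclusion of sets distinguishes them;
    the estimate is applied to the difference. *)
Lemma bmosh_continuously_included (A B : set (quat R -> quat R)) : A `<=` bmosh -> A `<=` B ->
  continuously_included A B bmosh_norm bloch_norm.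
Proof.
move=> Abm AB; split=> // f Af e e0; have [C C0 HC] := bloch_le_bmosh.
exists (e / C); first by rewrite divr_gt0.
move=> g Ag gf; have [hf _] := Abm f Af; have [hg _] := Abm g Ag.
have [sf _ _] := hf; have [sg _ _] := hg.
have fin : (bmosh_seminorm (g \- f)%R < +oo)%E.
  apply: le_lt_trans (lt_trans gf (ltry _)).
  by rewrite /bmosh_norm -[leLHS]add0e leeD2r// lee_fin.
apply: le_lt_trans (HC _ (slice_hyperholomorphicB f g sf sg) _ fin) _.
  by move=> i iS; apply: hardy_nearB => //; exact: hardy_near_hardy2.
by rewrite -lte_pdivlMl// mulrC EFinM in gf *.
Qed.

Lemma bmosh_sub_bloch : bmosh `<=` @bloch R.
Proof.
move=> f [hf fS]; have [C C0 HC] := bloch_le_bmosh; have [sf _ _] := hf.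
split=> //; apply: le_lt_trans (HC f sf (fun i => hardy_near_hardy2 f i hf) fS) _.
have fin : bmosh_seminorm f \is a fin_num by rewrite ge0_fin_numE// bmosh_seminorm_ge0.
by rewrite /bmosh_norm -(fineK fin) -EFinD -EFinM ltry.
Qed.

(** The threshold for small oscillation is taken on a single slice [j]. A point of any slice has the
    same modulus as its two companions p and conj p on [j], whose derivatives bound the one at hand;
    hence one radius serves all slices. *)
Lemma vmosh_sub_little_bloch : vmosh `<=` @little_bloch R.
Proof.
move=> f [bf vf]; split; first exact: bmosh_sub_bloch.
have [hf fS] := bf; have [sf _ _] := hf; move=> e e0.
have [j jS] : exists j : quat R, imag_sphere j by exists (imag_unit 0); exact: imag_unit_sphere.
have fH := hardy_near_hardy2 f j hf jS.
have S0 := bmosh_seminorm_ge0 f.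
have fin : bmosh_seminorm f \is a fin_num by rewrite ge0_fin_numE.
pose B := fine (bmosh_seminorm f) + 1; have B0 : 0 < B by rewrite ltr_wpDl// fine_ge0.
have SB : (bmosh_seminorm f <= B%:E)%E by rewrite -(fineK fin) lee_fin lerDl.
(* Two companion derivatives contribute e / 4 each, and e / 2 < e gives the strict inequality. *)
have e4 : 0 < e / 4 by rewrite divr_gt0.
have [s /andP[s0 s1] sP] := vmo_gradient f j B (e / 4) sf jS fH B0
  (oscillation_le_seminorm f j B jS B0 SB) (vf j jS) e4.
exists (Num.sqrt s); first by rewrite -(sqrtr1 R) ltr_sqrt.
move=> x sx x1; have iS := imag_unit_sphere x.
apply: (@le_lt_trans _ _ (e / 2)); last by rewrite ltr_pdivrMr// ltr_pMr// ltr1n.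
apply: slice_derivative_bound => // p D pE dD.
have pd : p.1 ^+ 2 + p.2 ^+ 2 < 1 by rewrite pE expr_lt1.
have pd' : (p.1, - p.2).1 ^+ 2 + (p.1, - p.2).2 ^+ 2 < 1 by rewrite /= sqrrN.
have [D1 dD1] := slice_diff f j p sf jS pd.
have [D2 dD2] := slice_diff f j _ sf jS pd'.
have sp : s < p.1 ^+ 2 + p.2 ^+ 2 < 1.
  by rewrite pd andbT pE -(sqr_sqrtr s0) ltrXn2r// nnegrE sqrtr_ge0.
have h1 := sP p D1 sp dD1.
have h2 : (1 - (p.1 ^+ 2 + p.2 ^+ 2)) * `|D2| <= e / 4.
  by have := sP _ D2 _ dD2; rewrite /= sqrrN; apply.
have t0 : 0 <= 1 - (p.1 ^+ 2 + p.2 ^+ 2) by rewrite subr_ge0 ltW.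
apply: (le_trans (ler_wpM2l t0 (slice_derivative_representation f _ j p D D1 D2 sf iS jS pd dD dD1 dD2))).
by rewrite mulrDr (_ : e / 2 = e / 4 + e / 4) ?lerD//; field.
Qed.

End Bloch.

Theorem lemma6p3 (R : realType) :
  [/\ exists2 C : R, 0 < C &
        forall f : quat R -> quat R, bmosh f ->
          (bloch_norm f <= C%:E * bmosh_norm f)%E,
      continuously_included bmosh (@bloch R) bmosh_norm bloch_norm &
      continuously_included vmosh (@little_bloch R) bmosh_norm bloch_norm].
Proof.
split.
- have [C C0 HC] := @bloch_le_bmosh R; exists C => // f [hf fS]; have [sf _ _] := hf.
  by apply: HC => // i; exact: hardy_near_hardy2.
- exact: bmosh_continuously_included bmosh_sub_bloch.
- by apply: bmosh_continuously_included vmosh_sub_little_bloch => f [].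
Qed.
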